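(* Let $R(t)\in\mathbb{C}(t)$ satisfy $R(0)=0$, $R'(0)\in\{0\}\cup\{\text{roots of unity}\}$, and suppose that no iterate $R^{\circ n}$ ($n\geq1$) equals the identity $t$. Suppose there exist $f\in\mathbb{C}((t))$ and $a\in\mathbb{C}(t)$ such that $f(R(t))=a(t)f(t)$. Then either $f$ is algebraic over $\mathbb{C}(t)$ and there exists a positive integer $N$ such that $f^N\in\mathbb{C}(t)$, or $f$ is differentially transcendental over $\mathbb{C}(t)$.
   Context: Rational functions are identified with their expansions in $\mathbb{C}((t))$. For $f=\sum_n f_nt^n\in\mathbb{C}((t))$, $f(R(t)):=\sum_n f_nR(t)^n$. Derivative is $\frac{d}{dt}$. $f$ is differentially transcendental over $\mathbb{C}(t)$ if there is no $n\geq0$ and nonzero polynomial $P$ in $n+1$ variables over $\mathbb{C}(t)$ with $P(f,f',\dots,f^{(n)})=0$.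
   Formalization: The rational function R(t) is additionally assumed nonzero: for R = 0 the expression f(R(t)) is undefined when f has a pole, and the claim fails, e.g. for a = 0 and f = log(1+t). *)

(* Defs.v *)
From HB Require Import structures.
From mathcomp Require Import all_boot all_order all_algebra generic_quotient.
From mathcomp Require Import complex mpoly.
From mathcomp Require Import boolp classical_sets functions cardinality fsbigop.
From mathcomp Require Import reals.
From mathcomp Require Import zify.

Set Implicit Arguments.
Unset Strict Implicit.
Unset Printing Implicit Defensive.

Import Order.TTheory GRing.Theory Num.Theory.
Local Open Scope ring_scope.

(* F((t)): two-sided coefficient sequences vanishing far enough to the left. *)
Definition bounded_below (F : fieldType) (h : int -> F) : bool :=
  `[< exists m : int, forall n, n < m -> h n = 0 >].

Record laurent (F : fieldType) := Laurent {
  lcoef :> int -> F;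
  lcoef_bounded : bounded_below lcoef }.

HB.instance Definition _ (F : fieldType) := [isSub for @lcoef F].
HB.instance Definition _ (F : fieldType) := [Choice of laurent F by <:].

Section LaurentField.
Variable F : fieldType.
Implicit Types (f g h : laurent F) (a b n m : int).

Definition vanish_below a (h : int -> F) := forall n, n < a -> h n = 0.

Lemma bounded_belowP (h : int -> F) a : vanish_below a h -> bounded_below h.
Proof. by move=> ha; apply/asboolP; exists a. Qed.

Lemma laurent_below f : exists a, vanish_below a f.
Proof. by case: f => h /= /asboolP. Qed.

Lemma laurentP f g : (forall n, f n = g n) -> f = g.
Proof. by move=> fg; apply/val_inj/funext. Qed.

Lemma vanish_belowW a b (h : int -> F) :
  b <= a -> vanish_below a h -> vanish_below b h.
Proof. by move=> ba ha n nb; apply: ha; apply: lt_le_trans ba. Qed.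

Lemma laurent_below2 f g : exists a, vanish_below a f /\ vanish_below a g.
Proof.
have [a fa] := laurent_below f; have [b gb] := laurent_below g.
exists (Num.min a b); split.
  by apply: vanish_belowW fa; rewrite ge_min lexx.
by apply: vanish_belowW gb; rewrite ge_min lexx orbT.
Qed.

Lemma vanish_belowN a f : vanish_below a f -> vanish_below a (fun n => - f n).
Proof. by move=> fa n na; rewrite fa ?oppr0. Qed.

Lemma vanish_belowD a f g : vanish_below a f -> vanish_below a g ->
  vanish_below a (fun n => f n + g n).
Proof. by move=> fa ga n na; rewrite fa ?ga ?addr0. Qed.

Fact lzero_subproof : bounded_below (fun _ : int => 0 : F).
Proof. exact: (@bounded_belowP _ 0). Qed.
Definition lzero := Laurent lzero_subproof.

Fact lopp_subproof f : bounded_below (fun n => - f n).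
Proof. by have [a /vanish_belowN/bounded_belowP] := laurent_below f. Qed.
Definition lopp f := Laurent (lopp_subproof f).

Fact ladd_subproof f g : bounded_below (fun n => f n + g n).
Proof.
by have [a [fa ga]] := laurent_below2 f g; apply: bounded_belowP (vanish_belowD fa ga).
Qed.
Definition ladd f g := Laurent (ladd_subproof f g).

Fact laddA : associative ladd.
Proof. by move=> f g h; apply: laurentP => n /=; rewrite addrA. Qed.
Fact laddC : commutative ladd.
Proof. by move=> f g; apply: laurentP => n /=; rewrite addrC. Qed.
Fact ladd0 : left_id lzero ladd.
Proof. by move=> f; apply: laurentP => n /=; rewrite add0r. Qed.
Fact laddN : left_inverse lzero lopp ladd.
Proof. by move=> f; apply: laurentP => n /=; rewrite addNr. Qed.

HB.instance Definition _ := GRing.isZmodule.Build (laurent F) laddA laddC ladd0 laddN.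

Lemma lcoef0 n : (0 : laurent F) n = 0. Proof. by []. Qed.
Lemma lcoefN f n : (- f) n = - f n. Proof. by []. Qed.
Lemma lcoefD f g n : (f + g) n = f n + g n. Proof. by []. Qed.

(* Cauchy product; the sum over all of Z has finite support. *)
Definition cauchy_prod (f g : int -> F) : int -> F :=
  fun n => \sum_(i \in [set: int]) (f i * g (n - i)).

(* t^-a f modulo t^M *)
Definition ltrunc a (M : nat) (h : int -> F) : {poly F} :=
  \poly_(i < M) h (a + i%:Z).

Lemma cauchy_prod_below a b (f g : int -> F) :
  vanish_below a f -> vanish_below b g -> vanish_below (a + b) (cauchy_prod f g).
Proof.
move=> fa gb n nab; apply: fsbig1 => i _.
have [ia|ai] := ltP i a; first by rewrite fa ?mul0r.
by rewrite gb ?mulr0//; lia.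
Qed.

Lemma cauchy_prodE a b (f g : int -> F) (k M : nat) :
  vanish_below a f -> vanish_below b g -> (k < M)%N ->
  cauchy_prod f g (a + b + k%:Z) = (ltrunc a M f * ltrunc b M g)`_k.
Proof.
move=> fa gb kM; rewrite /cauchy_prod coefM.
rewrite (fsbigE (map (fun i : nat => a + i%:Z) (iota 0 k.+1))) //; first last.
- move=> i _ /mapP ni.
  have [ia|ai] := ltP i a; first by rewrite fa ?mul0r.
  rewrite gb ?mulr0//; apply: contrapT => /negP; rewrite -leNgt => le.
  apply: ni; exists (absz (i - a)); last by lia.
  by rewrite mem_iota; lia.
- by rewrite map_inj_uniq ?iota_uniq// => i j; lia.
rewrite big_map (eq_bigl xpredT); last by move=> i; apply/asboolP.
rewrite -[iota 0 k.+1]/(index_iota 0 k.+1) big_mkord; apply: eq_bigr => i _.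
have iM : (i < M)%N := leq_trans (ltn_ord i) kM.
have kiM : (k - i < M)%N := leq_ltn_trans (leq_subr _ _) kM.
rewrite !coef_poly iM kiM; congr (f _ * g _).
have ik : (i <= k)%N by rewrite -ltnS.
by rewrite -subzn// opprD !addrA; apply/eqP; rewrite subr_eq; lia.
Qed.

Fact lmul_subproof f g : bounded_below (cauchy_prod f g).
Proof.
have [a fa] := laurent_below f; have [b gb] := laurent_below g.
exact: bounded_belowP (cauchy_prod_below fa gb).
Qed.
Definition lmul f g := Laurent (lmul_subproof f g).

Lemma ltrunc_cauchy_prod a b M (f g : int -> F) :
  vanish_below a f -> vanish_below b g ->
  ltrunc (a + b) M (cauchy_prod f g) = take_poly M (ltrunc a M f * ltrunc b M g).
Proof.
move=> fa gb; apply/polyP => k; rewrite coef_poly coef_take_poly.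
by case: ifP => // kM; apply: cauchy_prodE.
Qed.

Lemma coef_take_mul (p q : {poly F}) (k M : nat) :
  (k < M)%N -> (take_poly M p * q)`_k = (p * q)`_k.
Proof.
move=> kM; rewrite !coefM; apply: eq_bigr => i _.
by rewrite coef_take_poly ifT// (leq_ltn_trans _ kM)// -ltnS.
Qed.

Variant below_spec a n : Prop :=
  | BelowLt of n < a | BelowGe (k : nat) of n = a + k%:Z.

Lemma belowP a n : below_spec a n.
Proof.
have [na|an] := ltP n a; first exact: BelowLt.
by apply: (@BelowGe _ _ (absz (n - a))); lia.
Qed.

Fact lmulC : commutative lmul.
Proof.
move=> f g; have [a fa] := laurent_below f; have [b gb] := laurent_below g.
apply: laurentP => n /=; have [nab|k ->] := belowP (a + b) n.
  by rewrite (cauchy_prod_below fa gb)// (cauchy_prod_below gb fa)// addrC.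
rewrite (cauchy_prodE fa gb (ltnSn k)) [a + b]addrC.
by rewrite (cauchy_prodE gb fa (ltnSn k)) mulrC.
Qed.

Fact lmulA : associative lmul.
Proof.
move=> f g h; have [a fa] := laurent_below f.
have [b gb] := laurent_below g; have [c hc] := laurent_below h.
have fgab := cauchy_prod_below fa gb; have ghbc := cauchy_prod_below gb hc.
apply: laurentP => n /=; have [nab|k ->] := belowP (a + (b + c)) n.
  rewrite (cauchy_prod_below fa ghbc)// (cauchy_prod_below fgab hc)//.
  by rewrite -addrA.
rewrite (cauchy_prodE fa ghbc (ltnSn k)) [a + (b + c)]addrA.
rewrite (cauchy_prodE fgab hc (ltnSn k)) !ltrunc_cauchy_prod//.
by rewrite mulrC !coef_take_mul// mulrC mulrA.
Qed.

Fact lone_subproof : bounded_below (fun n => (n == 0)%:R : F).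
Proof. by apply: (@bounded_belowP _ 0) => n n0; rewrite lt_eqF. Qed.
Definition lone := Laurent lone_subproof.

Fact lmul1 : left_id lone lmul.
Proof.
move=> f; apply: laurentP => n /=; rewrite /cauchy_prod (fsbigE [:: 0])//; last first.
  by move=> i _; rewrite inE => /negbTE ->; rewrite mul0r.
rewrite big_cons big_nil ifT; last by apply/asboolP.
by rewrite eqxx mul1r subr0; exact: addr0.
Qed.

Fact lmulDl : left_distributive lmul +%R.
Proof.
move=> f g h; have [a [fa ga]] := laurent_below2 f g; have [b hb] := laurent_below h.
have fga := vanish_belowD fa ga.
apply: laurentP => n; rewrite lcoefD /=; have [nab|k ->] := belowP (a + b) n.
  rewrite (cauchy_prod_below fga hb)// (cauchy_prod_below fa hb)//.
  by rewrite (cauchy_prod_below ga hb)// addr0.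
rewrite (cauchy_prodE fga hb (ltnSn k)) (cauchy_prodE fa hb (ltnSn k)).
rewrite (cauchy_prodE ga hb (ltnSn k)) -coefD -mulrDl.
suff -> : ltrunc a k.+1 (fun n => f n + g n) = ltrunc a k.+1 f + ltrunc a k.+1 g by [].
by apply/polyP => i; rewrite coefD !coef_poly; case: ifP => //; rewrite addr0.
Qed.

Fact lone_neq0 : lone != 0.
Proof. by apply/eqP => /(congr1 (fun f => lcoef f 0))/eqP; rewrite /= oner_eq0. Qed.

HB.instance Definition _ :=
  GRing.Zmodule_isComNzRing.Build (laurent F) lmulA lmulC lmul1 lmulDl lone_neq0.

Lemma lcoef1 n : (1 : laurent F) n = (n == 0)%:R. Proof. by []. Qed.
Lemma lcoefM f g n : (f * g) n = \sum_(i \in [set: int]) (f i * g (n - i)).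
Proof. by []. Qed.

Lemma laurent_order f : f != 0 -> exists a, vanish_below a f /\ f a != 0.
Proof.
move=> f0; have [a fa] := laurent_below f.
have [n0 fn0] : exists n : nat, f (a + n%:Z) != 0.
  apply: contrapT => nf; move/eqP: f0; apply; apply: laurentP => n.
  have [/fa//|k ->] := belowP a n.
  by apply/eqP/negPn/negP => fk; apply: nf; exists k.
have ex : exists n : nat, f (a + n%:Z) != 0 by exists n0.
exists (a + (ex_minn ex)%:Z); case: ex_minnP => m fm mmin; split=> //.
move=> n nm; have [/fa//|k nE] := belowP a n.
apply/eqP/negPn/negP; rewrite nE => /mmin; lia.
Qed.

Section Inverse.
Variable u : nat -> F.
Hypothesis u0 : u 0%N != 0.

Definition pinv_next (s : seq F) : F :=
  (u 0%N)^-1 * ((size s == 0%N)%:R - \sum_(i < size s) u (size s - i)%N * s`_i).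
Definition pinv_seq (n : nat) := iter n (fun s => rcons s (pinv_next s)) [::].
Definition pinv (k : nat) := (pinv_seq k.+1)`_k.

Lemma size_pinv_seq (n : nat) : size (pinv_seq n) = n.
Proof. by elim: n => //= n IHn; rewrite size_rcons IHn. Qed.

Lemma nth_pinv_seq (n k : nat) : (k < n)%N -> (pinv_seq n)`_k = pinv k.
Proof.
elim: n => // n IHn; rewrite ltnS leq_eqVlt => /predU1P[->//|kn].
by rewrite -IHn//= nth_rcons size_pinv_seq kn.
Qed.

Lemma pinvP (k : nat) : \sum_(i < k.+1) u (k - i)%N * pinv i = (k == 0%N)%:R.
Proof.
rewrite big_ord_recr /= subnn {2}/pinv /= nth_rcons size_pinv_seq ltnn eqxx.
rewrite /pinv_next size_pinv_seq mulVKf// addrC.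
rewrite [X in _ - X](eq_bigr (fun i : 'I_k => u (k - i)%N * pinv i)) ?subrK//.
by move=> i _; rewrite nth_pinv_seq.
Qed.

End Inverse.

Lemma laurent_inv_ex f : f != 0 -> exists g, g * f = 1.
Proof.
move=> /laurent_order[a [fa fa0]].
pose u (k : nat) := f (a + k%:Z).
have u0 : u 0%N != 0 by rewrite /u addr0.
pose w n : F := if n + a is Posz k then pinv u k else 0.
have wa : vanish_below (- a) w.
  by move=> n na; rewrite /w; case nk: (n + a) => [k|]//; exfalso; lia.
exists (Laurent (bounded_belowP wa)); apply: laurentP => n.
rewrite lcoef1; have [na|k nk] := belowP (- a + a) n.
  by rewrite [LHS](cauchy_prod_below wa fa)// lt_eqF//; move: na; rewrite addNr.
rewrite nk [LHS](cauchy_prodE wa fa (ltnSn k)) coefM addNr add0r eqz_nat -(pinvP u0).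
apply: eq_bigr => i _; rewrite !coef_poly ltn_ord ltnS leq_subr mulrC.
congr (_ * _); rewrite /w; case ij: (_ + a) => [j|j]; last by exfalso; lia.
by congr (pinv u _); lia.
Qed.

Definition linv f : laurent F := xget 0 [set g | g * f = 1].

Fact lmulVf f : f != 0 -> linv f * f = 1.
Proof. by move=> /laurent_inv_ex[g gf]; rewrite /linv; case: xgetP => [x _ ->|/(_ g)]. Qed.

Fact linv0 : linv 0 = 0.
Proof.
rewrite /linv; case: xgetP => // g _ /=; rewrite mulr0 => /eqP.
by rewrite eq_sym oner_eq0.
Qed.

HB.instance Definition _ := GRing.ComNzRing_isField.Build (laurent F) lmulVf linv0.

End LaurentField.

Section Expansion.
Variable F : fieldType.
Implicit Types (p q : {poly F}) (R : {fraction {poly F}}).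

Fact lpoly_subproof p : bounded_below (fun n => if n is Posz k then p`_k else 0).
Proof. by apply: (@bounded_belowP _ _ 0); case. Qed.
Definition lpoly p : laurent F := Laurent (lpoly_subproof p).

Lemma lpoly_below p : vanish_below 0 (lpoly p). Proof. by case. Qed.

Fact lpoly_is_zmod_morphism : zmod_morphism lpoly.
Proof.
by move=> p q; apply: laurentP; case=> k; rewrite lcoefD lcoefN /= ?coefB ?subr0.
Qed.

Fact lpoly_is_monoid_morphism : monoid_morphism lpoly.
Proof.
split; first by apply: laurentP; case=> k; rewrite lcoef1 /= ?coef1.
move=> p q; apply: laurentP; case=> k; last first.
  by rewrite [RHS](cauchy_prod_below (@lpoly_below p) (@lpoly_below q)).
have := cauchy_prodE (@lpoly_below p) (@lpoly_below q) (ltnSn k).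
rewrite !add0r => kE; rewrite [RHS]kE /= !coefM; apply: eq_bigr => i _.
by rewrite !coef_poly !add0r ltn_ord ltnS leq_subr.
Qed.

HB.instance Definition _ :=
  GRing.isZmodMorphism.Build {poly F} (laurent F) lpoly lpoly_is_zmod_morphism.
HB.instance Definition _ :=
  GRing.isMonoidMorphism.Build {poly F} (laurent F) lpoly lpoly_is_monoid_morphism.

Lemma lpoly_eq0 p : (lpoly p == 0) = (p == 0).
Proof.
apply/eqP/eqP => [p0|->]; last exact: rmorph0.
apply/polyP => k; rewrite coef0.
exact: (congr1 (fun f : laurent F => f (Posz k)) p0).
Qed.

(* Expansion at 0, i.e. the embedding of F(t) into F((t)). *)
Definition expand R : laurent F := lpoly (repr R).1 / lpoly (repr R).2.

Lemma fraction_repr R :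
  (repr R).2 != 0 /\ R = tofrac (repr R).1 / tofrac (repr R).2.
Proof.
have d0 := denom_ratioP (repr R); split=> //.
apply/(canRL (mulfK _)); first by rewrite tofrac_eq0.
rewrite -[R in LHS]reprK !piE.
apply/eqmodP; rewrite /= equivfE /= /FracField.mulf.
rewrite !numden_Ratio ?mulr1 ?oner_neq0//.
by rewrite reprK mulrC.
Qed.

Lemma expand_frac p q : q != 0 -> expand (tofrac p / tofrac q) = lpoly p / lpoly q.
Proof.
move=> q0; set R := _ / _; have [d0 RE] := fraction_repr R.
apply/eqP; rewrite /expand eqr_div ?lpoly_eq0// -!rmorphM; apply/eqP.
congr (lpoly _); apply/eqP; rewrite -tofrac_eq !tofracM -eqr_div ?tofrac_eq0//.
by rewrite -RE.
Qed.

Lemma expand_poly p : expand (tofrac p) = lpoly p.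
Proof.
have := @expand_frac p 1 (oner_neq0 _).
by rewrite tofrac1 rmorph1 !divr1.
Qed.

Fact expand_is_zmod_morphism : zmod_morphism expand.
Proof.
move=> R S; have [d0 RE] := fraction_repr R; have [e0 SE] := fraction_repr S.
set p := (repr R).1 in RE; set q := (repr R).2 in d0 RE.
set p' := (repr S).1 in SE; set q' := (repr S).2 in e0 SE.
have -> : R - S = tofrac (p * q' - p' * q) / tofrac (q * q').
  rewrite {1}RE {1}SE -mulNr addf_div ?tofrac_eq0// tofracB !tofracM.
  by rewrite mulNr.
rewrite expand_frac ?mulf_neq0// /expand -/p -/q -/p' -/q'.
rewrite -[- (_ / lpoly q')]mulNr.
rewrite addf_div ?lpoly_eq0// rmorphB !rmorphM.
by rewrite mulNr.
Qed.

Fact expand_is_monoid_morphism : monoid_morphism expand.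
Proof.
split; first by rewrite -tofrac1 expand_poly rmorph1.
move=> R S; have [d0 RE] := fraction_repr R; have [e0 SE] := fraction_repr S.
have -> : R * S = tofrac ((repr R).1 * (repr S).1) / tofrac ((repr R).2 * (repr S).2).
  by rewrite {1}RE {1}SE mulf_div !tofracM.
by rewrite expand_frac ?mulf_neq0// !rmorphM /expand mulf_div.
Qed.

HB.instance Definition _ :=
  GRing.isZmodMorphism.Build {fraction {poly F}} (laurent F) expand
    expand_is_zmod_morphism.
HB.instance Definition _ :=
  GRing.isMonoidMorphism.Build {fraction {poly F}} (laurent F) expand
    expand_is_monoid_morphism.

End Expansion.

Section Operations.
Variable F : fieldType.
Implicit Types (f g : laurent F).

Fact lderiv_subproof f : bounded_below (fun n => f (n + 1) *~ (n + 1)).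
Proof.
have [a fa] := laurent_below f; apply: (@bounded_belowP _ _ (a - 1)) => n na.
by rewrite fa ?mul0rz//; lia.
Qed.
Definition lderiv f : laurent F := Laurent (lderiv_subproof f).

(* f has no pole at 0 and f(0) = c *)
Definition has_value0 f (c : F) := vanish_below 0 f /\ f 0 = c.

(* f(g(t)) = \sum_n f_n g(t)^n, computed coefficientwise. Meaningful for g != 0
   with g(0) = 0: then the coefficients are finite sums forming a Laurent series
   (lemma lcompE). Infinite sums, and families of coefficients that are not bounded
   below, default to 0. *)
Definition lcomp f g : laurent F :=
  insubd (0 : laurent F) (fun k : int => \sum_(n \in [set: int]) (f n * (g ^ n) k)).

(* g composed with itself n times *)
Definition literate (n : nat) g : laurent F := iter n (lcomp^~ g) (lpoly 'X).

Definition diff_transcendental f :=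
  ~ exists (n : nat) (P : {mpoly {fraction {poly F}}[n.+1]}),
      P != 0 /\ mmap (@expand F) (fun i : 'I_n.+1 => iter i lderiv f) P = 0.

Lemma expn_below g (n : nat) : vanish_below 1 g -> vanish_below n%:Z (g ^+ n).
Proof.
move=> g1; elim: n => [|n IHn]; first by rewrite expr0 => k k0; rewrite lcoef1 lt_eqF.
rewrite exprS -add1n PoszD; exact: cauchy_prod_below.
Qed.

Lemma lcomp_support f g : has_value0 g 0 -> exists a : int, forall k : int,
  (k < a -> forall n, f n * (g ^ n) k = 0) /\
  (forall n, f n * (g ^ n) k != 0 -> a <= n <= `|k|).
Proof.
move=> [g0 gc0]; have g1 : vanish_below 1 g.
  by move=> n n1; have [->//|n0] := eqVneq n 0; apply: g0; lia.
have [a fa] := laurent_below f.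
have [b [ba gb]] : exists b, b <= a /\
    forall n : nat, (n <= absz a)%N -> vanish_below b (g ^ (- n%:Z)).
  elim: (absz a) => [|N [b [ba IH]]].
    exists (Num.min a 0); split; first by rewrite ge_min lexx.
    move=> n; rewrite leqn0 => /eqP -> k kb.
    by rewrite oppr0 expr0z lcoef1 lt_eqF//; lia.
  have [c gc] := laurent_below (g ^ (- N.+1%:Z)).
  exists (Num.min b c); split; first by lia.
  move=> n; rewrite leq_eqVlt => /predU1P[->|nN].
    by apply: vanish_belowW gc; lia.
  by apply: vanish_belowW (IH _ nN); lia.
exists (Num.min b 0) => k; split=> [kb n|n].
  have [na|an] := ltP n a; first by rewrite fa ?mul0r.
  case: n an => n an; first by rewrite -exprnP (expn_below g1) ?mulr0//; lia.
  by rewrite NegzE gb ?mulr0//; lia.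
have [na|an] := ltP n a; first by rewrite fa ?mul0r ?eqxx.
have [nk|kn _] := ltP `|k| n; last by lia.
case: n an nk => n an nk; last by lia.
by rewrite -exprnP (expn_below g1) ?mulr0 ?eqxx//; lia.
Qed.

Lemma lcompE f g (k : int) : has_value0 g 0 ->
  lcomp f g k = \sum_(n \in [set: int]) (f n * (g ^ n) k) /\
  finite_set [set n | f n * (g ^ n) k != 0].
Proof.
move=> /(lcomp_support f)[a fga]; split.
  rewrite /lcomp; set c := (X in insubd _ X).
  suff cb : bounded_below c by exact: (congr1 (@^~ k) (insubdK (0 : laurent F) cb)).
  apply: (@bounded_belowP _ _ a) => j ja.
  by apply: fsbig1 => n _; apply: (fga j).1.
apply: (@sub_finite_set _ _
  [set` [seq a + i%:Z | i <- iota 0 (absz (`|k| - a)).+1]]); last exact: finite_seq.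
move=> n /(fga k).2 nak; apply/mapP; exists (absz (n - a)); last by lia.
by rewrite mem_iota; lia.
Qed.

Lemma has_value0_div f g (c d : F) : has_value0 f c -> has_value0 g d -> d != 0 ->
  has_value0 (f / g) (c / d).
Proof.
move=> [f0 fc] [g0 gd] d0.
have gn0 : g != 0 by apply: contra_neq d0 => gE; rewrite -gd gE.
set h := f / g; have hg : h * g = f by rewrite divfK.
have mul0 a : vanish_below a h -> f a = h a * d.
  move=> ha; rewrite -hg; have := cauchy_prodE ha g0 (ltnSn 0).
  by rewrite !addr0 coefM big_ord1 !coef_poly /= !addr0 gd => <-.
have h0 : vanish_below 0 h.
  have [->//|/laurent_order[a [ha han0]]] := eqVneq h 0.
  apply: (vanish_belowW _ ha); rewrite leNgt; apply/negP => a0.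
  by have /eqP := mul0 _ ha; rewrite f0// eq_sym mulf_eq0 (negbTE d0) (negbTE han0).
by split=> //; rewrite -fc mul0// mulfK.
Qed.

Lemma expand_value0 (p q : {poly F}) : q.[0] != 0 ->
  has_value0 (expand (tofrac p / tofrac q)) (p.[0] / q.[0]).
Proof.
move=> q0; have qn0 : q != 0 by apply: contra_neq q0 => ->; rewrite horner0.
by rewrite expand_frac//; apply: has_value0_div => //;
   split; rewrite ?horner_coef0//; apply: lpoly_below.
Qed.

End Operations.

(* Main.v *)
Require Import Defs.
From HB Require Import structures.
From mathcomp Require Import all_boot all_order all_algebra generic_quotient.
From mathcomp Require Import complex mpoly boolp classical_sets functions.
From mathcomp Require Import cardinality fsbigop reals zify ring.

(** Put z = 1/t. Composition with R becomes an endomorphism sigma of K = C(z), given by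
    a rational map F fixing infinity, and D = d/dz satisfies D sigma = mu sigma D with
    mu = F'. After passing to an iterate, infinity is superattracting for F, or F is
    tangent to the identity there; in both cases a Laurent series which composition
    multiplies by a constant is itself constant.

    Suppose f is differentially algebraic. The jets u_0 = D f / f - w and
    u_(k+1) = D u_k + (k+1) c u_k, where w and c in K are parameters, are transformed by
    sigma in a triangular affine way. A minimal relation between f and its jets is an
    eigenvector of this action. Either it shows that a power of f is rational, or it
    contains a nonconstant polynomial P in the jets whose image is mu^-W P, where W is
    the weight of P. The coefficients of P just below the top weight are rational
    solutions of inhomogeneous equations; according to the kernels of the derivations
    which describe the action to first and second order, one of them gives a solution of
    mu sigma g = g + D a / a, or an affine connection, or a projective connection
    invariant under F. Residues decide the rest: finite sets that are closed under
    preimages are too small for such an object to exist in the parabolic case, and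
    force F to be a polynomial in the superattracting case. A last comparison, in terms
    of the total degree of P, produces residues solving the equation for the divisor of
    a, so that some a^N is a constant times sigma b / b. Then composition multiplies
    f^N / b by a constant, whence f^N is rational. *)

Set Implicit Arguments.
Unset Strict Implicit.
Unset Printing Implicit Defensive.

Import Order.TTheory GRing.Theory Num.Theory.
Local Open Scope ring_scope.

(** * Formal Laurent series *)

(** Passing from [f] to [D f / f] turns the multiplicative equation into
    [mu * sigma(D f / f) = D f / f + D a / a], and [u_k], of weight [k + 1], behaves like a
    [(k+1)]-differential up to lower jets and a term in [K]. The obstacle is this mixing with lower
    jets. It disappears when [mu * sigma c = c + rho], [rho = D mu / mu]: then [c] is an invariant
    affine connection, [D + (k+1) c] is its covariant derivative, and [sigma] merely translates each
    jet. Hence the search for a connection. For [c = 0] the mixing is, to first and second order,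
    [rho] and the Schwarzian of [F] times the Witt fields of index 1 and 2. These generate all
    fields of positive index, so they cannot both kill a nonconstant polynomial; this is why the
    Schwarzian, and no higher invariant, occurs. The parameter [w] reduces [D a / a] to a constant
    multiple of [rho], so that [u_0] transforms like a multiple of a connection; as [w] is found
    from a first eigenvector, a relation is extracted again for the new jets. Maps of degree one are
    translations [z + k]: nothing ramifies, and infinite backward orbits take over. *)

Section Lead.
Variable F : fieldType.
Implicit Types (f g h : laurent F) (a b n : int) (c d : F).

(* [c] is allowed to vanish: [lead f a c] says f = c t^a + O(t^(a+1)). *)
Definition lead f a c := vanish_below a f /\ f a = c.

Lemma lead0 a : lead 0 a 0. Proof. by []. Qed.

Lemma lead_uniq f a c d : lead f a c -> lead f a d -> c = d.
Proof. by move=> [_ <-] [_ <-]. Qed.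

Lemma leadW f a b : vanish_below a f -> b < a -> lead f b 0.
Proof. by move=> fa ba; split; [apply: vanish_belowW fa; lia | apply: fa]. Qed.

Lemma lead_van f a : vanish_below a f -> lead f a (f a). Proof. by []. Qed.

Lemma lead0_van f a : lead f a 0 -> vanish_below (a + 1) f.
Proof.
by move=> [fa f0] n na; have [->//|n0] := eqVneq n a; apply: fa; lia.
Qed.

Lemma van_lead0 f a b : vanish_below b f -> b = a + 1 -> lead f a 0.
Proof. by move=> fb ba; apply: leadW fb _; lia. Qed.

Lemma leadD f g a c d : lead f a c -> lead g a d -> lead (f + g) a (c + d).
Proof. by move=> [fa <-] [ga <-]; split => //; apply: vanish_belowD. Qed.

Lemma leadN f a c : lead f a c -> lead (- f) a (- c).
Proof. by move=> [fa <-]; split => //; apply: vanish_belowN. Qed.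

Lemma leadB f g a c d : lead f a c -> lead g a d -> lead (f - g) a (c - d).
Proof. by move=> fa ga; apply: leadD => //; apply: leadN. Qed.

Lemma leadM f g a b c d : lead f a c -> lead g b d -> lead (f * g) (a + b) (c * d).
Proof.
move=> [fa <-] [gb <-]; split; first exact: cauchy_prod_below.
have := cauchy_prodE fa gb (ltnSn 0).
by rewrite !addr0 coefM big_ord1 !coef_poly /= !addr0.
Qed.

Lemma vanM f g a b : vanish_below a f -> vanish_below b g -> vanish_below (a + b) (f * g).
Proof. exact: cauchy_prod_below. Qed.

Lemma vanD f g a : vanish_below a f -> vanish_below a g -> vanish_below a (f + g).
Proof. exact: vanish_belowD. Qed.

Lemma vanN f a : vanish_below a f -> vanish_below a (- f).
Proof. exact: vanish_belowN. Qed.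

Lemma vanB f g a : vanish_below a f -> vanish_below a g -> vanish_below a (f - g).
Proof. by move=> fa ga; apply: vanD => //; apply: vanN. Qed.

Lemma van_sum I (r : seq I) (P : pred I) (h : I -> laurent F) a :
  (forall i, P i -> vanish_below a (h i)) -> vanish_below a (\sum_(i <- r | P i) h i).
Proof.
by move=> ha; elim/big_ind: _ => // x y; exact: vanD.
Qed.

Lemma lead_sum I (r : seq I) (P : pred I) (h : I -> laurent F) a (c : I -> F) :
  (forall i, P i -> lead (h i) a (c i)) ->
  lead (\sum_(i <- r | P i) h i) a (\sum_(i <- r | P i) c i).
Proof.
by move=> ha; elim/big_ind2: _ => // x1 x2 y1 y2; exact: leadD.
Qed.

Lemma lead1 : lead 1 0 1.
Proof. by split=> [n n0|]; rewrite lcoef1 ?eqxx// lt_eqF. Qed.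

Lemma lead_ex f : f != 0 -> exists a c, c != 0 /\ lead f a c.
Proof. by move=> /laurent_order[a [fa f0]]; exists a, (f a). Qed.

Lemma lead_neq0 f a c : lead f a c -> c != 0 -> f != 0.
Proof. by move=> [_ <-]; apply: contra_neq => ->. Qed.

Lemma lead_van_le f a b c : lead f a c -> c != 0 -> vanish_below b f -> b <= a.
Proof. by move=> [_ <-] f0 fb; rewrite leNgt; apply/negP => /fb/eqP; apply/negP. Qed.

Lemma lead_order f a b c d : lead f a c -> lead f b d -> c != 0 -> d != 0 -> a = b /\ c = d.
Proof.
move=> fa fb c0 d0; have ab : a = b.
  apply/eqP; rewrite eq_le (lead_van_le fb d0 fa.1) (lead_van_le fa c0 fb.1)//.
by split=> //; apply: lead_uniq fa _; rewrite ab.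
Qed.

Lemma leadV f a c : lead f a c -> c != 0 -> lead f^-1 (- a) c^-1.
Proof.
move=> fa c0; have f0 := lead_neq0 fa c0.
have [b [d [d0 fb]]] := lead_ex (invr_neq0 f0).
have := leadM fa fb; rewrite mulfV// => fab.
have [ab cd] := lead_order fab lead1 (mulf_neq0 c0 d0) (oner_neq0 _).
have -> : - a = b by lia.
by rewrite (_ : c^-1 = d)//; apply: (mulfI c0); rewrite cd mulfV.
Qed.

Lemma lead_div f g a b c d : lead f a c -> lead g b d -> d != 0 ->
  lead (f / g) (a - b) (c / d).
Proof. by move=> fa gb d0; apply: leadM => //; apply: leadV. Qed.

Lemma leadX f a c (n : nat) : lead f a c -> lead (f ^+ n) (a *+ n) (c ^+ n).
Proof.
move=> fa; elim: n => [|n IHn]; first by rewrite !expr0 mulr0n; exact: lead1.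
by rewrite !exprS mulrS; apply: leadM.
Qed.

Lemma leadXz f a c n : lead f a c -> c != 0 -> lead (f ^ n) (a * n) (c ^ n).
Proof.
move=> fa c0; case: n => n.
  by have := leadX n fa; rewrite -mulr_natr natz.
rewrite NegzE mulrN -!exprnN; apply: leadV; last exact: expf_neq0.
by have := leadX n.+1 fa; rewrite -mulr_natr natz.
Qed.

Lemma lead_deriv f a c : lead f a c -> lead (lderiv f) (a - 1) (c *~ a).
Proof.
move=> [fa <-]; split=> [n na|] /=; last by rewrite subrK.
by rewrite fa ?mul0rz//; lia.
Qed.

Lemma lderivE f n : lderiv f n = f (n + 1) *~ (n + 1). Proof. by []. Qed.

Lemma lderivD f g : lderiv (f + g) = lderiv f + lderiv g.
Proof. by apply: laurentP => n; rewrite /= mulrzDl. Qed.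

Lemma lderivN f : lderiv (- f) = - lderiv f.
Proof. by apply: laurentP => n; rewrite /= mulNrz. Qed.

Definition lC c : laurent F := lpoly c%:P.
Definition lT : laurent F := lpoly 'X.

Lemma lCE c n : lC c n = if n == 0 then c else 0.
Proof. by case: n => //= k; rewrite coefC. Qed.

Lemma lead_lC c : lead (lC c) 0 c.
Proof. by split => [n n0|]; rewrite lCE ?eqxx// lt_eqF. Qed.

Lemma lC_is_zmod_morphism : zmod_morphism lC.
Proof. by move=> c d; rewrite /lC polyCB rmorphB. Qed.
Lemma lC_is_monoid_morphism : monoid_morphism lC.
Proof. by split; rewrite /lC ?rmorph1// => c d; rewrite polyCM rmorphM. Qed.
HB.instance Definition _ := GRing.isZmodMorphism.Build F (laurent F) lC lC_is_zmod_morphism.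
HB.instance Definition _ :=
  GRing.isMonoidMorphism.Build F (laurent F) lC lC_is_monoid_morphism.

Lemma lead_lT : lead lT 1 1.
Proof.
split=> [[k|k] kn|] //=; last by rewrite coefX.
by rewrite coefX; case: k kn.
Qed.

Lemma lT_neq0 : lT != 0. Proof. exact: lead_neq0 lead_lT (oner_neq0 _). Qed.

Lemma lcoefCM c f n : (lC c * f) n = c * f n.
Proof.
rewrite lcoefM (fsbigE [:: 0])//; last first.
  by move=> i _; rewrite inE lCE => /negbTE ->; rewrite mul0r.
by rewrite big_cons big_nil ifT ?subr0 ?lCE ?eqxx; [exact: addr0 | apply/asboolP].
Qed.

Lemma lcoefTM f n : (lT * f) n = f (n - 1).
Proof.
have lTE i : lT i = (i == 1)%:R by case: i => [[|[|i]]|i] //=; rewrite coefX.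
rewrite lcoefM (fsbigE [:: 1])//; last first.
  by move=> i _; rewrite inE lTE => /negbTE ->; rewrite mul0r.
by rewrite big_cons big_nil ifT ?lTE ?eqxx ?mul1r; [exact: addr0 | apply/asboolP].
Qed.

Lemma lcoefTXM f n k : (lT ^ n * f) k = f (k - n).
Proof.
have H (m : nat) g j : (lT ^+ m * g) j = g (j - m%:Z).
  elim: m j => [|m IHm] j; first by rewrite mul1r subr0.
  by rewrite exprS -mulrA lcoefTM IHm; congr (g _); lia.
case: n => n; first exact: H.
rewrite NegzE -exprnN; set g := _ * f.
have -> : f = lT ^+ n.+1 * g by rewrite mulrA mulfV ?mul1r// expf_neq0 ?lT_neq0.
by rewrite H; congr (g _); lia.
Qed.

Lemma lTXE n k : (lT ^ n) k = (n == k)%:R.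
Proof.
rewrite -[X in lcoef X]mulr1 lcoefTXM lcoef1; congr (nat_of_bool _)%:R.
by apply/eqP/eqP; lia.
Qed.

Definition lmono c n : laurent F := lC c * lT ^ n.

Lemma lmonoE c n k : lmono c n k = c * (n == k)%:R.
Proof. by rewrite lcoefCM lTXE. Qed.

Lemma lead_lmono c n : lead (lmono c n) n c.
Proof. by split=> [k kn|]; rewrite lmonoE ?eqxx ?mulr1// gt_eqF ?mulr0. Qed.

(** Density of the finite sums of monomials in the t-adic topology. *)
Lemma lmono_ind (Q : laurent F -> Prop) a f : Q 0 ->
  (forall g h, Q g -> Q h -> Q (g + h)) ->
  (forall c n, a <= n -> Q (lmono c n)) -> vanish_below a f ->
  forall N, exists g, Q g /\ vanish_below N (f - g).
Proof.
move=> Q0 QD Qm fa N.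
suff [g [Qg fg]] : exists g, Q g /\ vanish_below (a + (absz (N - a))%:Z) (f - g).
  by exists g; split=> //; apply: vanish_belowW fg; lia.
elim: (absz _) => [|m [g [Qg fg]]].
  exists 0; split; first by [].
  by rewrite addr0 subr0.
exists (g + lmono ((f - g) (a + m%:Z)) (a + m%:Z)); split.
  by apply: QD => //; apply: Qm; lia.
set d := (f - g) (a + m%:Z).
have := leadB (lead_van fg) (lead_lmono d (a + m%:Z)).
rewrite subrr => /lead0_van; rewrite -[f - g - _]addrA -opprD.
by rewrite (_ : a + m%:Z + 1 = a + m.+1%:Z)//; lia.
Qed.

(** t-adic continuity at 0, which for additive maps is continuity. *)
Definition lcont (A : laurent F -> laurent F) :=
  forall N, exists M, forall f, vanish_below M f -> vanish_below N (A f).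

Lemma van_all f : (forall N, vanish_below N f) -> f = 0.
Proof. by move=> fN; apply: laurentP => n; apply: (fN (n + 1)); lia. Qed.

Definition zadd (A : laurent F -> laurent F) (hA : zmod_morphism A) :
  {additive laurent F -> laurent F} :=
  HB.pack A (GRing.isZmodMorphism.Build (laurent F) (laurent F) A hA).

Lemma lcont_van A a b f : zmod_morphism A -> lcont A ->
  (forall c n, a <= n -> vanish_below b (A (lmono c n))) ->
  vanish_below a f -> vanish_below b (A f).
Proof.
move=> hA Ac Am fa; have [M AM] := Ac b.
have AD : {morph A : x y / x + y} by exact: (raddfD (zadd hA)).
have A0 : A 0 = 0 by exact: (raddf0 (zadd hA)).
have [||g|g [Ag fg]] := @lmono_ind (fun g => vanish_below b (A g)) a f _ _ _ fa M.
- by rewrite A0.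
- by move=> g h ag ah; rewrite AD; apply: vanD.
- exact: Am.
by rewrite -[f](subrK g) AD; apply: vanD => //; apply: AM.
Qed.

(** By density of finite sums. The product rule, the multiplicativity of composition, the chain rule
    and associativity all reduce to monomials in this way, without manipulation of infinite sums. *)
Lemma lcont_ext A B : zmod_morphism A -> zmod_morphism B -> lcont A -> lcont B ->
  (forall c n, A (lmono c n) = B (lmono c n)) -> A =1 B.
Proof.
move=> hA hB Ac Bc AB f.
pose D f := A f - B f; suff : D f = 0 by move/eqP; rewrite subr_eq0 => /eqP.
have [a fa] := laurent_below f; apply: van_all => N; apply: lcont_van fa.
- by move=> g h; rewrite /D hA hB !opprD !opprK addrACA.
- move=> M; have [M1 AM] := Ac M; have [M2 BM] := Bc M; exists (Num.max M1 M2) => g gM.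
  by apply: vanB; [apply: AM | apply: BM]; apply: vanish_belowW gM; lia.
- by move=> c n _; rewrite /D AB subrr.
Qed.

Lemma lcontMr g : lcont (fun f => f * g).
Proof.
have [b gb] := laurent_below g => N; exists (N - b) => f fN.
by have := vanM fN gb; rewrite subrK.
Qed.

Lemma lcont_o A B : lcont A -> lcont B -> lcont (fun f => A (B f)).
Proof.
by move=> Ac Bc N; have [M AM] := Ac N; have [M' BM] := Bc M; exists M' => f /BM/AM.
Qed.

Lemma lcont_deriv : lcont (@lderiv F).
Proof. by move=> N; exists (N + 1) => f fN n nN /=; rewrite fN ?mul0rz//; lia. Qed.

Lemma lderiv_is_zmod_morphism : zmod_morphism (@lderiv F).
Proof. by move=> f g; rewrite lderivD lderivN. Qed.

Lemma lmonoM c d n m : lmono c n * lmono d m = lmono (c * d) (n + m).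
Proof. by rewrite /lmono rmorphM expfzDr ?lT_neq0// mulrACA. Qed.

Lemma lderiv_mono c n : lderiv (lmono c n) = lmono (c *~ n) (n - 1).
Proof.
apply: laurentP => k; rewrite lderivE !lmonoE.
have [->|nk] := eqVneq n (k + 1); first by rewrite addrK !eqxx !mulr1.
by rewrite (_ : (n - 1 == k) = false) ?mulr0 ?mul0rz//; apply/eqP; move/eqP: nk; lia.
Qed.

Lemma lderivM f g : lderiv (f * g) = lderiv f * g + f * lderiv g.
Proof.
move: f; apply: lcont_ext.
- by move=> f h; rewrite mulrBl lderiv_is_zmod_morphism.
- by move=> f h; rewrite lderiv_is_zmod_morphism !mulrBl opprD addrACA.
- exact: (lcont_o lcont_deriv (lcontMr g)).
- move=> N; have [M1 h1] := lcont_o (lcontMr g) lcont_deriv N.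
  have [M2 h2] := lcontMr (lderiv g) N; exists (Num.max M1 M2) => f fM.
  by apply: vanD; [apply: h1 | apply: h2]; apply: vanish_belowW fM; lia.
move=> c n; move: g; apply: lcont_ext.
- by move=> f h; rewrite mulrBr lderiv_is_zmod_morphism.
- by move=> f h; rewrite lderiv_is_zmod_morphism !mulrBr opprD addrACA.
- by under eq_fun do rewrite mulrC; exact: (lcont_o lcont_deriv (lcontMr _)).
- under eq_fun do rewrite [X in X + _]mulrC [X in _ + X]mulrC.
  move=> N; have [M1 h1] := lcontMr (lderiv (lmono c n)) N.
  have [M2 h2] := lcont_o (lcontMr (lmono c n)) lcont_deriv N; exists (Num.max M1 M2) => f fM.
  by apply: vanD; [apply: h1 | apply: h2]; apply: vanish_belowW fM; lia.
move=> d m; rewrite !(lmonoM, lderiv_mono) addrA.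
rewrite (_ : n - 1 + m = n + m - 1); last by lia.
by rewrite /lmono -mulrDl -rmorphD mulrzDr mulrzAl mulrzAr.
Qed.

Lemma lderiv_lC c : lderiv (lC c) = 0.
Proof. by have := lderiv_mono c 0; rewrite /lmono mulr1 mulr0z rmorph0 mul0r. Qed.

Lemma lderiv0 : lderiv (0 : laurent F) = 0. Proof. by have := lderiv_lC 0; rewrite rmorph0. Qed.
Lemma lderiv1 : lderiv (1 : laurent F) = 0. Proof. by have := lderiv_lC 1; rewrite rmorph1. Qed.

Lemma lderivV f : lderiv f^-1 = - lderiv f / f ^+ 2.
Proof.
have [->|f0] := eqVneq f 0; first by rewrite invr0 lderiv0 oppr0 mul0r.
have := lderiv1; rewrite -(mulfV f0) lderivM => /eqP.
rewrite addrC addr_eq0 => /eqP E; apply: (mulfI f0); rewrite E; field.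
exact: f0.
Qed.

Lemma lderivX f (m : nat) : lderiv (f ^+ m.+1) = f ^+ m * lderiv f *+ m.+1.
Proof.
elim: m => [|m IHm]; first by rewrite mul1r.
by rewrite exprS lderivM IHm mulrC [RHS]mulrS mulrnAr mulrA -exprS.
Qed.

Lemma lderivXz f n : f != 0 -> lderiv (f ^ n) = f ^ (n - 1) * lderiv f *~ n.
Proof.
move=> f0; case: n => [[|n]|n].
- by rewrite expr0z lderiv1 mulr0z.
- by have -> : Posz n.+1 - 1 = Posz n; [lia | exact: lderivX].
rewrite NegzE -exprnN lderivV lderivX.
rewrite (_ : - n.+1%:Z - 1 = - n.+2%:Z); last by lia.
have fn0 : f ^+ n != 0 by exact: expf_neq0.
rewrite -exprnN !exprS mulrNz pmulrn -mulrzr -[in RHS]mulrzr; field.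
by rewrite f0 fn0.
Qed.

Definition zero_at0 (G : laurent F) (e : nat) (w : F) :=
  [/\ (0 < e)%N, w != 0 & lead G e%:Z w].

(** * Composition with a series vanishing at 0 *)

Section Comp.
Variables (G : laurent F) (e : nat) (w : F).
Hypothesis (GZ : zero_at0 G e w).

Let e0 : (0 < e)%N. Proof. by case: GZ. Qed.
Let w0 : w != 0. Proof. by case: GZ. Qed.
Let Ge : lead G e%:Z w. Proof. by case: GZ. Qed.

Lemma zero_at0_value : has_value0 G 0.
Proof.
by have eZ : 0 < e%:Z by []; have [g1 g2] := leadW Ge.1 eZ.
Qed.

Let G0 := zero_at0_value.

Let Gn n : lead (G ^ n) (e%:Z * n) (w ^ n). Proof. exact: leadXz. Qed.

Lemma lcomp_is_zmod_morphism : zmod_morphism (fun f => lcomp f G).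
Proof.
move=> f g; apply: laurentP => k; rewrite lcoefD lcoefN.
have [-> finD] := lcompE (f - g) k G0.
have [-> finf] := lcompE f k G0; have [-> fing] := lcompE g k G0.
have fin : finite_set ([set n | f n * (G ^ n) k != 0] `|` [set n | g n * (G ^ n) k != 0])%classic.
  by rewrite finite_setU.
(* One finite list contains both supports, so that the three sums run over the same indices. *)
have [s0 s0E] := (finite_seqP _).1 fin; pose s := undup s0.
have sP n : f n * (G ^ n) k != 0 \/ g n * (G ^ n) k != 0 -> n \in s.
  move=> fg; rewrite mem_undup; suff : [set` s0]%classic n by [].
  by rewrite -s0E.
have sub (h : int -> F) :
    (forall n, h n != 0 -> f n * (G ^ n) k != 0 \/ g n * (G ^ n) k != 0) ->
   \sum_(n \in [set: int]) h n = \sum_(n <- s) h n.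
  move=> hs; rewrite (fsbigE s) ?undup_uniq//.
    by apply: eq_bigl => n; apply/asboolP.
  by move=> n _ /negP ns; apply/eqP/negPn/negP => /hs/sP.
rewrite !sub.
- by rewrite -sumrB; apply: eq_bigr => n _; rewrite mulrBl.
- by move=> n; right.
- by move=> n; left.
- move=> n; rewrite lcoefD lcoefN mulrBl => h.
  have [f0|] := eqVneq (f n * (G ^ n) k) 0; last by left.
  by right; apply: contra_neq h => ->; rewrite f0 subr0.
Qed.

Lemma lead_comp f a c : lead f a c -> lead (lcomp f G) (e%:Z * a) (c * w ^ a).
Proof.
move=> [fa <-]; split=> [k ka|].
  have [-> _] := lcompE f k G0; apply: fsbig1 => n _.
  have [na|an] := ltP n a; first by rewrite fa ?mul0r.
  rewrite (Gn n).1 ?mulr0//; apply: lt_le_trans ka _.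
  by rewrite ler_wpM2l//; lia.
have [-> _] := lcompE f (e%:Z * a) G0.
rewrite (fsbigE [:: a])//; last first.
  move=> n _; rewrite inE => na.
  have [na'|an] := ltP n a; first by rewrite fa ?mul0r.
  by rewrite (Gn n).1 ?mulr0// ltr_pM2l; lia.
by rewrite big_cons big_nil ifT ?(Gn a).2; [exact: addr0 | apply/asboolP].
Qed.

Lemma lcompC c : lcomp (lC c) G = lC c.
Proof.
apply: laurentP => k; have [-> _] := lcompE (lC c) k G0.
rewrite (fsbigE [:: 0])//; last first.
  by move=> n _; rewrite inE lCE => /negbTE ->; rewrite mul0r.
rewrite big_cons big_nil ifT ?lCE ?eqxx ?expr0z ?lcoef1; last exact/asboolP.
by rewrite [LHS]addr0 -mulr_natr; case: eqP; rewrite ?mulr1 ?mulr0.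
Qed.

Lemma lcomp_mono c n : lcomp (lmono c n) G = lC c * G ^ n.
Proof.
apply: laurentP => k; have [-> _] := lcompE (lmono c n) k G0; rewrite [RHS]lcoefCM.
rewrite (fsbigE [:: n])//; last first.
  by move=> i _; rewrite inE lmonoE eq_sym => /negbTE ->; rewrite mulr0 mul0r.
rewrite big_cons big_nil ifT; last exact/asboolP.
rewrite lmonoE eqxx mulr1.
exact: addr0.
Qed.

Lemma lcont_comp : lcont (fun f => lcomp f G).
Proof.
move=> N; exists (Num.max N 0) => f fN.
apply: vanish_belowW (lead_comp (lead_van fN)).1.
by apply: (@le_trans _ _ (Num.max N 0)); rewrite ?ler_peMl//; lia.
Qed.

Lemma lcompB f g : lcomp (f - g) G = lcomp f G - lcomp g G.
Proof. exact: lcomp_is_zmod_morphism. Qed.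

Lemma lcompM f g : lcomp (f * g) G = lcomp f G * lcomp g G.
Proof.
move: f; apply: lcont_ext.
- by move=> f h; rewrite mulrBl lcompB.
- by move=> f h; rewrite lcompB mulrBl.
- exact: (lcont_o lcont_comp (lcontMr g)).
- exact: (lcont_o (lcontMr (lcomp g G)) lcont_comp).
move=> c n; move: g; apply: lcont_ext.
- by move=> f h; rewrite mulrBr lcompB.
- by move=> f h; rewrite lcompB mulrBr.
- by under eq_fun do rewrite mulrC; exact: (lcont_o lcont_comp (lcontMr _)).
- by under eq_fun do rewrite mulrC; exact: (lcont_o (lcontMr _) lcont_comp).
have Gn0 : G != 0 by exact: lead_neq0 Ge w0.
by move=> d m; rewrite lmonoM !lcomp_mono rmorphM expfzDr// mulrACA.
Qed.

Lemma lcomp_is_monoid_morphism : monoid_morphism (fun f => lcomp f G).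
Proof. by split; [have := lcompC 1; rewrite rmorph1 | exact: lcompM]. Qed.

Definition lcomp_rmorph : {rmorphism laurent F -> laurent F} :=
  HB.pack (fun f => lcomp f G)
    (GRing.isZmodMorphism.Build _ _ (fun f => lcomp f G) lcomp_is_zmod_morphism)
    (GRing.isMonoidMorphism.Build _ _ (fun f => lcomp f G) lcomp_is_monoid_morphism).

Lemma lcompD f g : lcomp (f + g) G = lcomp f G + lcomp g G.
Proof. exact: (raddfD lcomp_rmorph). Qed.

Lemma lcompV f : lcomp f^-1 G = (lcomp f G)^-1.
Proof. exact: (fmorphV lcomp_rmorph). Qed.

Lemma lcompT : lcomp lT G = G.
Proof. by have := lcomp_mono 1 1; rewrite /lmono !rmorph1 !mul1r !expr1z. Qed.

Lemma lcomp_deriv f : lderiv (lcomp f G) = lcomp (lderiv f) G * lderiv G.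
Proof.
move: f; apply: lcont_ext.
- by move=> f h; rewrite lcompB lderiv_is_zmod_morphism.
- by move=> f h; rewrite lderiv_is_zmod_morphism lcompB mulrBl.
- exact: (lcont_o lcont_deriv lcont_comp).
- exact: (lcont_o (lcont_o (lcontMr _) lcont_comp) lcont_deriv).
have Gn0 : G != 0 by exact: lead_neq0 Ge w0.
move=> c n; rewrite lderiv_mono !lcomp_mono lderivM lderiv_lC mul0r add0r.
by rewrite lderivXz// rmorphMz mulrzAr -mulrzAl mulrA.
Qed.
End Comp.

Lemma lcomp_lT f : lcomp f lT = f.
Proof.
have TZ : zero_at0 lT 1 1 by split; [| exact: oner_neq0 | exact: lead_lT].
move: f; apply: lcont_ext => //.
- by move=> f g; rewrite (lcompB TZ).
- exact: (lcont_comp TZ).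
- by move=> N; exists N.
- by move=> c n; rewrite (lcomp_mono TZ).
Qed.

Lemma lcompXz G e w f n : zero_at0 G e w -> lcomp (f ^ n) G = (lcomp f G) ^ n.
Proof. by move=> Ge; exact: (fmorphXz (lcomp_rmorph Ge)). Qed.

Lemma zero_at0_comp G e w H e' w' : zero_at0 G e w -> zero_at0 H e' w' ->
  zero_at0 (lcomp G H) (e' * e)%N (w * w' ^ e%:Z).
Proof.
move=> [e0 w0 Ge] HZ; have [e0' w0' _] := HZ; split.
- by rewrite muln_gt0 e0'.
- by rewrite mulf_neq0// expfz_neq0.
- by rewrite PoszM; exact: (lead_comp HZ Ge).
Qed.

Lemma lcompA f G H e w e' w' : zero_at0 G e w -> zero_at0 H e' w' ->
  lcomp (lcomp f G) H = lcomp f (lcomp G H).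
Proof.
move=> Ge He; have GHe := zero_at0_comp Ge He.
move: f; apply: lcont_ext.
- by move=> f g; rewrite (lcompB Ge) (lcompB He).
- by move=> f g; rewrite (lcompB GHe).
- exact: (lcont_o (lcont_comp He) (lcont_comp Ge)).
- exact: (lcont_comp GHe).
move=> c n; rewrite (lcomp_mono Ge) (lcomp_mono GHe).
by rewrite (lcompM He) (lcompC He) (lcompXz _ _ He).
Qed.

(* For G = t + r t^(p+1) + ..., composition by G acts on the leading term as the
   identity plus r t^(p+1) d/dt. *)
Section Tangent.
Variables (G : laurent F) (p : nat) (r : F).
Hypotheses (p0 : (0 < p)%N) (Gp : lead (G - lT) (p%:Z + 1) r).

Lemma tangent_lead : lead G 1 1.
Proof.
rewrite -[G](subrK lT) -[X in lead _ _ X]add0r; apply: leadD; last exact: lead_lT.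
by apply: leadW Gp.1 _; lia.
Qed.

Lemma tangent_zero : zero_at0 G 1 1.
Proof. by split; [| exact: oner_neq0 | exact: tangent_lead]. Qed.

(** Binomial expansion of [t^n (1 + r t^p + ...)^n]; negative exponents follow from positive ones by
    [1/x - 1/y = - (x - y) / (x y)]. *)
Lemma tangent_pow n : lead (G ^ n - lT ^ n) (n + p%:Z) (n%:~R * r).
Proof.
have n0 : (1 : F) != 0 by exact: oner_neq0.
have GT n' : lead (G ^ n') n' 1 by have := leadXz n' tangent_lead n0; rewrite exp1rz mul1r.
have TT n' : lead (lT ^ n') n' 1 by have := leadXz n' lead_lT n0; rewrite exp1rz mul1r.
have Hn (m : nat) : lead (G ^+ m - lT ^+ m) (m%:Z + p%:Z) (m%:R * r).
  elim: m => [|m IHm]; first by rewrite !expr0 subrr mul0r; exact: lead0.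
  have -> : G ^+ m.+1 - lT ^+ m.+1 = (G ^+ m - lT ^+ m) * G + lT ^+ m * (G - lT).
    by rewrite !exprSr; ring.
  have -> : m.+1%:R * r = m%:R * r * 1 + 1 * r by rewrite -natr1; ring.
  apply: leadD.
    by have := leadM IHm tangent_lead; rewrite (_ : _ + _ + 1 = m.+1%:Z + p%:Z)//; lia.
  by have := leadM (TT m) Gp; rewrite (_ : _ + (_ + 1) = m.+1%:Z + p%:Z)//; lia.
case: n => n; first exact: Hn.
rewrite NegzE -!exprnN.
have Gn0 : G ^+ n.+1 != 0 by exact: lead_neq0 (GT n.+1) n0.
have Tn0 : lT ^+ n.+1 != 0 by exact: lead_neq0 (TT n.+1) n0.
have -> : G ^- n.+1 - lT ^- n.+1 =
    - ((G ^+ n.+1 - lT ^+ n.+1) * (G ^ (- n.+1%:Z) * lT ^ (- n.+1%:Z))).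
  by rewrite -!exprnN; field; rewrite Gn0 Tn0.
have := leadN (leadM (Hn n.+1) (leadM (GT (- n.+1%:Z)) (TT (- n.+1%:Z)))).
rewrite !mulr1 -mulNr (_ : _ + _ + _ = - n.+1%:Z + p%:Z); last by lia.
by rewrite mulrNz [- n.+1%:~R * r]mulNr.
Qed.

Lemma tangent_comp f a c : lead f a c -> lead (lcomp f G - f) (a + p%:Z) (a%:~R * r * c).
Proof.
move=> fa.
have Am := lcomp_mono tangent_zero.
have AB := lcompB tangent_zero.
pose A f := lcomp f G - f.
have hA : zmod_morphism A by move=> g h; rewrite /A AB !opprD opprK addrACA.
have Ac : lcont A.
  move=> N; have [M h] := lcont_comp tangent_zero N.
  exists (Num.max M N) => g gM; apply: vanB; first by apply: h; apply: vanish_belowW gM; lia.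
  by apply: vanish_belowW gM; lia.
have lm b d : lead (A (lmono d b)) (b + p%:Z) (b%:~R * r * d).
  rewrite /A Am /lmono -mulrBr.
  have := leadM (lead_lC d) (tangent_pow b); rewrite add0r.
  by rewrite [X in lead _ _ X -> _]mulrC.
have fE : f = lmono c a + (f - lmono c a) by rewrite addrC subrK.
have AD : {morph A : x y / x + y} by exact: (raddfD (zadd hA)).
rewrite -/(A f) fE AD -[X in lead _ _ X]addr0; apply: leadD => //.
apply: (@van_lead0 _ _ (a + 1 + p%:Z)); last by lia.
apply: (@lcont_van A (a + 1)) => //.
  by move=> d b ab; apply: vanish_belowW (lm _ _).1; lia.
by have := leadB fa (lead_lmono c a); rewrite subrr => /lead0_van.
Qed.
End Tangent.
End Lead.

(** * Rational functions and their expansions *)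

Section FracLift.
Variables (F M : fieldType) (phi : {rmorphism {poly F} -> M}).
Hypothesis phi_inj : forall p, p != 0 -> phi p != 0.

Definition frac_fun (R : {fraction {poly F}}) : M := phi (repr R).1 / phi (repr R).2.

Lemma frac_funE p q : q != 0 -> frac_fun (tofrac p / tofrac q) = phi p / phi q.
Proof.
move=> q0; set R := _ / _; have [d0 RE] := fraction_repr R.
apply/eqP; rewrite /frac_fun eqr_div ?phi_inj// -!rmorphM; apply/eqP.
congr (phi _); apply/eqP; rewrite -tofrac_eq !tofracM -eqr_div ?tofrac_eq0//.
by rewrite -RE.
Qed.

Lemma frac_fun_poly p : frac_fun (tofrac p) = phi p.
Proof. by have := @frac_funE p 1 (oner_neq0 _); rewrite tofrac1 rmorph1 !divr1. Qed.

Lemma frac_fun_is_zmod_morphism : zmod_morphism frac_fun.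
Proof.
move=> R S; have [d0 RE] := fraction_repr R; have [e0 SE] := fraction_repr S.
set p := (repr R).1 in RE; set q := (repr R).2 in d0 RE.
set p' := (repr S).1 in SE; set q' := (repr S).2 in e0 SE.
have -> : R - S = tofrac (p * q' - p' * q) / tofrac (q * q').
  rewrite {1}RE {1}SE -mulNr addf_div ?tofrac_eq0// tofracB !tofracM.
  by rewrite mulNr.
rewrite frac_funE ?mulf_neq0// /frac_fun -/p -/q -/p' -/q'.
rewrite rmorphB !rmorphM; field.
by rewrite !phi_inj.
Qed.

Lemma frac_fun_is_monoid_morphism : monoid_morphism frac_fun.
Proof.
split; first by rewrite -tofrac1 frac_fun_poly rmorph1.
move=> R S; have [d0 RE] := fraction_repr R; have [e0 SE] := fraction_repr S.
have -> : R * S = tofrac ((repr R).1 * (repr S).1) / tofrac ((repr R).2 * (repr S).2).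
  by rewrite {1}RE {1}SE mulf_div !tofracM.
by rewrite frac_funE ?mulf_neq0// !rmorphM /frac_fun mulf_div.
Qed.

Lemma frac_lift : {psi : {rmorphism {fraction {poly F}} -> M} |
  forall p, psi (tofrac p) = phi p}.
Proof.
pose psi : {rmorphism {fraction {poly F}} -> M} := HB.pack frac_fun
  (GRing.isZmodMorphism.Build _ _ frac_fun frac_fun_is_zmod_morphism)
  (GRing.isMonoidMorphism.Build _ _ frac_fun frac_fun_is_monoid_morphism).
exists psi; exact: frac_fun_poly.
Qed.
End FracLift.

Section FracEval.
Variable C : closedFieldType.
Local Notation K := {fraction {poly C}}.

Definition kC (c : C) : K := tofrac c%:P.
Definition kX : K := tofrac 'X.

Lemma kC_is_zmod_morphism : zmod_morphism kC.
Proof. by move=> c d; rewrite /kC polyCB rmorphB. Qed.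
Lemma kC_is_monoid_morphism : monoid_morphism kC.
Proof. by split; rewrite /kC ?rmorph1// => c d; rewrite polyCM rmorphM. Qed.
HB.instance Definition _ := GRing.isZmodMorphism.Build C K kC kC_is_zmod_morphism.
HB.instance Definition _ :=
  GRing.isMonoidMorphism.Build C K kC kC_is_monoid_morphism.

Section Target.
Variables (M : fieldType).
Implicit Types (psi : {rmorphism K -> M}).

Lemma frac_ext psi1 psi2 : psi1 kX = psi2 kX -> (forall c, psi1 (kC c) = psi2 (kC c)) ->
  psi1 =1 psi2.
Proof.
move=> eX eC R; have [d0 ->] := fraction_repr R; rewrite !fmorph_div.
have H p : psi1 (tofrac p) = psi2 (tofrac p).
  elim/poly_ind: p => [|p c IHp]; first by rewrite !rmorph0.
  by rewrite !rmorphD !rmorphM /= IHp eX eC.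
by rewrite !H.
Qed.

(* Over an algebraically closed field every non-constant element is transcendental. *)
Lemma frac_eval (kap : {rmorphism C -> M}) w : (forall x, w != kap x) ->
  {psi : {rmorphism K -> M} | psi kX = w /\ forall c, psi (kC c) = kap c}.
Proof.
move=> wk; pose phi : {rmorphism {poly C} -> M} := horner_morph (fun x => mulrC w (kap x)).
have phiX : phi 'X = w by rewrite /phi /= /horner_morph map_polyX hornerX.
have phiC c : phi c%:P = kap c by rewrite /phi /= /horner_morph map_polyC hornerC.
have phi_inj p : p != 0 -> phi p != 0.
  move=> p0; have [r ->] := closed_field_poly_normal p.
  rewrite -mul_polyC rmorphM rmorph_prod mulf_neq0//.
    by rewrite phiC fmorph_eq0 lead_coef_eq0.
  by rewrite prodf_seq_neq0; apply/allP => x _; rewrite rmorphB phiX phiC subr_eq0 implyTb.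
have [psi psiE] := frac_lift phi_inj; exists psi; rewrite /kX /kC.
by split=> [|c]; rewrite psiE.
Qed.
End Target.

(** The quotient rule on the chosen representative. The laws of a derivation are obtained from
    [frac_deriv_chain], through the injective expansion at 0. *)
Definition frac_deriv (R : K) : K := locked
  ((tofrac ((repr R).1)^`() * tofrac (repr R).2 - tofrac (repr R).1 * tofrac ((repr R).2)^`())
    / tofrac (repr R).2 ^+ 2).

Lemma frac_deriv_chain (M : fieldType) (psi : {rmorphism K -> M}) (d : M -> M) R :
  {morph d : x y / x + y} -> (forall x y, d (x * y) = d x * y + x * d y) ->
  (forall c, d (psi (kC c)) = 0) ->
  d (psi R) = psi (frac_deriv R) * d (psi kX).
Proof.
move=> dD dM dC; have [d0 {1}->] := fraction_repr R.
have dp p : d (psi (tofrac p)) = psi (tofrac p^`()) * d (psi kX).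
  elim/poly_ind: p => [|p c IHp].
    by have := dC 0; rewrite deriv0 !rmorph0 mul0r.
  rewrite !rmorphD !rmorphM /= dD dM IHp dC addr0 derivD derivM derivC derivX addr0 mulr1.
  by rewrite -/kX [in RHS]rmorphD /= rmorphD !rmorphM -/kX /=; ring.
have dV u v : v != 0 -> d (u / v) = (d u * v - u * d v) / v ^+ 2.
  move=> v0; have := dM (u / v) v; rewrite divfK// => ->; field.
  exact: v0.
have q0 : psi (tofrac (repr R).2) != 0 by rewrite fmorph_eq0 tofrac_eq0.
rewrite (fmorph_div psi). 
rewrite (dV _ _ q0).
rewrite (dp (repr R).1) (dp (repr R).2).
rewrite /frac_deriv -lock.
rewrite (fmorph_div psi).
rewrite (rmorphXn psi).
by rewrite (rmorphB psi) !(rmorphM psi); field; exact: q0.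
Qed.
End FracEval.

(** * Expansions at the finite places and at infinity *)

Section Places.
Variable C : numClosedFieldType.
Local Notation K := {fraction {poly C}}.
Local Notation L := (laurent C).

Lemma lead_loc (x : C) : lead (lT C + lC x) 0 x.
Proof.
by rewrite -[X in lead _ _ X]add0r; apply: leadD (lead_lC x); apply: leadW (lead_lT C).1 _.
Qed.

Lemma loc_nconst (x y : C) : lT C + lC x != lC y.
Proof.
apply/eqP => /(congr1 (fun f : L => f 1)); rewrite lcoefD !lCE (lead_lT C).2 addr0.
by move/eqP; rewrite oner_eq0.
Qed.

Definition Tloc (x : C) : {rmorphism K -> L} :=
  sval (frac_eval (kap := @lC C) (loc_nconst x)).

Lemma TlocX x : Tloc x (kX C) = lT C + lC x.
Proof. exact: (svalP (frac_eval (kap := @lC C) (loc_nconst x))).1. Qed.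
Lemma TlocC x c : Tloc x (kC c) = lC c.
Proof. exact: (svalP (frac_eval (kap := @lC C) (loc_nconst x))).2. Qed.

Lemma inf_nconst (y : C) : (lT C)^-1 != lC y.
Proof.
have li := leadV (lead_lT C) (oner_neq0 _); apply/eqP => E.
have := li.2; rewrite E lCE /= => /eqP.
by rewrite eq_sym invr_eq0 oner_eq0.
Qed.

Definition Tinf : {rmorphism K -> L} := sval (frac_eval (kap := @lC C) inf_nconst).

Lemma TinfX : Tinf (kX C) = (lT C)^-1.
Proof. exact: (svalP (frac_eval (kap := @lC C) inf_nconst)).1. Qed.
Lemma TinfC c : Tinf (kC c) = lC c.
Proof. exact: (svalP (frac_eval (kap := @lC C) inf_nconst)).2. Qed.

Lemma lead_loc_poly x (p : {poly C}) : lead (Tloc x (tofrac p)) 0 p.[x].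
Proof.
elim/poly_ind: p => [|p c IHp]; first by rewrite !rmorph0 horner0; apply: lead0.
rewrite !rmorphD !rmorphM /= hornerMXaddC -/(kX C) -/(kC c) TlocX TlocC.
by apply: leadD (lead_lC c); rewrite -[0]addr0; apply: leadM (lead_loc x).
Qed.

Lemma lead_loc_root x (p : {poly C}) n : p.[x] != 0 ->
  lead (Tloc x (tofrac (p * ('X - x%:P) ^+ n))) n%:Z p.[x].
Proof.
move=> px; rewrite !rmorphM !rmorphXn !rmorphB /= -/(kX C) -/(kC x) TlocX TlocC addrK.
have := leadM (lead_loc_poly x p) (leadX n (lead_lT C)).
by rewrite add0r expr1n mulr1 -mulr_natr mul1r natz.
Qed.

Lemma lead_inf_poly (p : {poly C}) : lead (Tinf (tofrac p)) (- (size p).-1%:Z) (lead_coef p).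
Proof.
elim/poly_ind: p => [|p c IHp].
  by rewrite !rmorph0 lead_coef0; apply: lead0.
rewrite !rmorphD !rmorphM /= -/(kX C) -/(kC c) TinfX TinfC.
have [->|p0] := eqVneq p 0.
  rewrite !rmorph0 !mul0r !add0r lead_coefC size_polyC.
  by case: eqP => _ /=; apply: lead_lC.
rewrite size_MXaddC (negbTE p0) /= lead_coefDl; last first.
  by rewrite size_mulX// size_polyC; case: (c != 0); rewrite // ltnS size_poly_gt0.
rewrite lead_coefM lead_coefX -[X in lead _ _ X]addr0.
have sp : (0 < size p)%N by rewrite size_poly_gt0.
apply: leadD; last by apply: leadW (lead_lC c).1 _; rewrite oppr_lt0.
have := leadM IHp (leadV (lead_lT C) (oner_neq0 _)).
by rewrite invr1 -opprD -PoszD addn1 prednK.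
Qed.

Lemma frac_coprime (R : K) : exists A Q : {poly C},
  [/\ Q != 0, coprimep A Q & R = tofrac A / tofrac Q].
Proof.
have [d0 RE] := fraction_repr R; set p := (repr R).1 in RE; set q := (repr R).2 in d0 RE.
have g0 : gcdp p q != 0 by rewrite gcdp_eq0 negb_and d0 orbT.
have pE : p = p %/ gcdp p q * gcdp p q by rewrite divpK// dvdp_gcdl.
have qE : q = q %/ gcdp p q * gcdp p q by rewrite divpK// dvdp_gcdr.
have q0 : q %/ gcdp p q != 0 by apply: contra_neq d0 => E; rewrite qE E mul0r.
exists (p %/ gcdp p q), (q %/ gcdp p q); split=> //.
  by apply: coprimep_div_gcd; rewrite d0 orbT.
rewrite RE; apply/eqP; rewrite eqr_div ?tofrac_eq0// -!tofracM tofrac_eq.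
have h (P S p1 s1 g : {poly C}) : P = p1 * g -> S = s1 * g -> P * s1 = p1 * S.
  by move=> -> ->; ring.
by apply/eqP; exact: (h _ _ _ _ _ pE qE).
Qed.

Lemma loc_finite (q : K) : exists s : seq C, forall x, x \notin s -> vanish_below 0 (Tloc x q).
Proof.
have [A [Q [Q0 _ ->]]] := frac_coprime q.
have [r Qr] := closed_field_poly_normal Q; exists r => x xr.
have Qx : Q.[x] != 0.
  rewrite Qr hornerZ mulf_neq0 ?lead_coef_eq0//.
  by rewrite -rootE root_prod_XsubC.
rewrite fmorph_div.
by have [] := lead_div (lead_loc_poly x A) (lead_loc_poly x Q) Qx.
Qed.

(** A nonconstant denominator of a reduced fraction has a root, at which the numerator does not
    vanish. *)
Lemma frac_liouville (q : K) : (forall x, vanish_below 0 (Tloc x q)) ->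
  exists p : {poly C}, q = tofrac p.
Proof.
have [A [Q [Q0 cAQ ->]]] := frac_coprime q => reg.
suff /size_poly1P[c c0 QE] : size Q == 1%N.
  exists (c^-1 *: A); rewrite QE -mul_polyC tofracM mulrC; congr (_ * _).
  by rewrite -/(kC c) -/(kC _) fmorphV.
rewrite -[_ == _]negbK; apply/negP => /closed_rootP[x].
rewrite rootE => /eqP Qx; have Ax : A.[x] != 0.
  by apply/negP => Ax; have /negP := coprimep_root cAQ Ax; apply; rewrite Qx.
have [n [g]] := multiplicity_XsubC Q x; rewrite Q0 /= rootE => gx QE.
have n0 : (0 < n)%N.
  by case: n QE Qx => // QE; rewrite QE mulr1 => gx0; rewrite gx0 eqxx in gx.
have := lead_div (lead_loc_poly x A) (lead_loc_root n gx) gx.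
rewrite -QE -fmorph_div sub0r => lx.
have := lead_van_le lx (mulf_neq0 Ax (invr_neq0 gx)) (reg x).
by lia.
Qed.
End Places.

Section Deriv.
Variable C : numClosedFieldType.
Local Notation K := {fraction {poly C}}.
Local Notation L := (laurent C).
Local Notation DK := (@frac_deriv C).

Lemma Tloc_deriv x q : Tloc x (DK q) = lderiv (Tloc x q).
Proof.
rewrite (frac_deriv_chain (psi := Tloc x) q (@lderivD C) (@lderivM C)).
  rewrite TlocX lderivD lderiv_lC addr0 -[lT C]expr1z lderivXz ?lT_neq0// subrr expr0z mul1r.
  by rewrite (_ : lderiv (lT C) = 1) ?mulr1//; have := lderiv_mono (1 : C) 1;
     rewrite /lmono rmorph1 !mul1r expr1z subrr expr0z.
by move=> c; rewrite TlocC lderiv_lC.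
Qed.

(** The derivation [d/dz] in the coordinate [t = 1/z]. *)
Definition linfD (f : L) : L := - lT C ^+ 2 * lderiv f.

Lemma lderiv_lT : lderiv (lT C) = 1.
Proof.
by have := lderiv_mono (1 : C) 1; rewrite /lmono rmorph1 !mul1r expr1z subrr expr0z.
Qed.

Lemma Tinf_deriv q : Tinf C (DK q) = linfD (Tinf C q).
Proof.
have T0 := lT_neq0 C.
rewrite /linfD (frac_deriv_chain (psi := Tinf C) q (@lderivD C) (@lderivM C)).
  rewrite TinfX lderivV lderiv_lT; field; exact: T0.
by move=> c; rewrite TinfC lderiv_lC.
Qed.

Lemma lead_linfD f a (c : C) : lead f a c -> lead (linfD f) (a + 1) (- (c *~ a)).
Proof.
move=> fa; have := leadM (leadN (leadX 2 (lead_lT C))) (lead_deriv fa).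
by rewrite expr1n mulN1r (_ : 1 *+ 2 + (a - 1) = a + 1)//; lia.
Qed.

Let T0I : injective (Tloc (0 : C)). Proof. exact: fmorph_inj. Qed.

Lemma frac_derivD : {morph DK : p q / p + q}.
Proof. by move=> p q; apply: T0I; rewrite rmorphD !Tloc_deriv rmorphD lderivD. Qed.
Lemma frac_derivM p q : DK (p * q) = DK p * q + p * DK q.
Proof.
by apply: T0I; rewrite rmorphD !rmorphM !Tloc_deriv rmorphM lderivM.
Qed.
Lemma frac_derivC c : DK (kC c) = 0.
Proof. by apply: T0I; rewrite rmorph0 Tloc_deriv TlocC lderiv_lC. Qed.
Lemma frac_deriv1 : DK 1 = 0.
Proof. by have := frac_derivC 1; rewrite rmorph1. Qed.
Lemma frac_deriv0 : DK 0 = 0.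
Proof. by have := frac_derivC 0; rewrite rmorph0. Qed.

Lemma lead_dlog_loc x (q : K) a c : lead (Tloc x q) a c -> c != 0 ->
  lead (Tloc x (DK q / q)) (-1) a%:~R.
Proof.
move=> qa c0; rewrite fmorph_div Tloc_deriv.
have := lead_div (lead_deriv qa) qa c0.
by rewrite mulrzAl mulfV// (_ : a - 1 - a = -1)//; lia.
Qed.

Lemma lead_dlog_inf (q : K) a c : lead (Tinf C q) a c -> c != 0 ->
  lead (Tinf C (DK q / q)) 1 (- a%:~R).
Proof.
move=> qa c0; rewrite fmorph_div Tinf_deriv.
have := lead_div (lead_linfD qa) qa c0.
by rewrite mulNr mulrzAl mulfV// (_ : a + 1 - a = 1)//; lia.
Qed.

Lemma Tinf_Xsub (x : C) : lead (Tinf C (kX C - kC x)^-1) 1 1.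
Proof.
have := lead_inf_poly ('X - x%:P); rewrite size_XsubC lead_coefXsubC rmorphB /=.
by move=> /leadV/(_ (oner_neq0 _)); rewrite invr1 opprK -fmorphV.
Qed.

Definition simple_part (s : seq C) (r : C -> C) : K :=
  \sum_(x <- s) kC (r x) / (kX C - kC x).

Lemma lead_loc_simple s r x : uniq s -> (forall y, y \notin s -> r y = 0) ->
  lead (Tloc x (simple_part s r)) (-1) (r x).
Proof.
move=> us rs; rewrite rmorph_sum.
have -> : r x = \sum_(y <- s) (if y == x then r x else 0).
  have [xs|xs] := boolP (x \in s).
    by rewrite (bigD1_seq x)//= eqxx big1 ?addr0// => y /negbTE ->.
  rewrite rs// big1_seq// => y /andP[_ ys].
  by case: eqP ys xs => // -> ->.
apply: lead_sum => y _; rewrite fmorph_div rmorphB TlocX !TlocC.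
rewrite -addrA -rmorphB; case: eqP => [->|/eqP yx].
  have := lead_div (lead_lC (r x)) (lead_lT C) (oner_neq0 _).
  by rewrite subrr rmorph0 addr0 sub0r divr1.
have xy0 : x - y != 0 by rewrite subr_eq0 eq_sym.
have := lead_div (lead_lC (r y)) (lead_loc (x - y)) xy0.
by move=> /proj1 h; apply: leadW h _.
Qed.

Lemma lead_inf_simple s r : lead (Tinf C (simple_part s r)) 1 (\sum_(x <- s) r x).
Proof.
rewrite rmorph_sum; apply: lead_sum => x _; rewrite rmorphM /= TinfC.
have := leadM (lead_lC (r x)) (Tinf_Xsub x).
by rewrite add0r mulr1.
Qed.

Lemma frac_eq0_van (q : K) : (forall x, vanish_below 0 (Tloc x q)) ->
  vanish_below 1 (Tinf C q) -> q = 0.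
Proof.
move=> /frac_liouville[p ->] pinf; apply/eqP; rewrite tofrac_eq0; apply/negPn/negP => p0.
have := lead_van_le (lead_inf_poly p) _ pinf; rewrite lead_coef_eq0 => /(_ p0).
by lia.
Qed.

(** The difference has no finite pole and vanishes at infinity. Together with [lead_inf_simple] this
    is the residue theorem: the coefficient at infinity is the sum of the residues. *)
Lemma simple_partE (q : K) s : uniq s ->
  (forall x, x \notin s -> vanish_below 0 (Tloc x q)) ->
  (forall x, vanish_below (-1) (Tloc x q)) -> vanish_below 1 (Tinf C q) ->
  q = simple_part s (fun x => Tloc x q (-1)).
Proof.
move=> us qs q1 qinf; apply/eqP; rewrite -subr_eq0; apply/eqP; apply: frac_eq0_van.
  move=> x; rewrite rmorphB.
  have rs y : y \notin s -> Tloc y q (-1) = 0 by move=> /qs; apply.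
  have := leadB (lead_van (q1 x)) (lead_loc_simple x us rs).
  by rewrite subrr => /lead0_van.
by rewrite rmorphB; apply: vanB (lead_inf_simple _ _).1.
Qed.
End Deriv.

(** * The rational map F *)

Section Dyn.
Variable C : numClosedFieldType.
Local Notation K := {fraction {poly C}}.
Local Notation L := (laurent C).
Local Notation DK := (@frac_deriv C).

Variables (F : K) (m : nat) (v0 : C).
Hypothesis FZ : zero_at0 (Tinf C F)^-1 m v0.

Let m0 : (0 < m)%N. Proof. by case: FZ. Qed.
Let v00 : v0 != 0. Proof. by case: FZ. Qed.

Lemma lead_inf_F : lead (Tinf C F) (- m%:Z) v0^-1.
Proof. by case: FZ => _ _ /leadV/(_ v00); rewrite invrK. Qed.

Lemma F_nconst x : F != kC x.
Proof.
apply/eqP => Fx; have := lead_inf_F; rewrite Fx TinfC => /lead_van_le.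
by move=> /(_ _ (invr_neq0 v00) (lead_lC x).1); lia.
Qed.

Definition sig : {rmorphism K -> K} := sval (frac_eval (kap := @kC C) F_nconst).

Lemma sigX : sig (kX C) = F.
Proof. exact: (svalP (frac_eval (kap := @kC C) F_nconst)).1. Qed.
Lemma sigC c : sig (kC c) = kC c.
Proof. exact: (svalP (frac_eval (kap := @kC C) F_nconst)).2. Qed.

Lemma sig_deriv q : DK (sig q) = sig (DK q) * DK F.
Proof.
rewrite (frac_deriv_chain (psi := sig) q (@frac_derivD C) (@frac_derivM C)) ?sigX//.
by move=> c; rewrite sigC frac_derivC.
Qed.

(** [F(y) = x] with local degree [e]; [v] is the leading coefficient of [F - x] at [y]. *)
Definition lies_over (y x : C) (e : nat) (v : C) := zero_at0 (Tloc y F - lC x) e v.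
Definition pole_at (y : C) (e : nat) (v : C) := zero_at0 (Tloc y F)^-1 e v.

Lemma over_value y x e v : lies_over y x e v -> lead (Tloc y F) 0 x.
Proof.
move=> [e0 _ /proj1 Fv]; rewrite -(subrK (lC x) (Tloc y F)) -[X in lead _ _ X]add0r.
by apply: leadD (lead_lC x); apply: leadW Fv _; rewrite ltz_nat.
Qed.

Lemma value_over y x : lead (Tloc y F) 0 x -> exists e v, lies_over y x e v.
Proof.
move=> Fx; have Fn : Tloc y F - lC x != 0.
  by rewrite subr_eq0 -(TlocC y); apply/eqP => /fmorph_inj/eqP; apply/negP/F_nconst.
have [a [c [c0 Fa]]] := lead_ex Fn.
have := leadB Fx (lead_lC x); rewrite subrr => /lead0_van F1.
have a1 := lead_van_le Fa c0 F1; exists (absz a), c; split=> //; first by lia.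
by rewrite (_ : (absz a)%:Z = a)//; lia.
Qed.

Lemma lead_pole y e v : pole_at y e v -> lead (Tloc y F) (- e%:Z) v^-1.
Proof. by case=> _ v1 /leadV/(_ v1); rewrite invrK. Qed.

Lemma place_cases y : (exists x e v, lies_over y x e v) \/ (exists e v, pole_at y e v).
Proof.
have [v|nv] := pselect (vanish_below 0 (Tloc y F)).
  by left; exists (Tloc y F 0); apply: value_over.
right; have Fn : Tloc y F != 0 by apply: contra_notN nv => /eqP ->.
have [a [c [c0 Fa]]] := lead_ex Fn.
have a0 : a < 0 by rewrite ltNge; apply/negP => a0; apply: nv; apply: vanish_belowW Fa.1.
exists (absz a), c^-1; split; [by lia | by rewrite invr_neq0 |].
by rewrite (_ : (absz a)%:Z = - a); [exact: leadV | lia].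
Qed.

Lemma over_uniq y x e v x' e' v' : lies_over y x e v -> lies_over y x' e' v' -> x = x' /\ e = e'.
Proof.
move=> o o'; have xx := lead_uniq (over_value o) (over_value o').
split=> //; case: o o' => _ v1 l [_ v1' l']; rewrite -xx in l'.
by have [[]] := lead_order l l' v1 v1'.
Qed.

Lemma over_pole y x e v e' v' : lies_over y x e v -> pole_at y e' v' -> False.
Proof.
move=> /over_value/proj1 o p; have [e0 v1 _] := p.
by have := lead_van_le (lead_pole p) (invr_neq0 v1) o; lia.
Qed.

(** Both sides are field morphisms out of [C(z)], so they need only be compared on [z] and on
    constants. *)
Lemma sig_over y x e v q : lies_over y x e v ->
  Tloc y (sig q) = lcomp (Tloc x q) (Tloc y F - lC x).
Proof.
move=> o; apply: (@frac_ext _ _ (Tloc y \o sig) (lcomp_rmorph o \o Tloc x)) => [|c] /=.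
  by rewrite sigX TlocX (lcompD o) (lcompT o) (lcompC o) subrK.
by rewrite sigC !TlocC (lcompC o).
Qed.

Lemma sig_pole y e v q : pole_at y e v -> Tloc y (sig q) = lcomp (Tinf C q) (Tloc y F)^-1.
Proof.
move=> o; apply: (@frac_ext _ _ (Tloc y \o sig) (lcomp_rmorph o \o Tinf C)) => [|c] /=.
  by rewrite sigX TinfX (lcompV o) (lcompT o) invrK.
by rewrite sigC TlocC TinfC (lcompC o).
Qed.

Lemma sig_inf q : Tinf C (sig q) = lcomp (Tinf C q) (Tinf C F)^-1.
Proof.
apply: (@frac_ext _ _ (Tinf C \o sig) (lcomp_rmorph FZ \o Tinf C)) => [|c] /=.
  by rewrite sigX TinfX (lcompV FZ) (lcompT FZ) invrK.
by rewrite sigC !TinfC (lcompC FZ).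
Qed.

Local Notation mu := (DK F).

Lemma lead_mu_over y x e v : lies_over y x e v -> lead (Tloc y mu) (e%:Z - 1) (e%:R * v).
Proof.
move=> [e0 _ /lead_deriv]; rewrite Tloc_deriv lderivD lderivN lderiv_lC subr0.
by rewrite -mulrzr mulrC.
Qed.

Lemma lead_mu_pole y e v : pole_at y e v ->
  lead (Tloc y mu) (- e%:Z - 1) (- e%:R * v^-1).
Proof.
move=> /lead_pole/lead_deriv; rewrite Tloc_deriv -mulrzr mulrC mulrNz.
exact.
Qed.

Lemma lead_mu_inf : lead (Tinf C mu) (1 - m%:Z) (m%:R * v0^-1).
Proof.
have := lead_linfD lead_inf_F; rewrite -Tinf_deriv addrC -mulrzr mulrNz mulrN opprK mulrC.
exact.
Qed.

Lemma mu_neq0 : mu != 0.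
Proof.
rewrite -(fmorph_eq0 (Tinf C)); apply: lead_neq0 lead_mu_inf _.
by rewrite mulf_neq0 ?invr_neq0// pnatr_eq0 -lt0n.
Qed.

(* Local expansion of the pullback mu^k q(F) of the k-differential q dz^k. *)
Lemma pull_over y x e v (k : nat) q a c : lies_over y x e v -> lead (Tloc x q) a c ->
  lead (Tloc y (mu ^+ k * sig q)) (e%:Z * (a + k%:Z) - k%:Z) (e%:R ^+ k * c * v ^ (a + k%:Z)).
Proof.
move=> o qa; have [_ v1 _] := o; rewrite rmorphM rmorphXn (sig_over _ o).
have := leadM (leadX k (lead_mu_over o)) (lead_comp o qa).
rewrite (_ : (e%:Z - 1) *+ k + _ = e%:Z * (a + k%:Z) - k%:Z); last first.
  by rewrite -mulr_natr natz; ring.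
by rewrite exprMn (_ : _ * _ * _ = e%:R ^+ k * c * v ^ (a + k%:Z))// expfzDr//= -exprnP; ring.
Qed.

Lemma pull_pole y e v (k : nat) q a c : pole_at y e v -> lead (Tinf C q) a c ->
  lead (Tloc y (mu ^+ k * sig q)) (e%:Z * (a - k%:Z) - k%:Z)
    ((- e%:R) ^+ k * c * v ^ (a - k%:Z)).
Proof.
move=> o qa; have [_ v1 _] := o; rewrite rmorphM rmorphXn (sig_pole _ o).
have := leadM (leadX k (lead_mu_pole o)) (lead_comp o qa).
rewrite (_ : (- e%:Z - 1) *+ k + _ = e%:Z * (a - k%:Z) - k%:Z); last first.
  by rewrite -mulr_natr natz; ring.
rewrite exprMn exprVn (_ : _ * _ * _ = (- e%:R) ^+ k * c * v ^ (a - k%:Z))//.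
by rewrite expfzDr//= -exprnN; ring.
Qed.

Lemma pull_inf (k : nat) q a c : lead (Tinf C q) a c ->
  lead (Tinf C (mu ^+ k * sig q)) (m%:Z * (a - k%:Z) + k%:Z)
    (m%:R ^+ k * c * v0 ^ (a - k%:Z)).
Proof.
move=> qa; rewrite rmorphM rmorphXn sig_inf.
have := leadM (leadX k lead_mu_inf) (lead_comp FZ qa).
rewrite (_ : (1 - m%:Z) *+ k + _ = m%:Z * (a - k%:Z) + k%:Z); last first.
  by rewrite -mulr_natr natz; ring.
rewrite exprMn exprVn (_ : _ * _ * _ = m%:R ^+ k * c * v0 ^ (a - k%:Z))//.
by rewrite expfzDr//= -exprnN; ring.
Qed.

(** The nonlinearity [F''/F'], the inhomogeneous term in the pullback of affine connections. *)
Definition rho : K := DK mu / mu.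

Lemma rho_over y x e v : lies_over y x e v -> lead (Tloc y rho) (-1) (e%:R - 1).
Proof.
move=> o; have [e0 v1 _] := o; have := lead_dlog_loc (lead_mu_over o) _.
rewrite mulf_neq0 ?pnatr_eq0 -?lt0n//= => /(_ isT).
by rewrite rmorphB.
Qed.

Lemma rho_pole y e v : pole_at y e v -> lead (Tloc y rho) (-1) (- e%:R - 1).
Proof.
move=> o; have [e0 v1 _] := o; have := lead_dlog_loc (lead_mu_pole o) _.
rewrite mulf_neq0 ?invr_neq0 ?oppr_eq0 ?pnatr_eq0 -?lt0n//= => /(_ isT).
by rewrite rmorphB rmorphN.
Qed.

Lemma rho_inf : lead (Tinf C rho) 1 (m%:R - 1).
Proof.
have := lead_dlog_inf lead_mu_inf _.
rewrite mulf_neq0 ?invr_neq0 ?pnatr_eq0 -?lt0n//= => /(_ isT).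
by rewrite rmorphB opprB.
Qed.
End Dyn.

Definition rational_number (C : numClosedFieldType) (z : C) :=
  exists2 N : nat, (0 < N)%N & exists n : int, z * N%:R = n%:~R.

(** * Finite backward-closed sets and orders of poles *)

Section Backward.
Variable C : numClosedFieldType.
Local Notation K := {fraction {poly C}}.
Local Notation DK := (@frac_deriv C).

Variables (F : K) (m : nat) (v0 : C).
Hypothesis FZ : zero_at0 (Tinf C F)^-1 m v0.

Definition backward_closed (B : C -> Prop) :=
  forall y x e v, lies_over F y x e v -> B x -> B y.

(* No finite backward-closed set carries a positive weight multiplied by the
   local degree under pullback. *)
Definition no_backward := forall (B : C -> Prop) (s : seq C) (w : C -> int),
  (forall x, B x -> x \in s) -> backward_closed B -> (forall x, B x -> 0 < w x) ->
  (forall y x e v, lies_over F y x e v -> B x -> w y = e%:Z * w x) -> forall x, ~ B x.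

Lemma over_translation (k y : C) : F = kX C + kC k -> lies_over F (y - k) y 1 1.
Proof.
move=> FE; split; rewrite ?oner_neq0// FE rmorphD TlocX !TlocC rmorphB.
rewrite -[_ + _ + lC k]addrA subrK addrK; exact: lead_lT.
Qed.

Lemma translate_notin (k x : C) (s : seq C) : k != 0 -> exists n : nat, x - n%:R * k \notin s.
Proof.
move=> k0; apply: contrapT => nx.
have us : uniq [seq x - i%:R * k | i <- iota 0 (size s).+1].
  rewrite map_inj_uniq ?iota_uniq// => i j /addrI/oppr_inj/(mulIf k0)/eqP.
  by rewrite eqr_nat => /eqP.
have /(uniq_leq_size us) : {subset [seq x - i%:R * k | i <- iota 0 (size s).+1] <= s}.
  move=> _ /mapP[i _ ->]; apply/negPn/negP => h; by apply: nx; exists i.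
by rewrite size_map size_iota ltnn.
Qed.

Lemma no_backward_translation (k : C) : k != 0 -> F = kX C + kC k -> no_backward.
Proof.
move=> k0 FE B s w Bs Bc _ _ x Bx.
have Bn n : B (x - n%:R * k).
  elim: n => [|n IHn]; first by rewrite mul0r subr0.
  rewrite -natr1 mulrDl mul1r opprD addrA.
  exact: Bc (over_translation _ FE) IHn.
by have [n] := translate_notin x s k0; rewrite Bs.
Qed.

Section PoleOrder.
Local Notation mu := (DK F).
Variables (k : nat) (q eta : K).
Hypotheses (NB : no_backward) (qE : mu ^+ k * sig FZ q = q + eta).

(** Where [q] has a pole deeper than [k], the term [eta] cannot interfere, and the order [o]
    satisfies [o(y) + k = e (o(x) + k)] for [y] over [x]. So these points are finitely many, are
    closed under preimages, and carry the positive weights [- (o + k)], multiplied by the local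
    degree. *)
Lemma pole_order : (forall x, vanish_below (- k%:Z) (Tloc x eta)) ->
  forall x, vanish_below (- k%:Z) (Tloc x q).
Proof.
move=> etak x; apply: contrapT => Bx.
have q0 : q != 0 by apply: contra_notN Bx => /eqP ->; rewrite rmorph0.
have lq y : exists a, exists2 c, c != 0 & lead (Tloc y q) a c.
  have q1 : Tloc y q != 0 by rewrite fmorph_eq0.
  by have [a [c [c0 l]]] := lead_ex q1; exists a, c.
have /choice[o oP] := lq.
pose B y := ~ vanish_below (- k%:Z) (Tloc y q).
have BP y : B y <-> o y < - k%:Z.
  have [c c0 l] := oP y; split=> [By|oy v].
    by rewrite ltNge; apply/negP => ky; apply: By; apply: vanish_belowW l.1.
  by have := lead_van_le l c0 v; rewrite leNgt oy.
have [s sP] := loc_finite q.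
have trans y z e v : lies_over F y z e v -> B z -> o y = e%:Z * (o z + k%:Z) - k%:Z.
  move=> ov /BP oz; have [e0 v1 _] := ov.
  have [c c0 l] := oP z; have [c' c0' l'] := oP y.
  have := pull_over FZ k ov l; rewrite qE rmorphD => l2.
  have lt : e%:Z * (o z + k%:Z) - k%:Z < - k%:Z by nia.
  have := leadB l2 (leadW (etak y) lt); rewrite addrK subr0 => l3.
  have [] // := lead_order l' l3 c0' _.
  by rewrite !mulf_neq0// ?expf_neq0 ?expfz_neq0// pnatr_eq0 -lt0n.
apply: (@NB B s (fun y => - (o y + k%:Z))) Bx.
- move=> y By; apply/negPn/negP => /sP h; apply: By.
  by apply: vanish_belowW h; rewrite oppr_le0.
- move=> y z e v ov Bz; apply/BP; have [e0 _ _] := ov.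
  by rewrite (trans _ _ _ _ ov Bz); move/BP: Bz; nia.
- by move=> y /BP; lia.
- by move=> y z e v ov Bz; rewrite (trans _ _ _ _ ov Bz) addrNK mulrN.
Qed.
End PoleOrder.

Variables (A Q : {poly C}).
Hypotheses (Q0 : Q != 0) (AQ : coprimep A Q) (FE : F = tofrac A / tofrac Q).

(** The preimages of infinity are infinity itself, with multiplicity [m], and the roots of [Q]. *)
Lemma size_numer : size A = (m + size Q)%N.
Proof.
have [m0 v00 _] := FZ; have FI := lead_inf_F FZ.
have A0 : A != 0.
  apply: contraTneq (invr_neq0 v00) => A0; rewrite negbK; apply/eqP.
  by have [_ <-] := FI; rewrite FE A0 rmorph0 mul0r rmorph0.
have lQ : lead_coef Q != 0 by rewrite lead_coef_eq0.
have := lead_div (lead_inf_poly A) (lead_inf_poly Q) lQ.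
rewrite -fmorph_div -FE => FI'.
have [] := lead_order FI FI' (invr_neq0 v00) _.
  by rewrite mulf_neq0 ?invr_eq0// lead_coef_eq0.
have sA : (0 < size A)%N by rewrite size_poly_gt0.
have sQ : (0 < size Q)%N by rewrite size_poly_gt0.
move=> + _; rewrite opprK; move: (size A) (size Q) sA sQ => a q; lia.
Qed.

Lemma value_root y x : lead (Tloc y F) 0 x -> Q.[y] != 0 /\ A.[y] = x * Q.[y].
Proof.
move=> Fy; have E : A.[y] = x * Q.[y].
  have := leadM Fy (lead_loc_poly y Q).
  rewrite -rmorphM FE divfK ?tofrac_eq0// add0r => h.
  exact: lead_uniq (lead_loc_poly y A) h.
split=> //; apply/negP => /eqP Qy; move: E; rewrite Qy mulr0 => Ay.
by have := coprimep_root AQ; rewrite /root => /(_ y); rewrite Ay eqxx Qy eqxx => /(_ isT).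
Qed.

Lemma root_value y x : Q.[y] != 0 -> A.[y] = x * Q.[y] -> lead (Tloc y F) 0 x.
Proof.
move=> Qy Ay; have := lead_div (lead_loc_poly y A) (lead_loc_poly y Q) Qy.
by rewrite -fmorph_div -FE Ay mulfK.
Qed.

Lemma pole_root y : Q.[y] = 0 -> exists e v, pole_at F y e v.
Proof.
move=> Qy; have [[x [e [v o]]]|//] := place_cases FZ y.
by have [] := value_root (over_value o); rewrite Qy eqxx.
Qed.

Lemma root_pole y e v : pole_at F y e v -> Q.[y] = 0.
Proof.
move=> p; apply/eqP/negPn/negP => Qy.
have Fy : lead (Tloc y F) 0 (A.[y] / Q.[y]) by apply: root_value => //; rewrite divfK.
by have [e' [v' o]] := value_over FZ Fy; have := over_pole FZ o p.
Qed.

Lemma size_fiber x : size (A - x *: Q) = size A.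
Proof.
rewrite size_polyDl// size_polyN (leq_ltn_trans (size_scale_leq _ _))// size_numer.
by have [m0 _ _] := FZ; rewrite -{1}[size Q]add0n ltn_add2r.
Qed.

Lemma fiber_root x y : root (A - x *: Q) y -> exists e v, lies_over F y x e v.
Proof.
rewrite rootE hornerD hornerN hornerZ subr_eq0 => /eqP Ay.
apply: (value_over FZ); apply: root_value => //; apply/negP => /eqP Qy.
have Ar : root A y by rewrite rootE Ay Qy mulr0.
by have := coprimep_root AQ Ar; rewrite Qy eqxx.
Qed.

(** As infinity is fixed, [A - x Q] keeps the positive degree of [A]. *)
Lemma over_surj x : exists y e v, lies_over F y x e v.
Proof.
have : size (A - x *: Q) != 1%N.
  rewrite size_fiber size_numer; have [m0 _ _] := FZ.
  by move: (size Q) (size_poly_gt0 Q) => q; rewrite Q0; lia.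
by move=> /closed_rootP[y /fiber_root h]; exists y.
Qed.

Section Closed.
Variables (B : C -> Prop) (s : seq C).
Hypotheses (Bs : forall x, B x -> x \in s) (Bc : backward_closed B).

(* F permutes a finite backward-closed set, so each point of it has a single,
   totally ramified, preimage. *)
Lemma backward_closed_total y : B y -> exists x v, B x /\ lies_over F y x (size A).-1 v.
Proof.
pose pre x := projT1 (cid (over_surj x)).
have preP x : exists e v, lies_over F (pre x) x e v := projT2 (cid (over_surj x)).
pose t := [seq x <- undup s | `[< B x >]].
have tP x : (x \in t) <-> B x.
  rewrite mem_filter mem_undup; split=> [/andP[/asboolP]//|Bx].
  by rewrite Bs// andbT; apply/asboolP.
have pret x : B x -> B (pre x) by have [e [v o]] := preP x; apply: Bc o.
have preI : injective pre.
  move=> x x' E; have [e [v o]] := preP x; have [e' [v' o']] := preP x'.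
  by rewrite E in o; case: (over_uniq o o').
have ut : uniq (map pre t) by rewrite map_inj_uniq// filter_uniq// undup_uniq.
have st : {subset map pre t <= t} by move=> _ /mapP[x /tP Bx ->]; apply/tP; apply: pret.
have [|_ tE] := uniq_min_size ut st; first by rewrite size_map.
have inv z : B z -> exists2 x, B x & z = pre x.
  by move=> /tP; rewrite -tE => /mapP[x /tP Bx ->]; exists x.
move=> /inv[x Bx yE]; exists x.
have uniq_pre z : root (A - x *: Q) z -> z = y.
  move=> /fiber_root[e [v o]]; have [x' _ zE] := inv _ (Bc o Bx).
  have [e' [v' o']] := preP x'; rewrite -zE in o'.
  by have [xx _] := over_uniq o o'; rewrite yE zE xx.
have p0 : A - x *: Q != 0.
  by rewrite -size_poly_gt0 size_fiber size_numer; have [m0 _ _] := FZ; rewrite addn_gt0 m0.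
have [r pE] := closed_field_poly_normal (A - x *: Q).
have lp : lead_coef (A - x *: Q) != 0 by rewrite lead_coef_eq0.
have rE : r = nseq (size r) y.
  apply/all_pred1P/allP => z zr /=; apply/eqP/uniq_pre.
  by rewrite pE rootZ// root_prod_XsubC.
have sr : size r = (size A).-1.
  by rewrite -(size_fiber x) pE size_scale// size_prod_XsubC.
have {}pE : A - x *: Q = (lead_coef (A - x *: Q))%:P * ('X - y%:P) ^+ (size A).-1.
  have rp : \prod_(z <- r) ('X - z%:P) = ('X - y%:P) ^+ size r.
    by rewrite {1}rE big_nseq iter_mulr_1.
  by rewrite {1}pE rp mul_polyC sr.
have [e [v o]] := preP x; rewrite -yE in o.
have [Qy _] := value_root (over_value o).
have ly := lead_loc_root (p := (lead_coef (A - x *: Q))%:P) (x := y) (size A).-1.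
rewrite hornerC in ly; have {ly} := lead_div (ly lp) (lead_loc_poly y Q) Qy.
rewrite -pE -fmorph_div rmorphB /= mulrBl -FE -mul_polyC rmorphM /= mulfK ?tofrac_eq0//.
rewrite -/(kC x) rmorphB /= TlocC subr0; rewrite mul_polyC => l.
exists (lead_coef (A - x *: Q) / Q.[y]); split=> //; split=> //.
  rewrite size_numer; have [m0 _ _] := FZ.
  by move: (size Q) (size_poly_gt0 Q) => q; rewrite Q0; lia.
by rewrite mulf_neq0 ?invr_neq0.
Qed.
End Closed.

(** Preimages inside such a set are totally ramified, so each step back multiplies the weight by the
    degree, which is at least 2; the weights would be unbounded on a finite set. *)
Lemma no_backward_deg : (2 < size A)%N -> no_backward.
Proof.
move=> d2 B s w Bs Bc w0 we x Bx.
have step z : B z -> exists y, B y /\ w z + 1 <= w y.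
  move=> Bz; have [y [e [v o]]] := over_surj z; have By := Bc _ _ _ _ o Bz.
  exists y; split=> //; have [z' [v' [_ o']]] := backward_closed_total Bs Bc By.
  have [_ eE] := over_uniq o o'; rewrite (we _ _ _ _ o Bz) eE.
  have := w0 z Bz; move: (size A) d2 => a; nia.
have large (n : nat) : exists y, B y /\ n%:Z <= w y.
  elim: n => [|n [y [By ny]]]; first by exists x; split=> //; apply: ltW; apply: w0.
  by have [y' [By' yy']] := step y By; exists y'; split=> //; lia.
pose M := (\sum_(y <- undup s) absz (w y))%N.
have [y [By My]] := large M.+1.
have : (absz (w y) <= M)%N.
  by rewrite /M (bigD1_seq y) ?undup_uniq ?mem_undup ?Bs//= leq_addr.
lia.
Qed.

(* On a cycle of length k a functional equation d E(x) = E(y) + n forces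
   (d^k - 1) E to be an integer. *)
Lemma rational_weights (s : seq C) (E : C -> C) : (2 < size A)%N ->
  (forall x, x \notin s -> E x = 0) ->
  (forall y x e v, lies_over F y x e v -> exists n : int, e%:R * E x = E y + n%:~R) ->
  forall x, rational_number (E x).
Proof.
move=> d2 Es Ee x; apply: contrapT => Bx.
pose B x := ~ rational_number (E x).
have Bs z : B z -> z \in s.
  move=> Bz; apply/negPn/negP => /Es Ez; apply: Bz; rewrite Ez.
  by exists 1%N => //; exists 0; rewrite mul0r.
have Bc : backward_closed B.
  move=> y z e v o Bz [N N0 [n En]]; apply: Bz.
  have [e0 _ _] := o; have [k Ek] := Ee _ _ _ _ o.
  exists (N * e)%N; first by rewrite muln_gt0 N0.
  exists (n + k * N%:Z); rewrite natrM mulrCA mulrC [E z * _]mulrC Ek mulrDl En.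
  by rewrite rmorphD rmorphM.
set d := (size A).-1; have d1 : (1 < d)%N by rewrite /d; lia.
have /choice[next nextP] : forall y, exists z, B y ->
    B z /\ exists n : int, E y = d%:R * E z + n%:~R.
  move=> y; have [By|nBy] := pselect (B y); last by exists y.
  have [z [v [Bz o]]] := backward_closed_total Bs Bc By.
  have [n En] := Ee _ _ _ _ o; exists z => _; split=> //; exists (- n).
  by rewrite En rmorphN addrK.
have it (k : nat) y : B y -> B (iter k next y) /\
    exists n : int, E y = d%:R ^+ k * E (iter k next y) + n%:~R.
  move=> By; elim: k => [|k [Bk [n En]]]; first by split=> //; exists 0; rewrite mul1r addr0.
  have [Bz [l El]] := nextP _ Bk; split=> //; exists (d%:Z ^+ k * l + n).
  by rewrite En El rmorphD rmorphM rmorphXn exprSr; ring.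
have : ~~ uniq [seq iter k next x | k <- iota 0 (size s).+1].
  apply/negP => us; suff : (size s < size s)%N by rewrite ltnn.
  rewrite -[X in (X <= _)%N](size_iota 0) -(size_map (fun k => iter k next x)).
  by apply: uniq_leq_size us _ => _ /mapP[k _ ->]; apply: Bs; case: (it k _ Bx).
move=> /(uniqPn x)[i [j []]]; rewrite size_map size_iota => ij jn.
have iN : (i < (size s).+1)%N by apply: ltn_trans ij jn.
rewrite !(nth_map 0%N) ?size_iota// !nth_iota// !add0n => Eij.
have [Bi _] := it i _ Bx; apply: (Bi).
have [_ [n]] := it (j - i)%N _ Bi; rewrite -iterD subnK ?(ltnW ij)// -Eij => En.
have dk : (1 < d ^ (j - i))%N by rewrite -(expn0 d) ltn_exp2l// subn_gt0.
exists (d ^ (j - i) - 1)%N; first by rewrite subn_gt0.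
exists (- n); rewrite natrB ?(ltnW dk)// natrX mulrBr mulr1 {2}En rmorphN.
by rewrite mulrC opprD addNKr.
Qed.

End Backward.

(** * Invariant connections *)

Section TangentPull.
Variable C : numClosedFieldType.
Local Notation K := {fraction {poly C}}.
Local Notation DK := (@frac_deriv C).
Variables (F : K) (m : nat) (v0 : C).
Hypothesis FZ : zero_at0 (Tinf C F)^-1 m v0.
Variables (p : nat) (r : C).
Hypotheses (p0 : (0 < p)%N) (Gp : lead ((Tinf C F)^-1 - lT C) (p%:Z + 1) r).
Local Notation mu := (DK F).

(** Here [F = z - r z^(1-p) + ...], hence [mu = 1 + r (p - 1) z^(-p) + ...]. *)
Lemma tangent_mu : lead (Tinf C mu - 1) p%:Z (r * (p%:R - 1)).
Proof.
set G := (Tinf C F)^-1; pose H := G - lT C.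
have G1 := tangent_lead p0 Gp; have n0 : (1 : C) != 0 by exact: oner_neq0.
have Gn0 : G != 0 := lead_neq0 G1 n0.
have -> : Tinf C mu - 1 = (lT C ^+ 2 * lderiv H - lT C * H *+ 2 - H ^+ 2) / G ^+ 2.
  rewrite Tinf_deriv -[Tinf C F]invrK -/G /linfD lderivV.
  have -> : lderiv G = 1 + lderiv H by rewrite -lderiv_lT -lderivD /H addrC subrK.
  by rewrite /H; field.
have lH : lead H (p%:Z + 1) r by [].
have l1 := leadM (leadX 2 (lead_lT C)) (lead_deriv lH).
have l2 := leadM (lead_lT C) lH.
have l3 : vanish_below (p%:Z + 3) (H ^+ 2).
  by rewrite expr2; apply: vanish_belowW (vanM lH.1 lH.1); lia.
rewrite (_ : 1 *+ 2 + (p%:Z + 1 - 1) = p%:Z + 2) in l1; last by lia.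
rewrite (_ : 1 + (p%:Z + 1) = p%:Z + 2) in l2; last by lia.
have l3' : lead (H ^+ 2) (p%:Z + 2) 0 by apply: leadW l3 _; lia.
have := lead_div (leadB (leadB l1 (leadD l2 l2)) l3') (leadX 2 G1) _.
rewrite expr1n oner_neq0 divr1 mulr2n => /(_ isT).
rewrite (_ : p%:Z + 2 - 1 *+ 2 = p%:Z); last by lia.
rewrite (_ : _ - 0 = r * (p%:R - 1))//.
by rewrite !mul1r -mulrzr rmorphD; ring.
Qed.

Lemma tangent_muX k : lead (Tinf C (mu ^+ k) - 1) p%:Z (k%:R * (r * (p%:R - 1))).
Proof.
elim: k => [|k IHk].
  by rewrite expr0 rmorph1 subrr mul0r; exact: lead0.
have -> : Tinf C (mu ^+ k.+1) - 1 =
    (Tinf C mu - 1) * (Tinf C (mu ^+ k) - 1) + (Tinf C (mu ^+ k) - 1) + (Tinf C mu - 1).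
  by rewrite exprS rmorphM /=; ring.
have -> : k.+1%:R * (r * (p%:R - 1)) = k%:R * (r * (p%:R - 1)) + r * (p%:R - 1).
  by rewrite -natr1; ring.
apply: leadD tangent_mu.
rewrite -[X in lead _ _ X]add0r; apply: (leadD _ IHk).
by apply: leadW (vanM tangent_mu.1 IHk.1) _; lia.
Qed.

(** The first-order term is the Lie derivative of [q dz^k] along the field [r t^(p+1) d/dt]. *)
Lemma tangent_pull (k : nat) q a c : lead (Tinf C q) a c ->
  lead (Tinf C (mu ^+ k * sig FZ q - q)) (a + p%:Z) (r * (a%:~R + k%:R * (p%:R - 1)) * c).
Proof.
move=> qa; rewrite rmorphB rmorphM /= sig_inf; set G := (Tinf C F)^-1.
have l1 := tangent_comp p0 Gp qa.
have l0 := lead_comp (tangent_zero p0 Gp) qa; rewrite mul1r exp1rz mulr1 in l0.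
have l2 := leadM (tangent_muX k) l0; rewrite [p%:Z + a]addrC in l2.
have -> : Tinf C (mu ^+ k) * lcomp (Tinf C q) G - Tinf C q =
  (lcomp (Tinf C q) G - Tinf C q) + (Tinf C (mu ^+ k) - 1) * lcomp (Tinf C q) G by ring.
have -> : r * (a%:~R + k%:R * (p%:R - 1)) * c =
  a%:~R * r * c + k%:R * (r * (p%:R - 1)) * c by ring.
exact: leadD.
Qed.

Lemma tangent_rho : lead (Tinf C (rho F)) (1 + p%:Z) (- (r * p%:R * (p%:R - 1))).
Proof.
have lm : lead (Tinf C mu) 0 1.
  rewrite -(subrK 1 (Tinf C mu)) -[X in lead _ _ X]add0r; apply: leadD (lead1 _).
  by apply: leadW tangent_mu.1 _; lia.
rewrite /rho fmorph_div.
have -> : Tinf C (DK mu) = linfD (Tinf C mu - 1).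
  by rewrite Tinf_deriv /linfD lderivD lderivN lderiv1 subr0.
have := lead_div (lead_linfD tangent_mu) lm (oner_neq0 _).
rewrite subr0 divr1 [p%:Z + 1]addrC -mulrzr.
by have -> : r * (p%:R - 1) * p%:~R = r * p%:R * (p%:R - 1) by ring.
Qed.
End TangentPull.

Section Connections.
Variable C : numClosedFieldType.
Local Notation K := {fraction {poly C}}.
Local Notation DK := (@frac_deriv C).

Variables (F : K) (m : nat) (v0 : C).
Hypothesis FZ : zero_at0 (Tinf C F)^-1 m v0.
Variables (A Q : {poly C}).
Hypotheses (Q0 : Q != 0) (AQ : coprimep A Q) (FE : F = tofrac A / tofrac Q).
Hypothesis d2 : (2 < size A)%N.

Local Notation mu := (DK F).
Local Notation rho := (rho F).
Local Notation sig := (sig FZ).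

Let NB : no_backward F := no_backward_deg FZ Q0 AQ FE d2.

Lemma pole_exists : (m < 2)%N -> exists y e v, pole_at F y e v.
Proof.
move=> m2; have : size Q != 1%N.
  by have := size_numer FZ Q0 AQ FE; move: d2 m2; move: (size A) (size Q) => *; lia.
by move=> /closed_rootP[y /eqP/(pole_root FZ Q0 AQ FE)]; exists y.
Qed.

(** An order [a < k] at infinity becomes [m (a - k) + k < a] after pullback if [m >= 2]. If [m = 1],
    some finite [y] is a pole of [F], and pullback to [y] produces a pole deeper than [pole_order]
    allows. *)
Lemma inf_order (k : nat) (q eta : K) : mu ^+ k * sig q = q + eta ->
  (forall x, vanish_below (- k%:Z) (Tloc x eta)) -> vanish_below k%:Z (Tinf C eta) ->
  vanish_below k%:Z (Tinf C q).
Proof.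
move=> qE etax etai; have qx := pole_order NB qE etax.
have [->|q0] := eqVneq q 0; first by rewrite rmorph0.
have q1 : Tinf C q != 0 by rewrite fmorph_eq0.
have [a [c [c0 l]]] := lead_ex q1; have [ka|ak] := leP k%:Z a; first exact: vanish_belowW ka l.1.
have [m0 v00 _] := FZ; exfalso; have [m2|m2] := leqP 2 m.
  have := lead_van_le (pull_inf FZ k l) _ (_ : vanish_below a _).
  rewrite qE rmorphD !mulf_neq0 ?expf_neq0 ?expfz_neq0 ?pnatr_eq0 -?lt0n// => H.
  have := H isT (vanD l.1 (vanish_belowW (ltW ak) etai)); nia.
have [y [e [v o]]] := pole_exists m2; have [e0 v1 _] := o.
have := lead_van_le (pull_pole FZ k o l) _ (_ : vanish_below (- k%:Z) _).
rewrite qE rmorphD !mulf_neq0 ?expf_neq0 ?expfz_neq0 ?oppr_eq0 ?pnatr_eq0 -?lt0n// => H.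
by have := H isT (vanD (qx y) (etax y)); nia.
Qed.

Section Affine.
Variable g : K.
Hypothesis gE : mu * sig g = g + rho.

Let gE1 : mu ^+ 1 * sig g = g + rho. Proof. by rewrite expr1. Qed.

Lemma rho_loc x : vanish_below (-1) (Tloc x rho).
Proof.
by have [[z [e [v /rho_over[]]]]|[e [v /rho_pole[]]]] := place_cases FZ x.
Qed.

Lemma conn_loc x : lead (Tloc x g) (-1) (Tloc x g (-1)).
Proof. exact: lead_van (pole_order NB gE1 rho_loc x). Qed.

Lemma conn_inf : lead (Tinf C g) 1 (Tinf C g 1).
Proof. apply: lead_van; exact: inf_order gE1 rho_loc (rho_inf FZ).1. Qed.

(** The number [1 - residue] is the angle of the affine structure at a point, and pullback
    multiplies angles by the local degree. It returns later as [nu]. *)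
Lemma conn_over y x e v : lies_over F y x e v ->
  Tloc y g (-1) - 1 = e%:R * (Tloc x g (-1) - 1).
Proof.
move=> o; have := pull_over FZ 1 o (conn_loc x); rewrite gE1 rmorphD addNr mulr0 sub0r.
move=> /lead_uniq/(_ (leadD (conn_loc y) (rho_over o))) h.
have : e%:R * Tloc x g (-1) = Tloc y g (-1) + (e%:R - 1) by rewrite -h expr1 expr0z mulr1.
by move=> E; rewrite mulrBr E; ring.
Qed.

Lemma conn_pole y e v : pole_at F y e v ->
  Tloc y g (-1) - 1 = e%:R * (1 - Tinf C g 1).
Proof.
move=> o; have := pull_pole FZ 1 o conn_inf; rewrite gE1 rmorphD subrr mulr0 sub0r.
move=> /lead_uniq/(_ (leadD (conn_loc y) (rho_pole o))) h.
have : - e%:R * Tinf C g 1 = Tloc y g (-1) + (- e%:R - 1) by rewrite -h expr1 expr0z mulr1.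
by move=> E; rewrite mulrBr -[e%:R * Tinf C g 1]opprK -mulNr E; ring.
Qed.

Lemma conn_inf_coef : (m%:R - 1) * (Tinf C g 1 - 1) = 0.
Proof.
have := pull_inf FZ 1 conn_inf; rewrite gE1 rmorphD subrr mulr0 add0r.
move=> /lead_uniq/(_ (leadD conn_inf (rho_inf FZ))) h.
have : m%:R * Tinf C g 1 = Tinf C g 1 + (m%:R - 1) by rewrite -h expr1 expr0z mulr1.
by move=> E; rewrite mulrBr mulrBl E; ring.
Qed.

Lemma conn_support : exists s : seq C, forall x, x \notin s -> Tloc x g (-1) = 0.
Proof. by have [s sP] := loc_finite g; exists s => x /sP; apply. Qed.

(* If infinity is superattracting, the residues of g equal to 1 form a finite
   backward-closed set containing the poles of F, so F is a polynomial. *)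
Lemma conn_superattracting : (1 < m)%N -> size Q = 1%N.
Proof.
move=> m2; apply/eqP/negPn/negP => /closed_rootP[y /eqP/(pole_root FZ Q0 AQ FE)[e [v o]]].
have g1 : Tinf C g 1 - 1 = 0.
  have /eqP := conn_inf_coef; rewrite mulf_eq0 => /orP[|/eqP//].
  by rewrite subr_eq0 pnatr_eq1 => /eqP E; rewrite E in m2.
have [s sP] := conn_support.
pose B x := Tloc x g (-1) - 1 = 0.
have Bs x : B x -> x \in s.
  rewrite /B => Bx; apply/negPn/negP => /sP E; move: Bx; rewrite E sub0r => /eqP.
  by rewrite oppr_eq0 oner_eq0.
have Bc : backward_closed F B.
  by move=> z x e' v' o' Bx; rewrite /B (conn_over o') Bx mulr0.
have By : B y by rewrite /B (conn_pole o) -opprB g1 oppr0 mulr0.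
have [x [v' [_ o']]] := backward_closed_total FZ Q0 AQ FE Bs Bc By.
by have := over_pole FZ o' o.
Qed.

(* If infinity is parabolic, g has residue p at infinity, so that its residues at the
   poles of F exceed 1; the residues with this property form a finite
   backward-closed set. *)
Lemma conn_parabolic (p : nat) (r : C) : (0 < p)%N -> r != 0 ->
  lead ((Tinf C F)^-1 - lT C) (p%:Z + 1) r -> False.
Proof.
move=> p0 r0 Gp; have g1 : Tinf C g 1 = 1 - p%:R.
  have := tangent_pull FZ p0 Gp 1 conn_inf; rewrite expr1 gE addrC addKr.
  move=> /lead_uniq/(_ (tangent_rho p0 Gp)) E.
  have pr0 : r * p%:R != 0 by rewrite mulf_neq0// pnatr_eq0 -lt0n.
  apply: (mulfI pr0).
  have -> : r * p%:R * Tinf C g 1 = r * (1%:~R + 1%:R * (p%:R - 1)) * Tinf C g 1 by ring.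
  by rewrite E; ring.
have m1 : (m < 2)%N.
  have [m0 v00 l] := FZ; have [] := lead_order l (tangent_lead p0 Gp) v00 (oner_neq0 _).
  by lia.
have [y [e [v o]]] := pole_exists m1; have [e0 _ _] := o.
have [s sP] := conn_support.
pose B x := 0 < Tloc x g (-1) - 1.
have Bs x : B x -> x \in s.
  rewrite /B => Bx; apply/negPn/negP => /sP E; move: Bx; rewrite E sub0r oppr_gt0.
  by rewrite lt_gtF ?ltr01.
have Bc : backward_closed F B.
  move=> z x e' v' o' Bx; have [e0' _ _] := o'.
  by rewrite /B (conn_over o') mulr_gt0// ltr0n.
have By : B y.
  by rewrite /B (conn_pole o) g1 opprB addrC subrK -natrM ltr0n muln_gt0 e0.
have [x [v' [_ o']]] := backward_closed_total FZ Q0 AQ FE Bs Bc By.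
by have := over_pole FZ o' o.
Qed.
End Affine.
End Connections.

(** * From projective to affine connections *)

Section Projective.
Variable C : numClosedFieldType.
Local Notation K := {fraction {poly C}}.
Local Notation DK := (@frac_deriv C).

Variables (F : K) (m : nat) (v0 : C).
Hypothesis FZ : zero_at0 (Tinf C F)^-1 m v0.
Variables (A Q : {poly C}).
Hypotheses (Q0 : Q != 0) (AQ : coprimep A Q) (FE : F = tofrac A / tofrac Q).
Hypothesis d2 : (2 < size A)%N.

Local Notation mu := (DK F).
Local Notation rho := (rho F).
Local Notation sig := (sig FZ).

Definition schwarzian : K := DK rho - rho ^+ 2 / 2%:R.

Lemma lead_nat (n : nat) : lead (n%:R : laurent C) 0 n%:R.
Proof. by have := lead_lC (n%:R : C); rewrite rmorph_nat. Qed.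

Let two0 : (2%:R : C) != 0. Proof. by rewrite pnatr_eq0. Qed.

Lemma schwarzian_of_rho y (c : C) : lead (Tloc y rho) (-1) c ->
  lead (Tloc y schwarzian) (- 2%:Z) (- c - c ^+ 2 / 2%:R).
Proof.
move=> l; rewrite rmorphB Tloc_deriv [Tloc y (rho ^+ 2 / _)]fmorph_div rmorphXn rmorph_nat.
have l1 := lead_deriv l; rewrite mulrN1z in l1.
have l2 := lead_div (leadX 2 l) (lead_nat 2) two0.
by apply: leadB => //; rewrite subr0 in l2.
Qed.

Lemma schwarzian_over y x e v : lies_over F y x e v ->
  lead (Tloc y schwarzian) (- 2%:Z) ((1 - e%:R ^+ 2) / 2%:R).
Proof.
move=> /rho_over/schwarzian_of_rho.
suff -> : - (e%:R - 1) - (e%:R - 1) ^+ 2 / 2%:R = (1 - e%:R ^+ 2) / 2%:R :> C by [].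
by field.
Qed.

Lemma schwarzian_pole y e v : pole_at F y e v ->
  lead (Tloc y schwarzian) (- 2%:Z) ((1 - e%:R ^+ 2) / 2%:R).
Proof.
move=> /rho_pole/schwarzian_of_rho.
suff -> : - (- e%:R - 1) - (- e%:R - 1) ^+ 2 / 2%:R = (1 - e%:R ^+ 2) / 2%:R :> C by [].
by field.
Qed.

Lemma schwarzian_inf : lead (Tinf C schwarzian) 2 ((1 - m%:R ^+ 2) / 2%:R).
Proof.
rewrite rmorphB Tinf_deriv [Tinf C (rho ^+ 2 / _)]fmorph_div rmorphXn rmorph_nat.
have l := rho_inf FZ; have l1 := lead_linfD l; rewrite mulr1z in l1.
have l2 := lead_div (leadX 2 l) (lead_nat 2) two0; rewrite subr0 in l2.
have := leadB l1 l2.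
suff -> : - (m%:R - 1) - (m%:R - 1) ^+ 2 / 2%:R = (1 - m%:R ^+ 2) / 2%:R :> C by [].
by field.
Qed.

(** Pullback of [q] only relates squares of angles. Since the principal root commutes with the
    nonnegative factor [e], it chooses signs consistently along all preimages. *)
Lemma sqrtC_scale (e : nat) (z : C) : sqrtC (e%:R ^+ 2 * z) = e%:R * sqrtC z.
Proof.
rewrite rootCMl ?exprn_ge0 ?ler0n//; congr (_ * _).
by rewrite sqrCK// ler0n.
Qed.

Section FromProjective.
Variable q : K.
Hypothesis qE : mu ^+ 2 * sig q = q + schwarzian.

Let NB : no_backward F := no_backward_deg FZ Q0 AQ FE d2.

Let sx x : vanish_below (- 2%:Z) (Tloc x schwarzian).
Proof.
by have [[z [e [v /schwarzian_over[]]]]|[e [v /schwarzian_pole[]]]] := place_cases FZ x.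
Qed.

Let qx x : lead (Tloc x q) (- 2%:Z) (Tloc x q (- 2%:Z)).
Proof. exact: lead_van (pole_order NB qE sx x). Qed.

Let qi : lead (Tinf C q) 2 (Tinf C q 2).
Proof.
by apply: lead_van; exact: (inf_order Q0 AQ FE d2 qE sx schwarzian_inf.1).
Qed.

(** The [theta] for which [q] has leading coefficient [(theta^2 - 1)/2], the opposite of that of the
    Schwarzian of [z^theta]. *)
Definition angle x : C := sqrtC (Tloc x q (- 2%:Z) * 2%:R + 1).
Definition angle_inf : C := sqrtC (Tinf C q 2 * 2%:R + 1).

Let scale_angle (e : nat) (z w : C) :
  e%:R ^+ 2 * z = w + (1 - e%:R ^+ 2) / 2%:R -> w * 2%:R + 1 = e%:R ^+ 2 * (z * 2%:R + 1).
Proof.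
move=> E; have -> : e%:R ^+ 2 * (z * 2%:R + 1) = (e%:R ^+ 2 * z) * 2%:R + e%:R ^+ 2 by ring.
by rewrite E; field.
Qed.

Lemma angle_over y x e v : lies_over F y x e v -> angle y = e%:R * angle x.
Proof.
move=> o; rewrite /angle -sqrtC_scale; congr sqrtC; apply: scale_angle.
have := pull_over FZ 2 o (qx x); rewrite qE rmorphD addNr mulr0 sub0r.
by move=> /lead_uniq/(_ (leadD (qx y) (schwarzian_over o))); rewrite expr0z mulr1.
Qed.

Lemma angle_pole y e v : pole_at F y e v -> angle y = e%:R * angle_inf.
Proof.
move=> o; rewrite /angle -sqrtC_scale; congr sqrtC; apply: scale_angle.
have := pull_pole FZ 2 o qi; rewrite qE rmorphD subrr mulr0 sub0r.
by move=> /lead_uniq/(_ (leadD (qx y) (schwarzian_pole o))); rewrite expr0z mulr1 sqrrN.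
Qed.

Lemma angle_infE : angle_inf = m%:R * angle_inf.
Proof.
rewrite {1}/angle_inf -sqrtC_scale; congr sqrtC; apply: scale_angle.
have := pull_inf FZ 2 qi; rewrite qE rmorphD subrr mulr0 add0r.
by move=> /lead_uniq/(_ (leadD qi schwarzian_inf)); rewrite expr0z mulr1.
Qed.

(* The residues 1 - angle define an invariant affine connection up to a multiple of
   Q'/Q, which comparison of both sides at infinity shows to vanish. *)
Lemma projective_connection : exists g, mu * sig g = g + rho.
Proof.
have [s0 s0P] := loc_finite q; pose s := undup s0.
pose r x := 1 - angle x; pose g := simple_part s r.
have us : uniq s := undup_uniq _.
have rs y : y \notin s -> r y = 0.
  rewrite mem_undup => /s0P h.
  by rewrite /r /angle h// mul0r add0r sqrtC1 subrr.
have gx x : lead (Tloc x g) (-1) (r x) := lead_loc_simple x us rs.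
pose R := \sum_(x <- s) r x.
have gi : lead (Tinf C g) 1 R := lead_inf_simple s r.
(* At a pole of [F] of order [e] the other terms of [delta] have total residue [k e], and [T] has
   residue [e]. *)
pose k := 1 + angle_inf - R.
pose T := DK (tofrac Q) / tofrac Q.
pose delta := mu * sig g - g - rho - kC k * T.
have gx' y x e v : lies_over F y x e v -> lead (Tloc y (mu * sig g)) (-1) (e%:R * r x).
  move=> o; have := pull_over FZ 1 o (gx x).
  by rewrite !expr1 addNr mulr0 sub0r expr0z mulr1.
have gp' y e v : pole_at F y e v -> lead (Tloc y (mu * sig g)) (-1) (- e%:R * R).
  move=> o; have := pull_pole FZ 1 o gi.
  by rewrite !expr1 subrr mulr0 sub0r expr0z mulr1.
have gi' : lead (Tinf C (mu * sig g)) 1 (m%:R * R).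
  by have := pull_inf FZ 1 gi; rewrite !expr1 subrr mulr0 add0r expr0z mulr1.
have Tx x (n : int) c : lead (Tloc x (tofrac Q)) n c -> c != 0 ->
    lead (Tloc x (kC k * T)) (-1) (k * n%:~R).
  move=> lQ c0; rewrite rmorphM /= TlocC -[-1]add0r.
  exact: leadM (lead_lC k) (lead_dlog_loc lQ c0).
have Ti : lead (Tinf C (kC k * T)) 1 (k * (size Q).-1%:R).
  have lQ : lead_coef Q != 0 by rewrite lead_coef_eq0.
  have := leadM (lead_lC k) (lead_dlog_inf (lead_inf_poly Q) lQ).
  by rewrite add0r rmorphN opprK [Tinf C (kC k * T)]rmorphM /= TinfC.
have di : lead (Tinf C delta) 1 (m%:R * R - R - (m%:R - 1) - k * (size Q).-1%:R).
  rewrite /delta !(rmorphB (Tinf C)); apply: leadB Ti; apply: leadB (rho_inf FZ).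
  exact: leadB gi' gi.
have d0 : delta = 0.
  apply: frac_eq0_van di.1 => y; rewrite /delta !(rmorphB (Tloc y)).
  have [[x [e [v o]]]|[e [v o]]] := place_cases FZ y.
    have [Qy _] := value_root Q0 AQ FE (over_value o).
    have lT := Tx _ _ _ (lead_loc_poly y Q) Qy; rewrite mulr0 in lT.
    have := leadB (leadB (leadB (gx' _ _ _ _ o) (gx y)) (rho_over o)) lT.
    suff -> : e%:R * r x - r y - (e%:R - 1) - 0 = 0 by move=> /lead0_van.
    by rewrite /r (angle_over o); ring.
  have Qy := root_pole FZ FE o; have [e0 v1 _] := o.
  have Ay : A.[y] != 0.
    apply/negP => Ay; have := coprimep_root AQ (_ : root A y).
    by rewrite rootE Ay Qy eqxx => /(_ isT).
  have lQ : lead (Tloc y (tofrac Q)) e%:Z (A.[y] / v^-1).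
    have := lead_div (lead_loc_poly y A) (lead_pole o) (invr_neq0 v1).
    rewrite sub0r opprK -fmorph_div FE.
    suff -> : tofrac A / (tofrac A / tofrac Q) = tofrac Q by [].
    rewrite invf_div mulrC divfK// tofrac_eq0; apply: contra_neq Ay => ->.
    by rewrite horner0.
  have Av : A.[y] / v^-1 != 0 by rewrite mulf_neq0 ?invr_neq0.
  have lT := Tx _ _ _ lQ Av.
  have := leadB (leadB (leadB (gp' _ _ _ o) (gx y)) (rho_pole o)) lT.
  suff -> : - e%:R * R - r y - (- e%:R - 1) - k * e%:~R = 0 by move=> /lead0_van.
  by rewrite /r (angle_pole o) /k; ring.
have k0 : k = 0.
  have [_] := di; rewrite d0 rmorph0 lcoef0 => /esym E.
  (* This is [d - 1], with [d] the degree of [F]; modulo [(m - 1) angle_inf = 0], the coefficient of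
     [delta] at infinity is [- k (d - 1)]. *)
  have sz : (size Q).-1%:R + m%:R - 1 != 0 :> C.
    have := size_numer FZ Q0 AQ FE; have [m0 _ _] := FZ => sA.
    rewrite -natrD -(natrB _ (_ : 1 <= _)%N) ?pnatr_eq0; move: d2; rewrite sA;
      move: (size Q) => *; lia.
  apply: (mulIf sz); rewrite mul0r.
  have E2 : (m%:R - 1) * angle_inf = 0 by rewrite mulrBl mul1r -angle_infE subrr.
  transitivity (- (m%:R * R - R - (m%:R - 1) - k * (size Q).-1%:R)
    + (m%:R - 1) * angle_inf); last by rewrite E E2 oppr0 addr0.
  by rewrite /k; ring.
exists g; move/eqP: d0; rewrite /delta k0 rmorph0 mul0r subr0 -addrA -opprD subr_eq0.
by move/eqP.
Qed.
End FromProjective.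
End Projective.

(** * Coboundaries *)

Lemma mulf_div_cancel (k : fieldType) (x y z : k) : y != 0 -> z != 0 ->
  x = x * y / z * (z / y).
Proof. by move=> y0 z0; rewrite mulrA divfK// mulfK. Qed.

Section Coboundary.
Variable C : numClosedFieldType.
Local Notation K := {fraction {poly C}}.
Local Notation DK := (@frac_deriv C).

Variables (F : K) (m : nat) (v0 : C).
Hypothesis FZ : zero_at0 (Tinf C F)^-1 m v0.

Local Notation mu := (DK F).
Local Notation rho := (rho F).
Local Notation sig := (sig FZ).

(** The class of [a] is torsion modulo constants and multiplicative coboundaries. *)
Definition root_coboundary (a : K) := exists2 N : nat, (0 < N)%N &
  exists (kap : C) (b : K), b != 0 /\ a ^+ N = kC kap * (sig b / b).

Lemma lead_loc_div (s : seq C) (n : C -> int) x : uniq s ->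
  (forall y, y \notin s -> n y = 0) -> exists2 c, c != 0 &
  lead (Tloc x (\prod_(y <- s) (kX C - kC y) ^ n y)) (n x) c.
Proof.
move=> us ns.
have [c c0] : exists2 c, c != 0 & lead (Tloc x (\prod_(y <- s) (kX C - kC y) ^ n y))
    (\sum_(y <- s) if y == x then n x else 0) c.
  elim: s {us ns} => [|y s [c c0 IH]].
    by exists 1; rewrite ?oner_neq0// !big_nil rmorph1; exact: lead1.
  have [d d0 ld] : exists2 d, d != 0 &
      lead (Tloc x ((kX C - kC y) ^ n y)) (if y == x then n x else 0) d.
    rewrite fmorphXz rmorphB TlocX !TlocC -addrA -rmorphB; case: eqP => [->|/eqP yx].
      rewrite subrr rmorph0 addr0; exists (1 ^ n x); first by rewrite exp1rz oner_neq0.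
      by have := leadXz (n x) (lead_lT C) (oner_neq0 _); rewrite mul1r.
    have xy0 : x - y != 0 by rewrite subr_eq0 eq_sym.
    exists ((x - y) ^ n y); first exact: expfz_neq0.
    by have := leadXz (n y) (lead_loc (x - y)) xy0; rewrite mul0r.
  exists (d * c); first exact: mulf_neq0.
  by rewrite !big_cons rmorphM; apply: leadM.
suff -> : \sum_(y <- s) (if y == x then n x else 0) = n x by exists c.
have [xs|xs] := boolP (x \in s).
  by rewrite (bigD1_seq x)//= eqxx big1 ?addr0// => y /negbTE ->.
by rewrite ns// big1_seq// => y /andP[_ ys]; case: eqP ys xs => // -> ->.
Qed.

Lemma lead_inf_div (s : seq C) (n : C -> int) :
  lead (Tinf C (\prod_(y <- s) (kX C - kC y) ^ n y)) (- \sum_(y <- s) n y) 1.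
Proof.
elim: s => [|y s IH]; first by rewrite !big_nil rmorph1; exact: lead1.
rewrite !big_cons rmorphM opprD -[X in lead _ _ X]mulr1; apply: leadM IH.
have := leadXz (- n y) (Tinf_Xsub y) (oner_neq0 _).
by rewrite mul1r exp1rz -fmorphXz exprz_inv opprK.
Qed.

Lemma common_denominator (s : seq C) (E : C -> C) : (forall x, rational_number (E x)) ->
  exists2 N : nat, (0 < N)%N & forall x, x \in s -> exists n : int, E x * N%:R = n%:~R.
Proof.
move=> Er; elim: s => [|x s [N N0 IH]]; first by exists 1%N.
have [M M0 [n En]] := Er x; exists (M * N)%N; first by rewrite muln_gt0 M0.
move=> y; rewrite inE => /predU1P[->|/IH[k Ek]].
  by exists (n * N%:Z); rewrite natrM mulrA En rmorphM.
by exists (k * M%:Z); rewrite mulnC natrM mulrA Ek rmorphM.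
Qed.

(** Let [N] clear the denominators of [E] and let [b] have divisor [N E]. The equations for [E] say
    that [a^N] and [sig b / b] have the same order at every finite point, so their quotient is a
    polynomial without roots. *)
Lemma divisor_coboundary (a : K) (s : seq C) (E : C -> C) (n : C -> int) :
  (forall y, exists2 c, c != 0 & lead (Tloc y a) (n y) c) ->
  uniq s -> (forall x, x \notin s -> E x = 0) -> (forall x, rational_number (E x)) ->
  (forall y x e v, lies_over F y x e v -> e%:R * E x = E y + (n y)%:~R) ->
  (forall y e v, pole_at F y e v -> - e%:R * \sum_(x <- s) E x = E y + (n y)%:~R) ->
  root_coboundary a.
Proof.
move=> an us Es Er Eo Ep; have [N N0 NE] := common_denominator s Er.
have NE' x : exists k : int, E x * N%:R = k%:~R.
  have [/NE//|/Es ->] := boolP (x \in s); by exists 0; rewrite mul0r.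
have [k kP] := choice NE'; exists N => //.
pose b := \prod_(y <- s) (kX C - kC y) ^ k y.
have kI (i j : int) : i%:~R = j%:~R :> C -> i = j by move=> /eqP; rewrite eqr_int => /eqP.
have ks y : y \notin s -> k y = 0 by move=> ys; apply: kI; rewrite -kP Es// mul0r.
have bx x : exists2 c, c != 0 & lead (Tloc x b) (k x) c := lead_loc_div x us ks.
have bi : lead (Tinf C b) (- \sum_(y <- s) k y) 1 := lead_inf_div s k.
have b0 : b != 0 by have [c c0 /lead_neq0/(_ c0)] := bx 0; rewrite fmorph_eq0.
clearbody b; pose h := a ^+ N * b / sig b.
have hx y : exists2 c, c != 0 & lead (Tloc y h) 0 c.
  have [c c0 lc] := an y; have [d d0 ld] := bx y.
  have [w w0 lw] : exists2 w, w != 0 & lead (Tloc y (sig b)) (n y *+ N + k y) w.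
    have [[x [e [v o]]]|[e [v o]]] := place_cases FZ y; have [e0 v1 _] := o.
      have [c' c0' lc'] := bx x; have := pull_over FZ 0 o lc'; rewrite expr0 mul1r.
      have -> : e%:Z * (k x + 0%:Z) - 0%:Z = n y *+ N + k y.
        apply: kI; rewrite subr0 addr0 !(rmorphD, rmorphN, rmorphM, rmorphMn) /= -!kP.
        rewrite mulrA (_ : _ * E x = E y + (n y)%:~R); last exact: Eo o.
        by rewrite -mulr_natr; ring.
      move=> l; exists (e%:R ^+ 0 * c' * v ^ (k x + 0%:Z)) => //.
      by rewrite !mulf_neq0// ?expf_neq0 ?expfz_neq0// pnatr_eq0 -lt0n.
    have := pull_pole FZ 0 o bi; rewrite expr0 mul1r.
    have -> : e%:Z * (- (\sum_(y <- s) k y) - 0%:Z) - 0%:Z = n y *+ N + k y.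
      apply: kI; rewrite !subr0 !(rmorphD, rmorphN, rmorphM, rmorphMn, rmorph_sum) /= -kP.
      under eq_bigr do rewrite -kP.
      rewrite -mulr_suml.
      rewrite mulrN mulrA -!mulNr (_ : _ * \sum_(y <- s) E y = E y + (n y)%:~R); last exact: Ep o.
      by rewrite -mulr_natr; ring.
    move=> l; eexists; last exact: l.
    by rewrite !mulf_neq0// ?oner_neq0// ?expf_neq0 ?expfz_neq0// oppr_eq0 pnatr_eq0 -lt0n.
  exists (c ^+ N * d / w); first by rewrite !mulf_neq0 ?invr_neq0 ?expf_neq0.
  rewrite fmorph_div rmorphM rmorphXn.
  by have := lead_div (leadM (leadX N lc) ld) lw w0; rewrite subrr.
have [p hp] : exists p : {poly C}, h = tofrac p.
  by apply: frac_liouville => x; have [c _ []] := hx x.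
have /size_poly1P[c c0 pc] : size p == 1%N.
  rewrite -[_ == _]negbK; apply/negP => /closed_rootP[x]; rewrite rootE => /eqP px.
  have [c c0 l] := hx x; have := lead_loc_poly x p; rewrite -hp => /(lead_uniq l) E1.
  by move: c0; rewrite E1 px eqxx.
exists c, b; split=> //; have sb0 : sig b != 0 by rewrite fmorph_eq0.
have hE : a ^+ N = h * (sig b / b) := mulf_div_cancel (a ^+ N) b0 sb0.
by rewrite hE hp pc.
Qed.
End Coboundary.

(** * Solving the divisor equation by residues *)

Section LogDeriv.
Variable C : numClosedFieldType.
Local Notation K := {fraction {poly C}}.
Local Notation DK := (@frac_deriv C).

Lemma loc_order (a : K) : a != 0 ->
  exists n : C -> int, forall y, exists2 c, c != 0 & lead (Tloc y a) (n y) c.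
Proof.
move=> a0; suff /choice[n nP] : forall y, exists k : int,
    exists2 c, c != 0 & lead (Tloc y a) k c by exists n.
move=> y; have a1 : Tloc y a != 0 by rewrite fmorph_eq0.
by have [k [c [c0 l]]] := lead_ex a1; exists k, c.
Qed.

Lemma dlog_inf_van (a : K) : a != 0 -> vanish_below 1 (Tinf C (DK a / a)).
Proof.
move=> a0; have a1 : Tinf C a != 0 by rewrite fmorph_eq0.
by have [k [c [c0 l]]] := lead_ex a1; have [] := lead_dlog_inf l c0.
Qed.

Variables (F : K) (m : nat) (v0 : C).
Hypothesis FZ : zero_at0 (Tinf C F)^-1 m v0.

Local Notation mu := (DK F).
Local Notation rho := (rho F).
Local Notation sig := (sig FZ).

Section Degree2.
Variables (A Q : {poly C}).
Hypotheses (Q0 : Q != 0) (AQ : coprimep A Q) (FE : F = tofrac A / tofrac Q).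
Hypothesis d2 : (2 < size A)%N.

Let NB : no_backward F := no_backward_deg FZ Q0 AQ FE d2.

(** The residue of [D a / a] is the order of [a], so the residues of [g] solve the divisor equation;
    at the poles of [F] the expansion of [g] at infinity enters, and it begins with the sum of the
    residues. *)
Lemma log_coboundary (a g : K) : a != 0 -> mu * sig g = g + DK a / a -> root_coboundary FZ a.
Proof.
move=> a0 gE; have gE1 : mu ^+ 1 * sig g = g + DK a / a by rewrite expr1.
have [n nP] := loc_order a0.
have bx y : lead (Tloc y (DK a / a)) (-1) (n y)%:~R.
  by have [c c0 l] := nP y; apply: lead_dlog_loc l c0.
have gx x : lead (Tloc x g) (-1) (Tloc x g (-1)).
  by apply: lead_van; apply: (pole_order NB gE1) => y; case: (bx y).
have gi : vanish_below 1 (Tinf C g).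
  apply: (inf_order Q0 AQ FE d2 gE1) (dlog_inf_van a0) => x.
  by case: (bx x).
have [s0 s0P] := loc_finite g; pose s := undup s0.
have sP x : x \notin s -> vanish_below 0 (Tloc x g) by rewrite mem_undup => /s0P.
have us : uniq s := undup_uniq _.
pose E x := Tloc x g (-1).
have Es x : x \notin s -> E x = 0 by move=> /sP; apply.
have gS : Tinf C g 1 = \sum_(x <- s) E x.
  have := simple_partE us sP (fun x => (gx x).1) gi => {1}->.
  by have [] := lead_inf_simple s (fun x => Tloc x g (-1)).
have Eo y x e v : lies_over F y x e v -> e%:R * E x = E y + (n y)%:~R.
  move=> o; have := pull_over FZ 1 o (gx x); rewrite gE1 rmorphD addNr mulr0 sub0r.
  by move=> /lead_uniq/(_ (leadD (gx y) (bx y))); rewrite expr0z mulr1.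
have Ep y e v : pole_at F y e v -> - e%:R * \sum_(x <- s) E x = E y + (n y)%:~R.
  move=> o; have := pull_pole FZ 1 o (lead_van gi); rewrite gE1 rmorphD subrr mulr0 sub0r.
  by rewrite -gS; move=> /lead_uniq/(_ (leadD (gx y) (bx y))); rewrite expr0z mulr1.
have Er x : rational_number (E x).
  apply: (rational_weights FZ Q0 AQ FE d2 Es) => y z e v o; exists (n y).
  exact: Eo o.
exact: divisor_coboundary nP us Es Er Eo Ep.
Qed.

(* mu has degree d - 1, whereas each totally ramified point is a zero of mu of order d - 1. *)
Lemma totally_ramified_uniq y1 x1 v1 y2 x2 v2 : size Q = 1%N ->
  lies_over F y1 x1 (size A).-1 v1 -> lies_over F y2 x2 (size A).-1 v2 -> y1 = y2.
Proof.
move=> sQ o1 o2; apply/eqP/negPn/negP => y12.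
have dm : (size A).-1 = m by rewrite (size_numer FZ Q0 AQ FE) sQ addn1.
pose n y : int := if y \in [:: y1; y2] then - ((size A).-1%:Z - 1) else 0.
have us : uniq [:: y1; y2] by rewrite /= inE y12.
have ns y : y \notin [:: y1; y2] -> n y = 0 by rewrite /n => /negbTE ->.
have bx y := lead_loc_div y us ns.
have bi := lead_inf_div [:: y1; y2] n.
set b := \prod_(y <- _) _ in bx bi.
have b0 : b != 0 by have [c c0 /lead_neq0/(_ c0)] := bx 0; rewrite fmorph_eq0.
suff : mu * b = 0 by move/eqP; rewrite mulf_eq0 (negbTE b0) (negbTE (mu_neq0 FZ)).
clearbody b; have d0 : (0 < (size A).-1)%N by move: d2; lia.
apply: frac_eq0_van => [y|].
  rewrite rmorphM; have [c c0 lb] := bx y.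
  have lm : lead (Tloc y mu) (- n y) (Tloc y mu (- n y)).
    have [[x [e [v o]]]|[e [v /(root_pole FZ FE) Qy]]] := place_cases FZ y; last first.
      by have /size_poly1P[k k0 Qk] := introT eqP sQ; move: Qy k0; rewrite Qk hornerC => ->; rewrite eqxx.
    have l := lead_mu_over o; apply: lead_van; apply: vanish_belowW l.1.
    rewrite /n !inE; case: eqP => [yy|_] /=.
      by rewrite opprK; rewrite yy in o; have [_ ->] := over_uniq o o1.
    case: eqP => [yy|_]; last by rewrite oppr0; have [] := o; lia.
    by rewrite opprK; rewrite yy in o; have [_ ->] := over_uniq o o2.
  by have := leadM lm lb; rewrite addNr => -[].
(* The order at infinity is [(1 - d) + 2 (d - 1) = d - 1 > 0]. *)
rewrite rmorphM; have := leadM (lead_mu_inf FZ) bi => -[h _]; apply: vanish_belowW h.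
rewrite !big_cons big_nil addr0 /n !inE eqxx eqxx orbT /=.
rewrite -dm; move: d2; move: (size A) => k; lia.
Qed.
End Degree2.

(** For [b = D a / a], the amount by which [sigma] translates the [j]-th jet when [c] is an
    invariant connection and [w = 0]. *)
Fixpoint dlog_iter (c b : K) (j : nat) : K :=
  if j is i.+1 then DK (dlog_iter c b i) + i.+1%:R * c * dlog_iter c b i else b.

Section Affine.
Variables (c : K) (nu : C -> C) (a : K) (n : C -> int).
Hypothesis cnu : forall x, lead (Tloc x c) (-1) (1 - nu x).
Hypothesis an : forall y, exists2 k, k != 0 & lead (Tloc y a) (n y) k.

Let w j : C := (-1) ^+ j * j`!%:R.

(** On a pole of order [j + 1] the operator [D + (j+1) c] multiplies the leading coefficient by
    [- (j+1) + (j+1)(1 - nu) = - (j+1) nu]. *)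
Lemma lead_dlog_iter x j :
  lead (Tloc x (dlog_iter c (DK a / a) j)) (- j.+1%:Z) ((n x)%:~R * w j * nu x ^+ j).
Proof.
elim: j => [|j IHj].
  have [k k0 l] := an x; rewrite /w !expr0 fact0 !mulr1.
  exact: lead_dlog_loc l k0.
rewrite [dlog_iter _ _ _]/= rmorphD !rmorphM rmorph_nat Tloc_deriv.
have l1 := lead_deriv IHj; have l2 := leadM (leadM (lead_nat C j.+1) (cnu x)) IHj.
rewrite (_ : - j.+1%:Z - 1 = - j.+2%:Z) in l1; last by lia.
rewrite (_ : 0 + -1 + - j.+1%:Z = - j.+2%:Z) in l2; last by lia.
rewrite (_ : (n x)%:~R * w j.+1 * nu x ^+ j.+1 = (n x)%:~R * w j * nu x ^+ j *~ - j.+1%:Z +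
  j.+1%:R * (1 - nu x) * ((n x)%:~R * w j * nu x ^+ j)); first exact: leadD.
set X := _ * nu x ^+ j; rewrite (_ : X *~ _ = - (X * j.+1%:R)); last by rewrite mulrNz mulr_natr.
by rewrite /X /w factS natrM !exprS; ring.
Qed.

Variable d : nat.
Hypotheses (NB : no_backward F) (nopole : forall y e v, ~ pole_at F y e v).
Hypothesis RW : forall (s : seq C) (E : C -> C), (forall x, x \notin s -> E x = 0) ->
  (forall y x e v, lies_over F y x e v -> exists n : int, e%:R * E x = E y + n%:~R) ->
  forall x, rational_number (E x).
Hypothesis nuo : forall y x e v, lies_over F y x e v -> nu y = e%:R * nu x.
Hypothesis nu0 : forall y x e v, lies_over F y x e v -> nu x = 0 ->
  [/\ y = x, e = d & (1 < d)%N].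

(* The coefficients of order -(j+1) of q, divided by those which 1/(z - x) contributes
   to the j-th iterate, form a divisor whose coboundary is the divisor of a. *)
Lemma affine_coboundary j (q eta : K) :
  mu ^+ j.+1 * sig q = q + (dlog_iter c (DK a / a) j + eta) ->
  (forall x, vanish_below (- j%:Z) (Tloc x eta)) -> root_coboundary FZ a.
Proof.
move=> qE etax.
have lx x : lead (Tloc x (dlog_iter c (DK a / a) j + eta)) (- j.+1%:Z)
    ((n x)%:~R * w j * nu x ^+ j).
  rewrite rmorphD -[X in lead _ _ X]addr0; apply: leadD (lead_dlog_iter x j) _.
  by apply: leadW (etax x) _; lia.
have qx x : lead (Tloc x q) (- j.+1%:Z) (Tloc x q (- j.+1%:Z)).
  by apply: lead_van; apply: (pole_order NB qE) => y; case: (lx y).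
have qo y x e v : lies_over F y x e v ->
    e%:R ^+ j.+1 * Tloc x q (- j.+1%:Z) = Tloc y q (- j.+1%:Z) + (n y)%:~R * w j * nu y ^+ j.
  move=> o; have := pull_over FZ j.+1 o (qx x).
  rewrite qE rmorphD addNr mulr0 sub0r.
  by move=> /lead_uniq/(_ (leadD (qx y) (lx y))); rewrite expr0z mulr1.
have w0 : w j != 0 by rewrite mulf_neq0// ?signr_eq0// pnatr_eq0 -lt0n fact_gt0.
(* Where [nu] vanishes the coefficient of [q] no longer sees the order of [a]; but such a point is
   its own only preimage, with local degree [d], and [d E = E + n] is solved outright. *)
pose E x := if nu x == 0 then (n x)%:~R / (d%:R - 1) else
  Tloc x q (- j.+1%:Z) / (w j * nu x ^+ j).
have [sq sqP] := loc_finite q; have [sc scP] := loc_finite c.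
pose s := undup (sq ++ sc).
have Es x : x \notin s -> E x = 0.
  rewrite mem_undup mem_cat negb_or => /andP[/sqP xq /scP xc].
  have nu1 : nu x = 1.
    have [_ h] := cnu x; have : Tloc x c (-1) = 0 by apply: xc.
    by rewrite h => /eqP; rewrite subr_eq0 => /eqP.
  by rewrite /E nu1 oner_eq0 (_ : Tloc x q _ = 0) ?mul0r//; apply: xq.
have Eo y x e v : lies_over F y x e v -> e%:R * E x = E y + (n y)%:~R.
  move=> o; have [e0 v1 _] := o; rewrite /E (nuo o) mulf_eq0 pnatr_eq0 eqn0Ngt e0 /=.
  case: eqP => [nux|/eqP nux].
    have [-> -> d1] := nu0 o nux.
    have d10 : d%:R - 1 != 0 :> C by rewrite subr_eq0 pnatr_eq1; move: d1; lia.
    by field.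
  have e1 : e%:R != 0 :> C by rewrite pnatr_eq0 -lt0n.
  have := qo _ _ _ _ o; rewrite (nuo o) exprS exprMn.
  move: (e%:R ^+ j) (expf_neq0 j e1) (nu x ^+ j) (expf_neq0 j nux) => ej ej0 nj nj0 E1.
  have -> : Tloc y q (- j.+1%:Z) =
    e%:R * ej * Tloc x q (- j.+1%:Z) - (n y)%:~R * w j * (ej * nj) by rewrite E1; ring.
  by field; rewrite nj0 w0 ej0.
have Er x : rational_number (E x).
  by apply: (RW Es) => y z e v o; exists (n y); apply: Eo o.
have us : uniq s := undup_uniq _.
have H := @divisor_coboundary _ F m v0 FZ a s E n an us Es Er Eo.
apply: H => y e v o.
by case: (nopole o).
Qed.
End Affine.
End LogDeriv.

(** * Derivations and substitutions of polynomials *)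

(** Multiplicativity of a second-order Taylor expansion: [dx * dy] comes once from the product of
    linear terms and twice, with factor [c = 1/2], from the second derivative of the product. *)
Lemma taylor_ring (S : comNzRingType) (c x dx ddx tx y dy ddy ty s s' : S) : c * 2%:R = 1 ->
  (s + (x + dx + c * ddx + tx)) * (s' + (y + dy + c * ddy + ty)) -
    (x * y + (dx * y + x * dy) + c * (ddx * y + dx * dy + (dx * dy + x * ddy))
      + (tx * y + x * ty)) =
  s * (y + dy + c * ddy + ty) + (x + dx + c * ddx + tx) * s' + s * s'
  + (dx * (c * ddy + ty) + (c * ddx + tx) * dy + (c * ddx + tx) * (c * ddy + ty)).
Proof.
move=> c2; rewrite -[LHS]subr0 -[X in _ - X](mul0r (dx * dy)) -(subrr (c * 2%:R)) {1}c2.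
ring.
Qed.

Section Derivations.
Variables (n : nat) (K : fieldType).
Local Notation R := {mpoly K[n]}.
Implicit Types (P Q : R) (v : 'I_n -> R) (m : 'X_{1..n}).

Lemma mmap_ext (S : comNzRingType) (psi1 psi2 : {rmorphism R -> S}) :
  (forall c, psi1 c%:MP = psi2 c%:MP) -> (forall i, psi1 'X_i = psi2 'X_i) -> psi1 =1 psi2.
Proof.
move=> eC eX P; rewrite [P]mpolyE !rmorph_sum; apply: eq_bigr => m _.
rewrite -mul_mpolyC !rmorphM /= eC mpolyXE_id !rmorph_prod; congr (_ * _).
by apply: eq_bigr => i _; rewrite !rmorphXn /= eX.
Qed.

Definition mder v P := \sum_i v i * P^`M(i).

Lemma mderD v : {morph mder v : P Q / P + Q}.
Proof.
by move=> P Q; rewrite /mder -big_split; apply: eq_bigr => i _; rewrite mderivD mulrDr.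
Qed.

Lemma mderZ v c P : mder v (c *: P) = c *: mder v P.
Proof. by rewrite /mder scaler_sumr; apply: eq_bigr => i _; rewrite mderivZ scalerAr. Qed.

Lemma mder0 v : mder v 0 = 0.
Proof. by rewrite /mder big1// => i _; rewrite mderiv0 mulr0. Qed.

Lemma mderC v c : mder v c%:MP = 0.
Proof. by rewrite /mder big1// => i _; rewrite mderivC mulr0. Qed.

Lemma mder_sum v I (r : seq I) (p : pred I) (E : I -> R) :
  mder v (\sum_(i <- r | p i) E i) = \sum_(i <- r | p i) mder v (E i).
Proof. exact: (big_morph (mder v) (@mderD v) (mder0 v)). Qed.

Lemma mderE v P : mder v P = \sum_(m <- msupp P) P@_m *: mder v 'X_[m].
Proof. by rewrite {1}[P]mpolyE mder_sum; apply: eq_bigr => m _; rewrite mderZ. Qed.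

Lemma mderM v P Q : mder v (P * Q) = mder v P * Q + P * mder v Q.
Proof.
rewrite /mder mulr_suml mulr_sumr -big_split; apply: eq_bigr => i _.
by rewrite mderivM /=; ring.
Qed.

Lemma mderX v i : mder v 'X_i = v i.
Proof.
rewrite /mder (bigD1 i)//= big1 => [|j ji].
  rewrite mderivX mnm1E eqxx scale1r (_ : (U_(i) - U_(i))%MM = 0%MM) ?mpolyX0 ?mulr1 ?addr0//.
  by apply/mnmP => k; rewrite mnmBE mnm0E subnn.
by rewrite mderivX mnm1E eq_sym (negbTE ji) scale0r mulr0.
Qed.

Lemma mder_comm v w P :
  mder v (mder w P) - mder w (mder v P) = mder (fun i => mder v (w i) - mder w (v i)) P.
Proof.
rewrite {2}/mder {4}/mder [mder v _]mder_sum [mder w _]mder_sum.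
under eq_bigr do rewrite mderM.
under [X in _ - X]eq_bigr do rewrite mderM.
rewrite !big_split /= opprD addrACA -[X in X + _]sumrB.
rewrite [X in _ + X](_ : _ = 0) ?addr0; first by apply: eq_bigr => i _; rewrite mulrBl.
apply/eqP; rewrite subr_eq0; apply/eqP.
under eq_bigr do rewrite /mder mulr_sumr.
under [RHS]eq_bigr do rewrite /mder mulr_sumr.
rewrite exchange_big; apply: eq_bigr => i _; apply: eq_bigr => j _.
by rewrite mderiv_comm; ring.
Qed.

Lemma mder_ext v w P : v =1 w -> mder v P = mder w P.
Proof. by move=> vw; apply: eq_bigr => i _; rewrite vw. Qed.

(** Stated without truncated subtraction, so that [k > d] forces [P = 0]. *)
Definition lowered (mf : measure n) k P d := forall m, m \in msupp P -> (mf m + k <= d)%N.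

Section Drop.
Variable mf : measure n.
Local Notation drop := (lowered mf).

Lemma dropD k P Q d : drop k P d -> drop k Q d -> drop k (P + Q) d.
Proof. by move=> Pd Qd m /msuppD_le; rewrite mem_cat => /orP[/Pd|/Qd]. Qed.

Lemma dropN k P d : drop k P d -> drop k (- P) d.
Proof. by move=> Pd m; rewrite (perm_mem (msuppN P)) => /Pd. Qed.

Lemma dropB k P Q d : drop k P d -> drop k Q d -> drop k (P - Q) d.
Proof. by move=> Pd Qd; apply: dropD => //; apply: dropN. Qed.

Lemma dropZ k c P d : drop k P d -> drop k (c *: P) d.
Proof. by move=> Pd m /msuppZ_le/Pd. Qed.

Lemma drop0 k d : drop k 0 d.
Proof. by move=> m; rewrite msupp0. Qed.

Lemma drop_sum I (r : seq I) (p : pred I) (E : I -> R) k d :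
  (forall i, p i -> drop k (E i) d) -> drop k (\sum_(i <- r | p i) E i) d.
Proof.
by move=> Ed; elim/big_ind: _ => //; [exact: drop0 | move=> *; exact: dropD].
Qed.

Lemma dropM k l P Q d e : drop k P d -> drop l Q e -> drop (k + l) (P * Q) (d + e).
Proof.
move=> Pd Qe m /msuppM_le/allpairsP[[m1 m2] /= [/Pd h1 /Qe h2 ->]].
by rewrite mfD addnACA leq_add.
Qed.

Lemma dropW k l P d : (l <= k)%N -> drop k P d -> drop l P d.
Proof. by move=> lk Pd m /Pd; apply: leq_trans; rewrite leq_add2l. Qed.

Lemma dropX m : drop 0 'X_[m] (mf m).
Proof. by move=> m'; rewrite msuppX inE => /eqP ->; rewrite addn0. Qed.

Lemma drop_coef k P d m : drop k P d -> (d < mf m + k)%N -> P@_m = 0.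
Proof. by move=> Pd dm; apply/memN_msupp_eq0/negP => /Pd; rewrite leqNgt dm. Qed.

(* Second-order Taylor expansion of a substitution along the filtration by mf. *)
Section Taylor.
Variables (h l t : 'I_n -> R).
Hypothesis half : (2%:R : K) != 0.
Hypothesis ld : forall i, drop 1 (l i) (mf U_(i)%MM).
Hypothesis lld : forall i, drop 2 (mder l (l i)) (mf U_(i)%MM).
Hypothesis td : forall i, drop 2 (t i) (mf U_(i)%MM).
Hypothesis hd : forall i,
  drop 3 (h i - ('X_i + l i + 2%:R^-1 *: mder l (l i) + t i)) (mf U_(i)%MM).

(** The exponential of the derivation [l + t] up to order two, where [l] has order one and [t] order
    two. *)
Definition taylor2 P := P + mder l P + 2%:R^-1 *: mder l (mder l P) + mder t P.

Let ok P d := [/\ drop 0 P d, drop 1 (mder l P) d, drop 2 (mder l (mder l P)) d,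
  drop 2 (mder t P) d & drop 3 (mmap (@mpolyC n K) h P - taylor2 P) d].

(** The truncated exponential is multiplicative up to order three, so the estimate passes from
    variables to their products; [ok] collects the bounds which this induction carries along. *)
Lemma taylor_mon m : drop 3 (mmap (@mpolyC n K) h 'X_[m] - taylor2 'X_[m]) (mf m).
Proof.
suff : ok 'X_[m] (mf m) by case.
have okM P Q d e : ok P d -> ok Q e -> ok (P * Q) (d + e).
  move=> [p0 p1 p2 pt p3] [q0 q1 q2 qt q3]; split.
  - exact: (dropM p0 q0).
  - by rewrite mderM; apply: dropD; [exact: (dropM p1 q0) | exact: (dropM p0 q1)].
  - rewrite mderM mderD !mderM; apply: dropD; apply: dropD.
    + exact: (dropM p2 q0).
    + exact: (dropM p1 q1).
    + exact: (dropM p1 q1).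
    + exact: (dropM p0 q2).
  - by rewrite mderM; apply: dropD; [exact: (dropM pt q0) | exact: (dropM p0 qt)].
  have d2 P' d' : drop 2 (mder l (mder l P')) d' -> drop 2 (mder t P') d' ->
      drop 2 (2%:R^-1 *: mder l (mder l P') + mder t P') d'.
    by move=> *; apply: dropD => //; apply: dropZ.
  set s := _ - _ in p3; set s' := _ - _ in q3.
  set P2 := 2%:R^-1 *: mder l (mder l P) + mder t P.
  set Q2 := 2%:R^-1 *: mder l (mder l Q) + mder t Q.
  have P2d : drop 2 P2 d by exact: d2.
  have Q2d : drop 2 Q2 e by exact: d2.
  have -> : mmap (@mpolyC n K) h (P * Q) - taylor2 (P * Q) =
      s * taylor2 Q + taylor2 P * s' + s * s'
      + (mder l P * Q2 + P2 * mder l Q + P2 * Q2).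
    rewrite rmorphM /= /taylor2 !(mderM, mderD).
    have -> : mmap (@mpolyC n K) h P = s + taylor2 P by rewrite /s subrK.
    have -> : mmap (@mpolyC n K) h Q = s' + taylor2 Q by rewrite /s' subrK.
    rewrite /taylor2 /P2 /Q2 -!mul_mpolyC.
    have E : 2%:R^-1%:MP * 2%:R = 1 :> R.
      by rewrite -(mpolyC_nat n K 2) -mpolyCM mulVf.
    exact: taylor_ring.
  have T0 P' d' : drop 0 P' d' -> drop 1 (mder l P') d' -> drop 2 (mder l (mder l P')) d' ->
      drop 2 (mder t P') d' -> drop 0 (taylor2 P') d'.
    move=> r0 r1 r2 r3; apply: dropD; last exact: dropW r3.
    by apply: dropD; [apply: dropD => //; exact: dropW r1 | apply: dropZ; exact: dropW r2].
  have tP := T0 _ _ p0 p1 p2 pt; have tQ := T0 _ _ q0 q1 q2 qt.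
  apply: dropD; last first.
    apply: dropD; last by apply: dropW (dropM P2d Q2d).
    by apply: dropD; [exact: (dropM p1 Q2d) | exact: (dropM P2d q1)].
  apply: dropD; last by apply: dropW (dropM p3 q3).
  by apply: dropD; [exact: (dropM p3 tQ) | exact: (dropM tP q3)].
have ok1 : ok 1 0.
  split; rewrite -?mpolyC1 ?mderC ?mder0; do ?exact: drop0.
    by move=> m'; rewrite msuppC oner_eq0 inE => /eqP ->; rewrite mf0.
  by rewrite /taylor2 !mderC ?mder0 scaler0 !addr0 mmapC subrr; exact: drop0.
have okX i : ok 'X_i (mf U_(i)%MM).
  split; rewrite ?mderX//; first exact: dropX.
  by rewrite /taylor2 !mderX mmapX mmap1U; exact: hd.
rewrite mpolyXE_id mfE; elim/big_rec2: _ => // i d P _ okP.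
apply: (okM _ _ _ _ _ okP); elim: (m i) => [|k IHk]; first by rewrite mul0n expr0.
by rewrite exprS mulSn; apply: okM.
Qed.
End Taylor.
End Drop.
End Derivations.

(** * Witt vector fields and their common kernels *)

Section Witt.
Variables (n : nat) (K : fieldType).
Local Notation R := {mpoly K[n]}.
Hypothesis K0 : forall k, k.+1%:R != 0 :> K.

Definition jet (k : nat) : R := if insub k is Some i then 'X_i else 0.

Lemma jetE (i : 'I_n) : jet i = 'X_i.
Proof. by rewrite /jet valK. Qed.

Lemma mder_jet (v : nat -> R) k : (k < n)%N -> mder (fun i : 'I_n => v i) (jet k) = v k.
Proof. by move=> kn; rewrite -[k]/(val (Ordinal kn)) jetE mderX. Qed.

(* The action on jets of 1-forms (lam = 0) or of affine connections of the vector
   field - z^(j+1) d/dz: a jet of index k is lowered by j, and the jet of index j - 1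
   becomes a constant. *)
Definition witt (lam : K) (j k : nat) : R :=
  if (j <= k)%N then (k.+1 ^_ j.+1)%:R *: jet (k - j)
  else if k.+1 == j then - ((j.+1)`!%:R * lam)%:MP else 0.

Local Notation wder lam j := (mder (fun i : 'I_n => witt lam j i)).

Lemma witt_ge lam j k : (j <= k)%N -> witt lam j k = (k.+1 ^_ j.+1)%:R *: jet (k - j).
Proof. by rewrite /witt => ->. Qed.

Lemma witt_pred lam k : witt lam k.+1 k = (- ((k.+2)`!%:R * lam))%:MP.
Proof. by rewrite /witt ltnn eqxx mpolyCN. Qed.

Lemma witt_lt lam j k : (k.+1 < j)%N -> witt lam j k = 0.
Proof. by move=> kj; rewrite /witt leqNgt (ltnW kj) /= ltn_eqF. Qed.

Lemma witt_comm lam j k : (0 < j)%N -> (k < n)%N ->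
  wder lam 1 (witt lam j k) - wder lam j (witt lam 1 k) = - (j.-1%:R *: witt lam j.+1 k).
Proof.
move=> j0 kn; have [kj|jk|kj] := ltngtP k j.
- rewrite (@witt_lt lam j.+1)// scaler0 oppr0.
  have -> : wder lam 1 (witt lam j k) = 0.
    have [kj'|kj'|kj'] := ltngtP k.+1 j; first by rewrite witt_lt// mder0.
      by move: kj kj'; lia.
    by rewrite -kj' witt_pred mderC.
  rewrite sub0r; case: k kj kn => [|k] kj kn; first by rewrite witt_pred mderC oppr0.
  by rewrite (@witt_ge lam 1)// mderZ subn1 mder_jet ?(ltnW kn)// witt_lt// scaler0 oppr0.
- have k0 : (0 < k)%N by apply: leq_trans jk.
  have kjn : (k - j < n)%N by apply: leq_ltn_trans (leq_subr _ _) kn.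
  have k1n : (k - 1 < n)%N by apply: leq_ltn_trans (leq_subr _ _) kn.
  have kj0 : (0 < k - j)%N by rewrite subn_gt0.
  have jk1 : (j <= k - 1)%N by rewrite subn1 -ltnS prednK.
  rewrite !witt_ge ?(ltnW jk)// !mderZ !mder_jet// !witt_ge//.
  rewrite -subnDA -[(k - 1 - j)%N]subnDA addn1 add1n !scalerA -scalerBl -scaleNr.
  congr (_ *: _); rewrite (_ : (k - 1).+1 = k); last by rewrite subn1 prednK.
  have E1 : (k.+1 ^_ j.+2 = k.+1 ^_ j.+1 * (k - j))%N by rewrite ffactnSr subSS.
  have E2 : (k.+1 ^_ j.+1 = k.+1 * (k ^_ j))%N by rewrite ffactSS.
  have E3 : (k ^_ j.+1 = k ^_ j * (k - j))%N by rewrite ffactnSr.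
  have E4 : (k.+1 ^_ 2 = k.+1 * k)%N by rewrite ffactSS ffactn1.
  have E5 : ((k - j).+1 ^_ 2 = (k - j).+1 * (k - j))%N by rewrite ffactSS ffactn1.
  rewrite E4 E5 E1 E3 E2 !natrM -[(k - j).+1%:R]natr1 natrB ?(ltnW jk)//.
  have -> : j.-1%:R = j%:R - 1 :> K by rewrite -subn1 natrB.
  by rewrite -[k.+1%:R]natr1; ring.
case: k kj j0 kn => [|k] kj j0 kn; first by rewrite -kj in j0.
rewrite -kj; have kn' := ltnW kn.
rewrite witt_pred !witt_ge// !mderZ subnn subn1 !mder_jet//; last exact: leq_ltn_trans kn.
rewrite !witt_pred -!mul_mpolyC -!mpolyCM -mpolyCB -mpolyCN; congr (_%:MP).
have E4 : (k.+2 ^_ 2 = k.+2 * k.+1)%N by rewrite ffactSS ffactn1.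
rewrite E4 ffactnn (factS k.+2) !natrM succnK.
by rewrite -[k.+3%:R]natr1 -[k.+2%:R]natr1 -[k.+1%:R]natr1; ring.
Qed.

Lemma mder_delta (i : 'I_n) (P : R) : mder (fun k => (k == i)%:R) P = P^`M(i).
Proof.
by rewrite /mder (bigD1 i)//= eqxx mul1r big1 ?addr0// => j /negbTE ->; rewrite mul0r.
Qed.

(** Brackets with the field of index 1 produce all higher fields from the one of index 2. The field
    of index [i + 1] kills the variables below [i] and sends the [i]-th to a nonzero constant, so
    the partial derivatives vanish one after another, from the last variable downwards. *)
Lemma witt_kernel lam (P : R) : lam != 0 -> wder lam 1 P = 0 -> wder lam 2 P = 0 ->
  forall i, P^`M(i) = 0.
Proof.
move=> lam0 P1 P2.
have Pj j : (1 < j)%N -> wder lam j P = 0.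
  elim: j => // j IHj; rewrite ltnS leq_eqVlt => /predU1P[<-//|j1].
  have j0 := ltnW j1; have := mder_comm (fun i : 'I_n => witt lam 1 i) (fun i => witt lam j i) P.
  rewrite P1 (IHj j1) !mder0 subrr.
  rewrite (mder_ext _ (fun i => witt_comm lam j0 (ltn_ord i))) /mder.
  under eq_bigr do rewrite -scaleNr -scalerAl.
  rewrite -scaler_sumr => /esym/eqP; rewrite scaler_eq0 oppr_eq0 => /orP[|/eqP//].
  by case: j j1 {IHj j0} => [|[|j]]//= _; rewrite (negbTE (K0 j)).
have {}Pj j : (0 < j)%N -> wder lam j P = 0 by case: j => [|[|j]]// _; apply: Pj.
have H (d : nat) (i : 'I_n) : (n - i <= d)%N -> P^`M(i) = 0.
  elim: d i => [|d IHd] i; first by have := ltn_ord i; lia.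
  move=> nid; have := Pj i.+1 isT; rewrite /mder (bigD1 i)//= big1 => [|k ki].
    rewrite addr0 witt_pred => /eqP; rewrite mulf_eq0 mpolyC_eq0 oppr_eq0 mulf_eq0.
    rewrite (negbTE lam0) orbF => /orP[|/eqP//].
    by have := fact_gt0 i.+2; case: (_`!) => // f _; rewrite (negbTE (K0 f)).
  have [ik|ki'|/val_inj ik] := ltngtP i k.
  - by rewrite (IHd k) ?mulr0//; move: nid ik; lia.
  - by rewrite witt_lt ?mul0r.
  - by rewrite ik eqxx in ki.
by move=> i; apply: (H (n - i)%N).
Qed.

(** The bracket of the [k]-th partial derivative with the field of index 1 is [(k+2)(k+1)] times the
    next partial derivative. *)
Lemma affine_kernel (P : R) : wder 0 1 P = 0 -> (forall i : 'I_n, val i = 0%N -> P^`M(i) = 0) ->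
  forall i, P^`M(i) = 0.
Proof.
move=> P1 P0; suff H k (kn : (k < n)%N) : P^`M(Ordinal kn) = 0.
  by case=> k kn; apply: H.
elim: k kn => [|k IHk] kn; first exact: P0.
have kn' := ltnW kn; pose j := Ordinal kn'.
have := mder_comm (fun i => (i == j)%:R) (fun i : 'I_n => witt 0 1 i) P.
rewrite P1 !mder_delta mderiv0 IHk mder0 subrr.
rewrite (@mder_ext _ _ _ (fun i => (i == Ordinal kn)%:R * (k.+2 * k.+1)%:R)) => [|i].
  rewrite /mder (bigD1 (Ordinal kn))//= eqxx mul1r big1 ?addr0 => [|i /negbTE ->]; last first.
    by rewrite !mul0r.
  move=> /esym/eqP; rewrite mulf_eq0 natrM mulf_eq0 -!mpolyC_nat !mpolyC_eq0.
  by rewrite !(negbTE (K0 _)) /= => /eqP.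
rewrite mder_delta; have -> : mder (fun i0 : 'I_n => witt 0 1 i0) (i == j)%:R = 0.
  by rewrite -mpolyC_nat mderC.
rewrite subr0; case: i => [[|i] iN].
  by rewrite witt_pred mulr0 oppr0 mderivC mul0r.
rewrite witt_ge// subn1 /= mderivZ -[ i ]/(val (Ordinal (ltnW iN))) jetE mderivX mnm1E.
have -> : (Ordinal iN == Ordinal kn) = (i == k) by rewrite -(inj_eq val_inj) /= eqSS.
have -> : (Ordinal (ltnW iN) == j) = (i == k) by rewrite -(inj_eq val_inj).
have [ik|ik] := eqVneq i k; last by rewrite scale0r scaler0 mul0r.
rewrite scale1r mul1r (_ : (U_(Ordinal (ltnW iN)) - U_(j))%MM = 0%MM); last first.
  by apply/mnmP => l; rewrite mnmBE mnm0E !mnm1E /j -!(inj_eq val_inj) /= ik subnn.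
by rewrite mpolyX0 /= scaler_nat ffactSS ffactn1 ik.
Qed.
End Witt.

(** * Jets *)

Section MTop.
Variables (n : nat) (K : fieldType) (mf : measure n).
Local Notation R := {mpoly K[n]}.

Definition mtop W (P : R) := \sum_(m <- msupp P | mf m == W) P@_m *: 'X_[m].

Lemma mcoeff_mtop W P m : (mtop W P)@_m = if mf m == W then P@_m else 0.
Proof.
rewrite /mtop raddf_sum /=; have [mP|mP] := boolP (m \in msupp P); last first.
  rewrite big1_seq => [|m' /andP[_ m'P]].
    by rewrite memN_msupp_eq0// if_same.
  rewrite mcoeffZ mcoeffX; case: eqP => [mm|_]; last by rewrite mulr0.
  by rewrite -mm m'P in mP.
rewrite big_mkcond (bigD1_seq m)//= ?msupp_uniq// big1 ?addr0 => [|m' m'm].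
  by case: ifP; rewrite // mcoeffZ mcoeffX eqxx mulr1.
by rewrite mcoeffZ mcoeffX (negbTE m'm) mulr0 if_same.
Qed.
End MTop.

Section JetCoef.
Variables (K : fieldType) (sK : {rmorphism K -> K}) (dK : K -> K) (mu a w c : K).

Definition jrho := dK mu / mu.
(** The defect of invariance of the connection [c]. *)
Definition jtheta := mu * sK c - c - jrho.

(** Coefficients in [mu^(k+1) sigma(u_k) = sum_j jc k j * u_j + jb k]; the recursion results from
    differentiating this identity. *)
Fixpoint jc (k j : nat) : K :=
  if k is k'.+1 then
    dK (jc k' j) + (if j is i.+1 then jc k' i else 0) +
      jc k' j * (k%:R * jtheta + (k'%:R - j%:R) * c)
  else (j == 0%N)%:R.

Fixpoint jb (k : nat) : K :=
  if k is k'.+1 then dK (jb k') + k%:R * (jtheta + c) * jb k'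
  else dK a / a - (mu * sK w - w).

Lemma jc_gt k j : dK 0 = 0 -> (k < j)%N -> jc k j = 0.
Proof.
move=> dK0; elim: k j => [|k IHk] [|j] //= kj; rewrite !IHk ?dK0 ?mul0r ?addr0//; lia.
Qed.

Lemma jc_diag k : dK 0 = 0 -> dK 1 = 0 -> jc k k = 1.
Proof.
move=> dK0 dK1; elim: k => //= k IHk.
by rewrite jc_gt// IHk dK0 mul0r addr0 add0r.
Qed.

Section Poly.
Variable N : nat.
Local Notation R := {mpoly K[N]}.
Hypotheses (dK0 : dK 0 = 0) (dK1 : dK 1 = 0).

Definition jh (i : 'I_N) : R := \sum_(j < N) jc i j *: 'X_j + (jb i)%:MP.
Definition jphi (P : R) : R := mmap (@mpolyC N K) jh P.
(** The action of [sigma] on polynomials in the jets; [jphi] is its unipotent part, with neither the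
    twist of coefficients nor the powers of [mu]. *)
Definition jS (P : R) : R := mmap (@mpolyC N K \o sK) (fun i => mu ^- i.+1 *: jh i) P.
Lemma jS_mon m : jS 'X_[m] = mu ^- mnmwgt m *: jphi 'X_[m].
Proof.
rewrite /jS /jphi !mmapX /mmap1.
transitivity ((\prod_(i < N) (mu ^- i.+1) ^+ m i) *: \prod_(i < N) jh i ^+ m i).
  by rewrite -scaler_prod; apply: eq_bigr => i _; rewrite exprZn.
congr (_ *: _); rewrite /mnmwgt -exprVn -prodrXr; apply: eq_bigr => i _.
by rewrite mulnC exprM [mu^-1 ^+ i.+1]exprVn.
Qed.

Lemma jS_sum P : jS P =
  \sum_(m <- msupp P) (sK P@_m * mu ^- mnmwgt m) *: jphi 'X_[m].
Proof.
rewrite {1}[P]mpolyE /jS rmorph_sum; apply: eq_bigr => m _.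
by rewrite /= mmapZ /= -/(jS 'X_[m]) jS_mon mul_mpolyC scalerA.
Qed.

Lemma jphi_sum P : jphi P = \sum_(m <- msupp P) P@_m *: jphi 'X_[m].
Proof.
rewrite {1}[P]mpolyE /jphi rmorph_sum; apply: eq_bigr => m _.
by rewrite /= mmapZ /= mul_mpolyC.
Qed.

(* The part of the substitution [jh] lowering the weight by k. *)
Definition jpart (k i : nat) : R :=
  if (k <= i)%N then jc i (i - k) *: jet N K (i - k)
  else if k == i.+1 then (jb i)%:MP else 0.

Lemma drop_jpart k (i : 'I_N) : lowered (@mnmwgt N) k (jpart k i) (mnmwgt U_(i)%MM).
Proof.
rewrite mnmwgt1 /jpart; case: leqP => [ki|ki].
  apply: dropZ; rewrite /jet; case: insubP => [j _ jE|_]; last exact: drop0.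
  by move=> m; rewrite msuppX inE => /eqP -> /=; rewrite mnmwgt1 jE; lia.
case: eqP => [kE|_]; last exact: drop0.
by move=> m; rewrite msuppC; case: ifP => // _; rewrite inE => /eqP ->; rewrite /= mnmwgt0 kE.
Qed.

Lemma jh_part (i : 'I_N) : jh i = \sum_(k < i.+2) jpart k i.
Proof.
rewrite big_ord_recr /= [jpart i.+1 i]/jpart ltnn eqxx; congr (_ + _).
rewrite (eq_bigr (fun k : 'I_i.+1 => jc i (i - k) *: jet N K (i - k))); last first.
  by move=> k _; rewrite /jpart -ltnS ltn_ord.
rewrite [RHS](reindex_inj rev_ord_inj) /=.
rewrite (eq_bigr (fun j : 'I_i.+1 => jc i j *: jet N K j)); last first.
  by move=> j _; rewrite ?subSS subKn // -ltnS.
rewrite (big_ord_widen N (fun j => jc i j *: jet N K j)) //.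
rewrite [RHS]big_mkcond /=; apply: eq_bigr => j _; rewrite jetE.
by case: ltnP => // ij; rewrite jc_gt // scale0r.
Qed.

Definition jlin (i : 'I_N) := jpart 1 i.
(** The second-order part of the logarithm of the substitution: the exponential of [jlin] already
    accounts for the subtracted term. *)
Definition jquad (i : 'I_N) := jpart 2 i - 2%:R^-1 *: mder jlin (jlin i).

Hypothesis K2 : 2%:R != 0 :> K.

Lemma jpart0 (i : 'I_N) : jpart 0 i = 'X_i.
Proof. by rewrite /jpart /= subn0 jc_diag// scale1r jetE. Qed.

Lemma drop_jlin2 (i : 'I_N) : lowered (@mnmwgt N) 2 (mder jlin (jlin i)) (mnmwgt U_(i)%MM).
Proof.
rewrite [jlin i]/jlin /jpart; case: (leqP 1 i) => i0.
  rewrite mderZ; apply: dropZ; have kN : (i - 1 < N)%N by have := ltn_ord i; lia.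
  rewrite (@mder_jet _ _ (jpart 1)) // => m /(@drop_jpart _ (Ordinal kN)).
  by rewrite !mnmwgt1 /=; lia.
by case: (_ == _); rewrite ?mderC ?mder0; exact: drop0.
Qed.

Lemma jphi_mon m : lowered (@mnmwgt N) 3 (jphi 'X_[m] - taylor2 jlin jquad 'X_[m]) (mnmwgt m).
Proof.
apply: taylor_mon => // i.
- exact: drop_jpart.
- exact: drop_jlin2.
- by apply: dropB; [exact: drop_jpart | apply: dropZ; exact: drop_jlin2].
rewrite [X in _ - X](_ : _ = jpart 0 i + jpart 1 i + jpart 2 i); last first.
  by rewrite /jquad -jpart0 -!addrA [X in _ + (_ + X)]addrC subrK.
rewrite jh_part; case: i => [[|i]] iN /=.
  by rewrite !big_ord_recl big_ord0 /= /bump /= [jpart 2 0]/jpart /= !addr0 subrr; exact: drop0.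
rewrite !big_ord_recl /= /bump /= !addrA [X in lowered _ _ X]addrC addKr.
by apply: drop_sum => k _; apply: dropW (@drop_jpart _ (Ordinal iN)).
Qed.
End Poly.
End JetCoef.

Section Jets.
Variables (K L : fieldType) (iota : {rmorphism K -> L}).
Variables (sK : {rmorphism K -> K}) (sL : {rmorphism L -> L}).
Variables (dK : K -> K) (dL : L -> L) (mu : K).
Hypotheses (iota_s : forall x, sL (iota x) = iota (sK x))
  (iota_d : forall x, dL (iota x) = iota (dK x))
  (dLD : {morph dL : x y / x + y}) (dLM : forall x y, dL (x * y) = dL x * y + x * dL y)
  (d_s : forall x, dL (sL x) = iota mu * sL (dL x)) (mu0 : mu != 0).

Lemma jdKD : {morph dK : x y / x + y}.
Proof. by move=> x y; apply: (fmorph_inj iota); rewrite -iota_d !rmorphD dLD !iota_d. Qed.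
Lemma jdKM x y : dK (x * y) = dK x * y + x * dK y.
Proof.
by apply: (fmorph_inj iota); rewrite -iota_d rmorphD !rmorphM dLM !iota_d.
Qed.
Lemma jdK1 : dK 1 = 0.
Proof. by have /eqP := jdKM 1 1; rewrite !mul1r mulr1 -subr_eq0 opprD addNKr oppr_eq0 => /eqP. Qed.
Lemma jdK0 : dK 0 = 0.
Proof. by have /eqP := jdKD 0 0; rewrite addr0 -subr_eq0 opprD addNKr oppr_eq0 => /eqP. Qed.
Lemma jdLV x : x != 0 -> dL x^-1 = - dL x / x ^+ 2.
Proof.
move=> x0; have := dLM x x^-1; rewrite mulfV// -[in dL 1](rmorph1 iota) iota_d jdK1 rmorph0.
move=> /esym/eqP; rewrite addrC addr_eq0 => /eqP E; apply: (mulfI x0); rewrite E; field.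
exact: x0.
Qed.

Variables (f : L) (a w c : K).
Hypotheses (f0 : f != 0) (a0 : a != 0) (sf : sL f = iota a * f).

Local Notation jc := (jc sK dK mu c).
Local Notation jb := (jb sK dK mu a w c).
Local Notation jtheta := (jtheta sK dK mu c).
Local Notation jrho := (jrho dK mu).

Fixpoint ujet k : L :=
  if k is i.+1 then dL (ujet i) + iota (k%:R * c) * ujet i else dL f / f - iota w.

(** Induction on [k]: differentiate the formula and use [D sigma = mu sigma D]. Differentiating
    [mu^-(k+1)] yields the multiple of [jrho] which enters [jtheta]. *)
Lemma sigma_jet k N : (k < N)%N ->
  sL (ujet k) = iota (mu ^- k.+1) * (\sum_(j < N) iota (jc k j) * ujet j + iota (jb k)).
Proof.
have mu1 : iota mu != 0 by rewrite fmorph_eq0.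
have sd x : sL (dL x) = iota mu^-1 * dL (sL x).
  by rewrite d_s fmorphV mulKf.
elim: k N => [|k IHk] N kN.
  case: N kN => // N _; rewrite big_ord_recl big1 ?addr0 => [|i _]; last first.
    by rewrite /= rmorph0 mul0r.
  rewrite /= rmorph1 mul1r rmorphB rmorphM /= fmorphV sd sf dLM !iota_d iota_s.
  rewrite !rmorphB rmorphM /= !rmorphM /= !fmorphV.
  have a1 : iota a != 0 by rewrite fmorph_eq0.
  by field; rewrite mu1 a1 f0.
have kN' := ltnW kN; rewrite [ujet _]/= rmorphD rmorphM /= sd iota_s (IHk N kN').
set X := \sum_(j < N) _ + _.
have dX : dL X = \sum_(j < N) iota (dK (jc k j) + (if val j is i.+1 then jc k i else 0) +
    jc k j * (- j.+1%:R * c)) * ujet j + iota (dK (jb k)).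
  have dS : dL (\sum_(j < N) iota (jc k j) * ujet j) =
      \sum_(j < N) dL (iota (jc k j) * ujet j).
    by apply: (big_morph dL dLD); rewrite -(rmorph0 iota) iota_d jdK0.
  rewrite /X dLD iota_d; congr (_ + _); rewrite dS.
  have E (j : 'I_N) : dL (iota (jc k j) * ujet j) =
      iota (dK (jc k j) + jc k j * (- j.+1%:R * c)) * ujet j + iota (jc k j) * ujet j.+1.
    rewrite dLM iota_d [ujet j.+1]/= rmorphD !rmorphM rmorphN /=; ring.
  under eq_bigr do rewrite E; rewrite big_split /=.
  case: N kN {IHk kN' dS E X} => // N kN.
  rewrite [X in _ + X]big_ord_recr /= [jc k N]jc_gt ?rmorph0 ?mul0r ?addr0; [|exact: jdK0|by lia].
  rewrite [in LHS]big_ord_recl [in RHS]big_ord_recl /= addr0 -addrA; congr (_ + _).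
  rewrite -big_split /=; apply: eq_bigr => i _.
  by rewrite -mulrDl -rmorphD; congr (iota _ * _); rewrite /bump /= add1n; ring.
have dmu : dL (iota (mu ^- k.+1)) = - iota (k.+1%:R * jrho * mu ^- k.+1).
  rewrite fmorphV jdLV rmorphXn ?expf_neq0//.
  have dX' (j : nat) : dL (iota mu ^+ j.+1) = iota mu ^+ j * iota (dK mu) *+ j.+1.
    elim: j => [|j IHj]; first by rewrite mul1r expr1 iota_d.
    by rewrite exprS dLM IHj iota_d mulrC [RHS]mulrS mulrnAr mulrA -exprS.
  have muk : iota mu ^+ k != 0 by exact: expf_neq0.
  rewrite dX' /jrho !rmorphM /= !fmorphV rmorph_nat rmorphXn -mulr_natr !exprS.
  by field; rewrite mu1 muk.
rewrite dLM dmu dX.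
have -> : \sum_(j < N) iota (jc k.+1 j) * ujet j + iota (jb k.+1) =
  (\sum_(j < N) iota (dK (jc k j) + (if val j is i.+1 then jc k i else 0) +
    jc k j * (- j.+1%:R * c)) * ujet j + iota (dK (jb k))) +
  iota (k.+1%:R * (jtheta + c)) * X.
  rewrite /X mulrDr mulr_sumr addrACA -big_split /= -rmorphM -rmorphD; congr (_ + _).
  apply: eq_bigr => j _; rewrite mulrA -rmorphM -mulrDl -rmorphD; congr (iota _ * _).
  by rewrite -[(nat_of_ord j).+1%:R]natr1 -[k.+1%:R]natr1; ring.
set D := _ + iota (dK (jb k)); rewrite /jtheta.
rewrite !(rmorphM, rmorphD, rmorphN, rmorphB) /= !fmorphV !rmorphXn /= !rmorph_nat !exprS.
have muk : iota mu ^+ k != 0 by exact: expf_neq0.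
by field; rewrite mu1 muk.
Qed.

Section Poly.
Variable N : nat.
Local Notation R := {mpoly K[N]}.

Local Notation jh := (@jh K sK dK mu a w c N).
Local Notation jS := (@jS K sK dK mu a w c N).

Definition jev (P : R) : L := mmap iota (fun i : 'I_N => ujet i) P.

Lemma jev_S P : jev (jS P) = sL (jev P).
Proof.
rewrite /jev /jS; apply: (@mmap_ext _ _ _ (mmap iota (fun i : 'I_N => ujet i) \o
  mmap (@mpolyC N K \o sK) (fun i => mu ^- i.+1 *: jh i)) (sL \o mmap iota (fun i : 'I_N => ujet i))).
  by move=> x /=; rewrite !mmapC /= iota_s.
move=> i /=; rewrite !mmapX !mmap1U mmapZ (sigma_jet (ltn_ord i)); congr (_ * _).
rewrite /jh rmorphD /= mmapC rmorph_sum /=; congr (_ + _).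
by apply: eq_bigr => j _; rewrite mmapZ mmapX mmap1U.
Qed.

End Poly.
End Jets.

Section Homog.
Variables (n : nat) (K : fieldType) (mf : measure n).
Local Notation R := {mpoly K[n]}.

Lemma mtop_ge W (P : R) m : m \in msupp (mtop mf W P) -> mf m = W.
Proof. by rewrite mcoeff_msupp mcoeff_mtop; have [|_] := eqVneq (mf m) W; rewrite ?eqxx. Qed.

Definition raised k (P : R) d := forall m, m \in msupp P -> (d <= mf m + k)%N.

Lemma msupp_mder (v : 'I_n -> R) P m : m \in msupp (mder v P) ->
  exists i m1 m2, [/\ m1 \in msupp (v i), (m2 + U_(i))%MM \in msupp P & m = (m1 + m2)%MM].
Proof.
rewrite /mder mcoeff_msupp raddf_sum /= => /eqP s0; apply: contrapT => nex; apply: s0.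
apply/big1 => i _; apply/memN_msupp_eq0/negP => /msuppM_le/allpairsP[[m1 m2] /= [h1 h2 mE]].
apply: nex; exists i, m1, m2; split=> //; move: h2; rewrite !mcoeff_msupp mcoeff_deriv.
by apply: contraNneq => ->; rewrite mul0rn.
Qed.

Lemma raised_mder k (v : 'I_n -> R) P d : (forall i, raised k (v i) (mf U_(i)%MM)) ->
  raised 0 P d -> raised k (mder v P) d.
Proof.
move=> vk Pd _ /msupp_mder[i [m1 [m2 [/vk h1 /Pd h2 ->]]]].
by move: h1 h2; rewrite !mfD; lia.
Qed.

Lemma lowered_mder k (v : 'I_n -> R) P d : (forall i, lowered mf k (v i) (mf U_(i)%MM)) ->
  lowered mf 0 P d -> lowered mf k (mder v P) d.
Proof.
move=> vk Pd _ /msupp_mder[i [m1 [m2 [/vk h1 /Pd h2 ->]]]].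
by move: h1 h2; rewrite !mfD; lia.
Qed.

Lemma mder_map (s : {rmorphism K -> K}) (v : 'I_n -> R) P :
  (forall i, map_mpoly s (v i) = v i) -> map_mpoly s P = P -> map_mpoly s (mder v P) = mder v P.
Proof.
move=> vs Ps; rewrite /mder rmorph_sum; apply: eq_bigr => i _ /=.
rewrite rmorphM /= vs; congr (_ * _); apply/mpolyP => m.
by rewrite mcoeff_map_mpoly /= !mcoeff_deriv -{2}Ps mcoeff_map_mpoly rmorphMn.
Qed.
End Homog.

(** * Eigenvectors and their coefficients near the top of a filtration *)

Section Eigen.
Variables (K : fieldType) (sK : {rmorphism K -> K}) (dK : K -> K) (mu : K).
Hypothesis mu0 : mu != 0.
Variables (a w c : K) (N : nat).
Local Notation R := {mpoly K[N]}.
Local Notation jS := (@jS K sK dK mu a w c N).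
Local Notation jphi := (@jphi K sK dK mu a w c N).
Local Notation wgt := (@mnmwgt N).

Definition eigen (P : R) W := [/\ jS P = mu ^- W *: P, lowered wgt 0 P W, (0 < W)%N
  & exists2 m, m \in msupp P & wgt m = W].

Variables (P : R) (W : nat).
Hypothesis EP : eigen P W.

(** Separates [jphi - id], which in a filtration lowered by [jphi] contributes only from monomials
    above [M]. *)
Lemma eigen_coef M : P@_M = mu ^+ (W - wgt M) * sK P@_M +
  \sum_(m <- msupp P) sK P@_m * mu ^+ (W - wgt m) * (jphi 'X_[m] - 'X_[m])@_M.
Proof.
have [SP dP _ _] := EP; have muW k : mu ^+ k != 0 by exact: expf_neq0.
have /(congr1 (fun x => mu ^+ W * x@_M)) := SP.
rewrite mcoeffZ mulVKf// => {1}<-; rewrite jS_sum raddf_sum mulr_sumr /=.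
under [X in _ = _ + X]eq_bigr do rewrite mcoeffB mulrBr.
rewrite sumrB addrCA (_ : _ * _ = \sum_(m <- msupp P) sK P@_m * mu ^+ (W - wgt m) * ('X_[m])@_M).
  rewrite subrr addr0; apply: eq_big_seq => m mP; rewrite mcoeffZ mulrA mulrCA mulrA.
  have /dP := mP; rewrite addn0 => mW.
  by rewrite -{1}(subnK mW) exprD -mulrA mulfK // mulrC.
have [MP|MP] := boolP (M \in msupp P).
  rewrite (bigD1_seq M)//= ?msupp_uniq// mcoeffX eqxx mulr1 mulrC big1 ?addr0// => m mM.
  by rewrite mcoeffX (negbTE mM) mulr0.
rewrite (memN_msupp_eq0 MP) rmorph0 mulr0 big1_seq// => m /andP[_ mP].
by rewrite mcoeffX; case: eqP mP => [->|]; rewrite ?(negbTE MP)// mulr0.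
Qed.

Section Top.
Variables (mf : measure N) (D : nat).
Hypothesis phi1 : forall m, lowered mf 1 (jphi 'X_[m] - 'X_[m]) (mf m).
Hypothesis PD : lowered mf 0 P D.

Lemma eigen_top M : mf M = D -> P@_M = mu ^+ (W - wgt M) * sK P@_M.
Proof.
move=> MD; rewrite {1}eigen_coef big1_seq ?addr0// => m /andP[_ mP].
by rewrite (drop_coef (@phi1 m)) ?mulr0// MD addn1 ltnS -[mf m]addn0 (PD mP).
Qed.

(** If [P] has nothing strictly between [M] and the top, only the top part contributes, and there
    [eigen_top] converts the twisted coefficients into those of [P]. It is applied to the filtration
    by weight and to that by total degree. *)
Lemma eigen_step M : (mf M < D)%N ->
  (forall m, m \in msupp P -> (mf M < mf m)%N -> mf m = D) ->
  P@_M = mu ^+ (W - wgt M) * sK P@_M + (jphi (mtop mf D P))@_M.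
Proof.
move=> MD gap; rewrite {1}eigen_coef; congr (_ + _).
rewrite /mtop /jphi rmorph_sum raddf_sum /= [RHS]big_mkcond /=.
apply: eq_big_seq => m mP; case: eqP => mD.
  rewrite mmapZ /= mul_mpolyC mcoeffZ mcoeffB [sK _ * _]mulrC -eigen_top// mcoeffX.
  by case: eqP => [mM|_]; rewrite ?subr0//; move: MD; rewrite -mM mD ltnn.
rewrite (drop_coef (@phi1 m)) ?mulr0// addn1 ltnS leqNgt; apply/negP => Mm.
by apply: mD; apply: gap.
Qed.
End Top.
End Eigen.

Section MderLinear.
Variables (n : nat) (K : fieldType).
Implicit Types (v u : 'I_n -> {mpoly K[n]}).

Lemma mder_addl v u P : mder (fun i => v i + u i) P = mder v P + mder u P.
Proof. by rewrite /mder -big_split; apply: eq_bigr => i _; rewrite mulrDl. Qed.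

Lemma mder_scalel x v P : mder (fun i => x *: v i) P = x *: mder v P.
Proof. by rewrite /mder scaler_sumr; apply: eq_bigr => i _; rewrite scalerAl. Qed.

Lemma nonconst_mderiv (P : {mpoly K[n]}) (mf : measure n) D m :
  (forall k, k.+1%:R != 0 :> K) ->
  (0 < D)%N -> mf m = D -> m \in msupp P -> exists i, P^`M(i) != 0.
Proof.
move=> K0 D0 mD mP; have [i mi] : exists i, m i != 0%N.
  apply/existsP; apply: contraTT D0 => /existsPn m0; rewrite -mD (_ : m = 0%MM) ?mf0//.
  by apply/mnmP => i; rewrite mnm0E; apply/eqP; rewrite -[_ == _]negbK m0.
exists i; apply: contraTneq mP => P0; rewrite mcoeff_msupp negbK.
have /eqP : (P^`M(i))@_(m - U_(i))%MM = 0 by rewrite P0 mcoeff0.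
have Um : (U_(i) <= m)%MM by rewrite lep1mP.
rewrite mcoeff_deriv submK// -mulr_natr mulf_eq0 => /orP[//|].
by rewrite mnmBE mnm1E eqxx (negbTE (K0 _)).
Qed.
End MderLinear.

Section Filtration.
Variables (K : fieldType) (sK : {rmorphism K -> K}) (dK : K -> K) (mu a w c : K) (N : nat).
Hypotheses (dK0 : dK 0 = 0) (dK1 : dK 1 = 0) (K2 : 2%:R != 0 :> K).
Local Notation R := {mpoly K[N]}.
Local Notation jphi := (@jphi K sK dK mu a w c N).
Local Notation jlin := (@jlin K sK dK mu a w c N).
Local Notation jquad := (@jquad K sK dK mu a w c N).
Local Notation wgt := (@mnmwgt N).

Lemma jlin_lowered (i : 'I_N) : lowered wgt 1 (jlin i) (wgt U_(i)%MM).
Proof. exact: drop_jpart. Qed.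

Lemma jquad_lowered (i : 'I_N) : lowered wgt 2 (jquad i) (wgt U_(i)%MM).
Proof. by apply: dropB; [apply: drop_jpart | apply/dropZ/drop_jlin2]. Qed.

Lemma mder_jlin_lowered Q d : lowered wgt 0 Q d -> lowered wgt 1 (mder jlin Q) d.
Proof. exact/lowered_mder/jlin_lowered. Qed.

Lemma mder_jquad_lowered Q d : lowered wgt 0 Q d -> lowered wgt 2 (mder jquad Q) d.
Proof. exact/lowered_mder/jquad_lowered. Qed.

Lemma mder_jlin2_lowered Q d : lowered wgt 0 Q d -> lowered wgt 2 (mder jlin (mder jlin Q)) d.
Proof.
move=> Qd m mQ; have d0 : (0 < d)%N.
  apply: contraT; rewrite -eqn0Ngt => /eqP d0; move: mQ.
  rewrite (_ : mder jlin Q = 0) ?mder0 ?msupp0//; apply/eqP; rewrite -msupp_eq0 -size_eq0.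
  apply/eqP; case E: (msupp _) => [//|x s].
  have /(mder_jlin_lowered Qd) : x \in msupp (mder jlin Q) by rewrite E mem_head.
  by rewrite d0 addn1.
suff /(_ m mQ) : lowered wgt 1 (mder jlin (mder jlin Q)) d.-1 by lia.
by apply: mder_jlin_lowered => m' /(mder_jlin_lowered Qd); lia.
Qed.

Lemma jphi_lowered m : lowered wgt 1 (jphi 'X_[m] - 'X_[m]) (wgt m).
Proof.
rewrite (_ : jphi 'X_[m] - 'X_[m] = jphi 'X_[m] - taylor2 jlin jquad 'X_[m] +
  (taylor2 jlin jquad 'X_[m] - 'X_[m])); last by rewrite addrA subrK.
have X0 := @dropX N K wgt m.
apply: dropD.
  by apply: (@dropW _ _ _ 3) => //; apply: jphi_mon.
rewrite /taylor2 -!addrA [X in lowered _ _ X]addrC !addrA addrNK.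
apply: dropD; first (apply: dropD; first exact: mder_jlin_lowered).
  by apply: dropZ; apply: (@dropW _ _ _ 2) => //; apply: mder_jlin2_lowered.
by apply: (@dropW _ _ _ 2) => //; apply: mder_jquad_lowered.
Qed.

(** Errors of order three cannot reach coefficients within two weights of the top. *)
Lemma jphi_coef Q d M : lowered wgt 0 Q d -> (wgt M < d <= (wgt M).+2)%N ->
  (jphi Q)@_M = (taylor2 jlin jquad Q)@_M.
Proof.
move=> Qd /andP[Md dM].
have mder2E (v : 'I_N -> R) P : mder v (mder v P) =
    \sum_(m <- msupp P) P@_m *: mder v (mder v 'X_[m]).
  by rewrite [mder v P]mderE mder_sum; apply: eq_bigr => m _; rewrite mderZ.
have tE : taylor2 jlin jquad Q = \sum_(m <- msupp Q) Q@_m *: taylor2 jlin jquad 'X_[m].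
  rewrite /taylor2 mder2E (mderE jlin) (mderE jquad) {1}[Q]mpolyE scaler_sumr -!big_split /=.
  by apply: eq_bigr => m _; rewrite !scalerDr !scalerA [_^-1 * _]mulrC.
rewrite tE jphi_sum !raddf_sum; apply: eq_big_seq => m mQ /=; rewrite !mcoeffZ.
congr (_ * _); apply/eqP; rewrite -subr_eq0 -mcoeffB; apply/eqP.
have h : lowered wgt 3 (jphi 'X_[m] - taylor2 jlin jquad 'X_[m]) (wgt m) by exact: jphi_mon.
by apply: (drop_coef h); have := Qd _ mQ => /=; lia.
Qed.
End Filtration.

(** * The coefficients of weight [W - 1] and [W - 2] *)

Section Stages.
Variables (K : fieldType) (sK : {rmorphism K -> K}) (dK : K -> K) (mu : K).
Hypotheses (mu0 : mu != 0) (K0 : forall k, k.+1%:R != 0 :> K).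
Hypotheses (dKD : {morph dK : x y / x + y}) (dKM : forall x y, dK (x * y) = dK x * y + x * dK y).
Hypotheses (dK0 : dK 0 = 0) (dK1 : dK 1 = 0).
Variables (a w : K) (N : nat).
Local Notation R := {mpoly K[N]}.
Local Notation rho := (jrho dK mu).
Local Notation schw := (dK rho - rho ^+ 2 / 2%:R).
Local Notation eigen := (@eigen K sK dK mu a w 0 N).
Local Notation jphi := (@jphi K sK dK mu a w 0 N).
Local Notation jc := (jc sK dK mu 0).
Local Notation jb := (jb sK dK mu a w 0).
Local Notation jlin := (@jlin K sK dK mu a w 0 N).
Local Notation jquad := (@jquad K sK dK mu a w 0 N).
Local Notation jpart := (@jpart K sK dK mu a w 0 N).
Local Notation wgt := (@mnmwgt N).
Local Notation wder lam j := (mder (fun i : 'I_N => witt N lam j i)).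

Lemma jtheta_connection c : mu * sK c = c + rho -> jtheta sK dK mu c = 0.
Proof. by rewrite /jtheta => ->; rewrite [c + _]addrC addrK subrr. Qed.

Lemma jtheta0 : jtheta sK dK mu 0 = - rho.
Proof. by rewrite /jtheta rmorph0 mulr0 subr0 sub0r. Qed.

Lemma dK_nat n : dK n%:R = 0.
Proof. by elim: n => // n IHn; rewrite -natr1 dKD IHn dK1 addr0. Qed.

Lemma dKN x : dK (- x) = - dK x.
Proof. by apply/eqP; rewrite -addr_eq0 -dKD addNr dK0. Qed.

Lemma jcS k j : jc k.+1 j =
  dK (jc k j) + (if j is i.+1 then jc k i else 0) - jc k j * (k.+1%:R * rho).
Proof. by rewrite /= jtheta0 mulr0 addr0 mulrN mulrN. Qed.

Lemma jc_sub1 k : jc k.+1 k = - (k.+2 ^_ 2)%:R / 2%:R * rho.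
Proof.
elim: k => [|k IHk]; rewrite jcS jc_diag// dK1 add0r.
  by rewrite add0r !mul1r ffactnn (_ : 2`! = 2)%N// mulNr mulfV ?(K0 1)// mulN1r.
rewrite IHk !(ffactSS, ffactn0) !natrM mul1r.
by rewrite -[k.+3%:R]natr1 -[k.+2%:R]natr1 -[k.+1%:R]natr1; field; exact: (K0 1).
Qed.

(** Expressed through the Schwarzian so that, in [jquad_witt], half the square of the first-order
    part cancels the terms in [rho ^+ 2]. *)
Lemma jc_sub2 k : jc k.+2 k = (k.+3 ^_ 3)%:R * (k.+2%:R * rho ^+ 2 / 8%:R - schw / 6%:R).
Proof.
have dhalf x (r : K) : dK (- x%:R / 2%:R * r) = - x%:R / 2%:R * dK r.
  have h y : dK (y / 2%:R) = dK y / 2%:R.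
    apply: (mulIf (K0 1)); rewrite divfK ?(K0 1)//.
    by have := dKM (y / 2%:R) 2%:R; rewrite dK_nat mulr0 addr0 divfK ?(K0 1).
  by rewrite dKM h dKN dK_nat oppr0 mul0r mul0r add0r.
have n2 : 2%:R != 0 :> K by exact: (K0 1).
have n8 : 8%:R != 0 :> K by exact: (K0 7).
have n6 : 6%:R != 0 :> K by exact: (K0 5).
elim: k => [|k IHk]; rewrite jcS jc_sub1 dhalf.
  by rewrite !(ffactSS, ffactn0) /= !natrM; field; rewrite ?n2 ?n8 ?n6.
rewrite IHk !(ffactSS, ffactn0) !natrM.
rewrite -[k.+4%:R]natr1 -[k.+3%:R]natr1 -[k.+2%:R]natr1 -[k.+1%:R]natr1.
by field; rewrite ?n2 ?n8 ?n6.
Qed.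

Variable lam : K.
Hypotheses (dlam : dK lam = 0).

Lemma jlin_witt (b : K) i : jb 0 = lam * rho + b ->
  jlin i = - rho / 2%:R *: witt N lam 1 i + (if val i == 0%N then b%:MP else 0).
Proof.
move=> b0; rewrite /jlin; case: i => [[|i] iN] /=.
  rewrite /jpart /= -/(jb 0) b0 witt_pred -mul_mpolyC -mpolyCM -mpolyCD; congr (_%:MP).
  by rewrite (_ : 2`! = 2)%N//; field; exact: (K0 1).
have -> : jpart 1 i.+1 = jc i.+1 i *: jet N K i by rewrite /jpart subSS subn0.
rewrite addr0 witt_ge// subSS subn0 jc_sub1 scalerA; congr (_ *: _).
by field; exact: (K0 1).
Qed.

Lemma jquad_witt i : jb 0 = lam * rho -> jquad i = - schw / 6%:R *: witt N lam 2 i.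
Proof.
move=> b0; have b0' : jb 0 = lam * rho + 0 by rewrite addr0.
have lE (k : 'I_N) : jlin k = - rho / 2%:R *: witt N lam 1 k.
  by rewrite (jlin_witt _ b0') if_same addr0.
have lE' : mder jlin =1 mder (fun k : 'I_N => - rho / 2%:R *: witt N lam 1 k).
  by move=> Q; apply: mder_ext.
have n2 : 2%:R != 0 :> K by exact: (K0 1).
have n8 : 8%:R != 0 :> K by exact: (K0 7).
have n6 : 6%:R != 0 :> K by exact: (K0 5).
rewrite /jquad lE lE' mder_scalel mderZ !scalerA; case: i => [[|[|i]] iN] /=.
- by rewrite witt_pred mderC witt_lt// !scaler0 subr0 /jpart.
- rewrite witt_ge// mderZ mder_jet ?(ltnW iN)// subnn !witt_pred /jpart /= -/(jb 0).
  rewrite jtheta0 addr0 b0 dKM dlam mul0r add0r -!mul_mpolyC -!mpolyCM -mpolyCB; congr (_%:MP).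
  rewrite (_ : 2 ^_ 2 = 2)%N// (_ : 2`! = 2)%N// (_ : 3`! = 6)%N//.
  by field; rewrite n2 n6.
have -> : jpart 2 i.+2 = jc i.+2 i *: jet N K i by rewrite /jpart !subSS subn0.
rewrite !witt_ge// mderZ subSS subn0 mder_jet ?(ltnW iN)// witt_ge// !subSS !subn0.
rewrite !scalerA -scalerBl jc_sub2; congr (_ *: _).
rewrite !(ffactSS, ffactn0) !natrM -[i.+3%:R]natr1 -[i.+2%:R]natr1 -[i.+1%:R]natr1.
by field; rewrite n2 n8 n6.
Qed.
Let K2 := K0 1.
Let jphi_low m : lowered wgt 1 (jphi 'X_[m] - 'X_[m]) (wgt m).
Proof. exact: jphi_lowered. Qed.

Section Top.
Variables (P : R) (W : nat).
Hypothesis EP : eigen P W.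
Local Notation Q := (mtop wgt W P).

Lemma top_lowered : lowered wgt 0 Q W.
Proof. by move=> m /mtop_ge ->; rewrite addn0. Qed.

Lemma top_raised : raised wgt 0 Q W.
Proof. by move=> m /mtop_ge ->; rewrite addn0. Qed.

Lemma top_fixed : map_mpoly sK Q = Q.
Proof.
have [_ PW _ _] := EP.
apply/mpolyP => M; rewrite mcoeff_map_mpoly /= mcoeff_mtop; case: eqP => [MW|_]; last exact: rmorph0.
by rewrite [RHS](eigen_top mu0 EP jphi_low PW MW) MW subnn mul1r.
Qed.

Lemma top_nonconst : exists i, Q^`M(i) != 0.
Proof.
have [_ _ W0 [m mP mW]] := EP; apply: (@nonconst_mderiv _ _ Q wgt W m) => //.
by rewrite mcoeff_msupp mcoeff_mtop /= mW eqxx -mcoeff_msupp.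
Qed.

Lemma top_step M : (wgt M < W <= (wgt M).+2)%N ->
  (forall m, m \in msupp P -> (wgt M < wgt m)%N -> wgt m = W) ->
  P@_M = mu ^+ (W - wgt M) * sK P@_M + (mder jlin Q)@_M +
     (2%:R^-1 * (mder jlin (mder jlin Q))@_M + (mder jquad Q)@_M).
Proof.
move=> /andP[MW WM] gap; have [_ PW _ _] := EP.
rewrite [LHS](eigen_step mu0 EP jphi_low PW MW gap) -addrA; congr (_ + _).
rewrite (@jphi_coef K sK dK mu a w 0 N dK0 dK1 K2 _ _ _ top_lowered) ?MW// /taylor2 !mcoeffD mcoeffZ mcoeff_mtop.
by rewrite (ltn_eqF MW) add0r addrA.
Qed.

Lemma top_step1 M : (wgt M).+1 = W ->
  P@_M = mu * sK P@_M + (mder jlin Q)@_M.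
Proof.
move=> MW; have [_ PW _ _] := EP.
have MW2 : (wgt M < W <= (wgt M).+2)%N by lia.
rewrite [LHS](top_step MW2); last by move=> m /PW /=; lia.
rewrite (_ : W - wgt M = 1)%N; last by lia.
rewrite expr1 (drop_coef (mder_jlin2_lowered K2 top_lowered)) /=; last by lia.
by rewrite (drop_coef (mder_jquad_lowered K2 top_lowered)) /= ?mulr0 ?addr0//; lia.
Qed.

Local Notation del0 := (mder (fun i : 'I_N => if val i == 0%N then 1 else 0)).

Lemma top_linear b M : jb 0 = lam * rho + b -> (wgt M).+1 = W ->
  P@_M = mu * sK P@_M - rho / 2%:R * (wder lam 1 Q)@_M + b * (del0 Q)@_M.
Proof.
move=> b0 MW; rewrite [LHS]top_step1// -addrA; congr (_ + _).
rewrite (@mder_ext _ _ _ (fun i => - rho / 2%:R *: witt N lam 1 i +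
   b *: (if val i == 0%N then 1 else 0))); last first.
  move=> i; rewrite (jlin_witt _ b0); congr (_ + _).
  by case: (val i == _); rewrite -mul_mpolyC ?mulr1 ?mulr0.
by rewrite mder_addl !mder_scalel mcoeffD !mcoeffZ mulNr mulNr.
Qed.

Lemma witt_weight j (i : 'I_N) m : (0 < j)%N -> m \in msupp (witt N lam j i) ->
  (wgt m + j = wgt U_(i))%N.
Proof.
rewrite mnmwgt1 /witt => j0; case: leqP => ji; last first.
  case: eqP => [iE|_]; last by rewrite msupp0.
  by rewrite -mpolyCN msuppC; case: ifP => // _; rewrite inE => /eqP ->; rewrite mnmwgt0 -iE.
move=> /msuppZ_le; rewrite /jet; case: insubP => [k _ kE|_]; last by rewrite msupp0.
by rewrite msuppX inE => /eqP ->; rewrite mnmwgt1 kE; lia.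
Qed.

Lemma wder_weight j m : (0 < j)%N -> m \in msupp (wder lam j Q) -> (wgt m + j = W)%N.
Proof.
move=> j0 mQ; apply/eqP; rewrite eqn_leq; apply/andP; split.
  apply: (lowered_mder (mf := wgt) _ top_lowered mQ) => i m' /(witt_weight j0) /= <-.
  exact: leqnn.
apply: (raised_mder (mf := wgt) _ top_raised mQ) => i m' /(witt_weight j0) /= <-.
exact: leqnn.
Qed.

Lemma del0_weight m : m \in msupp (del0 Q) -> ((wgt m).+1 = W)%N.
Proof.
have h (i : 'I_N) m' : m' \in msupp (if val i == 0%N then 1 else 0 : R) ->
    (wgt m' + 1 = wgt U_(i))%N.
  rewrite mnmwgt1; case: eqP => [->|_]; last by rewrite msupp0.
  by rewrite msupp1 inE => /eqP ->; rewrite mnmwgt0.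
move=> mQ; apply/eqP; rewrite -addn1 eqn_leq; apply/andP; split.
  by apply: (lowered_mder (mf := wgt) _ top_lowered mQ) => i m' /h /= <-.
by apply: (raised_mder (mf := wgt) _ top_raised mQ) => i m' /h /= <-.
Qed.

Lemma wder_fixed j m : sK lam = lam -> sK (wder lam j Q)@_m = (wder lam j Q)@_m.
Proof.
move=> slam; rewrite -mcoeff_map_mpoly mder_map//; last exact: top_fixed.
move=> i; rewrite /witt; case: ifP => _.
  rewrite scaler_nat rmorphMn /jet; case: insubP => [k _ _|_]; rewrite ?rmorph0//.
  by rewrite /= map_mpolyX.
case: ifP => _; rewrite ?rmorph0// rmorphN /= map_mpolyC /= rmorphM rmorph_nat /= slam.
by [].
Qed.

Lemma del0_fixed m : sK (del0 Q)@_m = (del0 Q)@_m.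
Proof.
rewrite -mcoeff_map_mpoly mder_map//; last exact: top_fixed.
by move=> i; case: ifP => _; rewrite ?rmorph0 ?rmorph1.
Qed.

Lemma del0E (i : 'I_N) : val i = 0%N -> del0 Q = Q^`M(i).
Proof.
move=> i0; rewrite -mder_delta; apply: mder_ext => k.
by rewrite -[k == i](inj_eq val_inj) i0; case: (_ == _).
Qed.

(** If the field of index 1 does not kill the top part, a coefficient of weight [W - 1] satisfies
    [x = mu sigma x - rho t / 2] with [t] fixed, and [2 x / t] is a connection. Otherwise the field
    of index 2 does not kill it; weight [W - 1] is empty by injectivity, and weight [W - 2] gives
    [x = mu^2 sigma x - schw t / 6]. *)
Lemma connection_or_projective : sK lam = lam -> lam != 0 -> jb 0 = lam * rho ->
  (forall x, mu * sK x = x -> x = 0) ->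
  (exists g, mu * sK g = g + rho) \/ (exists q, mu ^+ 2 * sK q = q + schw).
Proof.
move=> slam lam0 b0 inj1; have b0' : jb 0 = lam * rho + 0 by rewrite addr0.
have n2 : 2%:R != 0 :> K by exact: (K0 1).
have n6 : 6%:R != 0 :> K by exact: (K0 5).
have [T0|] := eqVneq (wder lam 1 Q) 0; last first.
  rewrite -msupp_eq0 -size_eq0; case E: (msupp _) => [//|M s] _; left.
  have MT : M \in msupp (wder lam 1 Q) by rewrite E mem_head.
  have MW : (wgt M).+1 = W by rewrite -addn1 (wder_weight _ MT).
  move: (top_linear b0' MW) (wder_fixed 1 M slam) MT; rewrite mcoeff_msupp mul0r addr0.
  set t := (wder lam 1 Q)@_M => PM st t0.
  exists (2%:R * P@_M / t); rewrite rmorphM fmorphV st rmorphM rmorph_nat.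
  by rewrite [X in _ = 2 * X / _ + _]PM; field; rewrite n2 t0.
right; have [T2|] := eqVneq (wder lam 2 Q) 0.
  have [ i ] := top_nonconst; rewrite (witt_kernel K0 lam0 T0 T2) eqxx//.
rewrite -msupp_eq0 -size_eq0; case E: (msupp _) => [//|M s] _.
have MT : M \in msupp (wder lam 2 Q) by rewrite E mem_head.
have MW : ((wgt M).+2 = W)%N by rewrite -addn2 (wder_weight _ MT).
have lQ : mder jlin Q = 0.
  rewrite (@mder_ext _ _ _ (fun i : 'I_N => - rho / 2%:R *: witt N lam 1 i)) => [|i].
    by rewrite mder_scalel T0 scaler0.
  by rewrite (jlin_witt _ b0') if_same addr0.
have qQ : mder jquad Q = - schw / 6%:R *: wder lam 2 Q.
  by rewrite -mder_scalel; apply: mder_ext => i; exact: jquad_witt.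
have gap m : m \in msupp P -> (wgt M < wgt m)%N -> wgt m = W.
  have [_ PW _ _] := EP.
  move=> mP Mm; have /= mW := PW _ mP; apply/eqP; apply: contraTT mP => nW.
  have mW1 : (wgt m).+1 = W by lia.
  rewrite mcoeff_msupp negbK; apply/eqP/inj1.
  by rewrite [RHS](top_step1 mW1) lQ mcoeff0 addr0.
have MW2 : (wgt M < W <= (wgt M).+2)%N by lia.
move: (top_step MW2 gap) (wder_fixed 2 M slam) MT; rewrite mcoeff_msupp.
rewrite lQ mder0 mcoeff0 mulr0 addr0 add0r qQ mcoeffZ (_ : W - wgt M = 2)%N; last by lia.
set t := (wder lam 2 Q)@_M => PM st t0.
exists (6%:R * P@_M / t); rewrite rmorphM fmorphV st rmorphM rmorph_nat.
rewrite [X in _ = 6 * X / _ + _]PM; set S := (dK _ - _); field.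
by rewrite n6 t0.
Qed.
End Top.
End Stages.

(** With [c = w = 0] the first-order action is [- rho/2] times the Witt field of index 1 plus
    [D a / a] times the partial derivative in [u_0]; by [affine_kernel] one of the two does not kill
    the top part. *)
Lemma affine_or_linear (K : fieldType) (sK : {rmorphism K -> K}) (dK : K -> K) (mu : K)
    (mu0 : mu != 0) (K0 : forall k, k.+1%:R != 0 :> K)
    (dKD : {morph dK : x y / x + y}) (dKM : forall x y, dK (x * y) = dK x * y + x * dK y)
    (dK0 : dK 0 = 0) (dK1 : dK 1 = 0) (a : K) N (P : {mpoly K[N]}) W :
  eigen sK dK mu a 0 0 P W ->
  exists tau beta g, [/\ (tau != 0) || (beta != 0), sK tau = tau, sK beta = beta &
    mu * sK g = g + tau * jrho dK mu - beta * (dK a / a)].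
Proof.
move=> EP; set rho := jrho dK mu.
have b0 : jb sK dK mu a 0 0 0 = 0 * rho + dK a / a.
  by rewrite /= rmorph0 mulr0 subrr subr0 mul0r add0r.
have n2 : 2%:R != 0 :> K by exact: (K0 1).
set Q := mtop (@mnmwgt N) W P.
set T := mder (fun i : 'I_N => witt N 0 1 i) Q.
set B := mder (fun i : 'I_N => if val i == 0%N then 1 else 0) Q.
have [M MW MTB] : exists2 M, (mnmwgt M).+1 = W & (T@_M != 0) || (B@_M != 0).
  have [T0|] := eqVneq T 0; last first.
    rewrite -msupp_eq0 -size_eq0; case E: (msupp _) => [//|M s] _; exists M.
      by rewrite -addn1; apply: (wder_weight mu0 K0 (lam := 0) (P := P)); rewrite // -/Q -/T E mem_head.
    by rewrite -mcoeff_msupp E mem_head.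
  have [B0|] := eqVneq B 0; last first.
    rewrite -msupp_eq0 -size_eq0; case E: (msupp _) => [//|M s] _; exists M.
      by apply: (del0_weight (P := P)); rewrite -/Q -/B E mem_head.
    by rewrite orbC -mcoeff_msupp E mem_head.
  have [ i ] := top_nonconst K0 EP; rewrite (affine_kernel K0 T0) ?eqxx// => k k0.
  by rewrite -(del0E P W k0).
have PM := top_linear mu0 K0 dK0 dK1 EP b0 MW.
exists (T@_M / 2%:R), (B@_M), (P@_M); split.
- by rewrite mulf_eq0 invr_eq0 (negbTE n2) orbF.
- rewrite rmorphM fmorphV rmorph_nat (wder_fixed mu0 K0 dK0 dK1 EP)//.
  exact: rmorph0.
- exact: (del0_fixed mu0 K0 dK0 dK1 EP).
- rewrite [X in _ = X + _ - _]PM -/Q -/T -/B -/rho; set b := dK a / a; field; exact: n2.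
Qed.

(** When [tau] and [beta] are both nonzero, [w = - g / beta] reduces [D a / a] to [(tau / beta) rho]
    modulo [mu sigma w - w]. *)
Lemma eigen_trichotomy (K : fieldType) (sK : {rmorphism K -> K}) (dK : K -> K) (mu : K)
    (mu0 : mu != 0) (K0 : forall k, k.+1%:R != 0 :> K)
    (dKD : {morph dK : x y / x + y}) (dKM : forall x y, dK (x * y) = dK x * y + x * dK y)
    (dK0 : dK 0 = 0) (dK1 : dK 1 = 0) (a : K) N (P : {mpoly K[N]}) W :
  eigen sK dK mu a 0 0 P W ->
  [\/ exists g, mu * sK g = g + jrho dK mu, exists g, mu * sK g = g + dK a / a |
    exists lam w, [/\ lam != 0, sK lam = lam & jb sK dK mu a w 0 0 = lam * jrho dK mu]].
Proof.
move=> /(affine_or_linear mu0 K0 dKD dKM dK0 dK1)[tau [beta [g [tb stau sbeta gE]]]].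
set rho := jrho dK mu in gE *; rewrite /=; set b := dK a / a in gE *.
have [b0|b0] := eqVneq beta 0.
  rewrite b0 eqxx orbF in tb; constructor 1; exists (g / tau).
  by rewrite fmorph_div stau mulrA gE b0; field; exact: tb.
have [t0|t0] := eqVneq tau 0.
  constructor 2; exists (- g / beta).
  by rewrite fmorph_div rmorphN sbeta mulrA mulrN gE t0; field; exact: b0.
constructor 3; exists (tau / beta), (- g / beta); split.
- by rewrite mulf_neq0 ?invr_eq0.
- by rewrite fmorph_div stau sbeta.
- by rewrite fmorph_div rmorphN sbeta mulrA mulrN gE; field; exact: b0.
Qed.

(** The 1-form [x dz] is invariant; the connection constructed is the one for which it is
    parallel. *)
Lemma fixed_connection (K : fieldType) (sK : {rmorphism K -> K}) (dK : K -> K) (mu x : K) :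
    mu != 0 -> (forall x y, dK (x * y) = dK x * y + x * dK y) ->
    (forall y, dK (sK y) = sK (dK y) * mu) -> x != 0 -> mu * sK x = x ->
  mu * sK (- dK x / x) = - dK x / x + jrho dK mu.
Proof.
move=> mu0 dKM dKs x0 xE; have s0 : sK x != 0 by rewrite fmorph_eq0.
have dx : dK x = dK mu * sK x + mu * (sK (dK x) * mu) by rewrite -{1}xE dKM dKs.
rewrite fmorph_div rmorphN [X in _ = - X / _ + _]dx -[X in _ = _ / X + _]xE /jrho.
by field; rewrite s0 mu0.
Qed.

(** * Jets relative to an invariant connection *)

Section Translation.
Variables (K : fieldType) (sK : {rmorphism K -> K}) (dK : K -> K) (mu : K).
Hypotheses (mu0 : mu != 0) (K0 : forall k, k.+1%:R != 0 :> K).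
Hypotheses (dK0 : dK 0 = 0) (dK1 : dK 1 = 0).
Variables (a w c : K) (N : nat).
Hypothesis conn : jtheta sK dK mu c = 0.
Local Notation jphi := (@jphi K sK dK mu a w c N).
Local Notation jb := (jb sK dK mu a w c).
Local Notation jh := (@jh K sK dK mu a w c N).
Local Notation deg := (@mdeg N).

Lemma jc_conn k j : jc sK dK mu c k j = (k == j)%:R.
Proof.
elim: k j => [|k IHk] j; first by case: j.
have dd (b : bool) : dK b%:R = 0 by case: b.
rewrite [LHS]/= conn mulr0 add0r IHk dd add0r.
rewrite (_ : (if j is i.+1 then _ else 0) = (k.+1 == j)%:R); last by case: j => // j; rewrite IHk.
by have [->|] := eqVneq k j; rewrite ?subrr ?mul0r ?mulr0 addr0.
Qed.

Lemma jh_conn i : jh i = 'X_i + (jb i)%:MP.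
Proof.
rewrite /jh (bigD1 i)//= jc_conn eqxx scale1r big1 ?addr0// => j ji.
by rewrite jc_conn -[_ == _](inj_eq val_inj) in ji *; rewrite eq_sym (negbTE ji) scale0r.
Qed.

Local Notation lin := (fun i : 'I_N => (jb i)%:MP : {mpoly K[N]}).

(** The substitution is now a translation, hence compatible with the filtration by total degree, and
    [taylor_mon] applies to that measure. *)
Lemma jphi_mon_conn m : lowered deg 2 (jphi 'X_[m] - ('X_[m] + mder lin 'X_[m])) (deg m).
Proof.
have lin1 (i : 'I_N) : lowered deg 1 (lin i) (deg U_(i)%MM).
  by rewrite mdeg1 => m'; rewrite msuppC; case: ifP => // _; rewrite inE => /eqP -> /=; rewrite mdeg0.
have h : lowered deg 3 (jphi 'X_[m] - taylor2 lin (fun=> 0) 'X_[m]) (deg m).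
  apply: taylor_mon => //.
  - by move=> i; rewrite mderC; exact: drop0.
  - by move=> i; exact: drop0.
  by move=> i; rewrite jh_conn mderC scaler0 !addr0 subrr; exact: drop0.
rewrite (_ : _ - _ = jphi 'X_[m] - taylor2 lin (fun=> 0) 'X_[m] +
  2%:R^-1 *: mder lin (mder lin 'X_[m])); last first.
  rewrite /taylor2 (_ : mder (fun=> 0) _ = 0) ?addr0; last first.
    by rewrite /mder big1// => i _; rewrite mul0r.
  by apply/esym; rewrite opprD addrA subrK.
apply: dropD; first by apply: (@dropW _ _ _ 3).
apply: dropZ; have X1 : lowered deg 1 (mder lin 'X_[m]) (deg m).
  by apply: lowered_mder => //; exact: dropX.
move=> m' mQ; have m0 : (0 < mdeg m)%N.
  apply: contraT; rewrite -eqn0Ngt mdeg_eq0 => /eqP m0; move: mQ.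
  by rewrite m0 mpolyX0 -mpolyC1 mderC mder0 msupp0.
suff /(_ m' mQ) : lowered deg 1 (mder lin (mder lin 'X_[m])) (mdeg m).-1 by move=> /=; lia.
by apply: lowered_mder => // m2 /X1 /=; lia.
Qed.

Lemma jphi_lowered_conn m : lowered deg 1 (jphi 'X_[m] - 'X_[m]) (deg m).
Proof.
rewrite (_ : _ - _ = jphi 'X_[m] - ('X_[m] + mder lin 'X_[m]) + mder lin 'X_[m]); last first.
  by rewrite opprD addrA subrK.
apply: dropD; first by apply: (@dropW _ _ _ 2) => //; exact: jphi_mon_conn.
apply: lowered_mder; last exact: dropX.
by move=> i m'; rewrite msuppC; case: ifP => // _; rewrite inE => /eqP -> /=; rewrite mdeg0 mdeg1.
Qed.

Lemma jphi_coef_conn Q d M : lowered deg 0 Q d -> (deg M).+1 = d -> Q@_M = 0 ->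
  (jphi Q)@_M = \sum_(i < N) jb i * (Q^`M(i))@_M.
Proof.
move=> Qd Md QM; have -> : \sum_(i < N) jb i * (Q^`M(i))@_M = (Q + mder lin Q)@_M.
  rewrite mcoeffD QM add0r raddf_sum; apply: eq_bigr => i _.
  by rewrite mul_mpolyC /= mcoeffZ.
have -> : Q + mder lin Q = \sum_(m <- msupp Q) Q@_m *: ('X_[m] + mder lin 'X_[m]).
  by under eq_bigr do rewrite scalerDr; rewrite big_split /= -mpolyE -mderE.
rewrite jphi_sum !raddf_sum /=; apply: eq_big_seq => m mQ; rewrite !mcoeffZ.
congr (_ * _); apply/eqP; rewrite -subr_eq0 -mcoeffB; apply/eqP.
by apply: (drop_coef (@jphi_mon_conn m)); have /= := Qd _ mQ; lia.
Qed.

Variables (P : {mpoly K[N]}) (W : nat).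
Hypothesis EP : eigen sK dK mu a w c P W.
Hypothesis alt : (forall k x, (0 < k)%N -> mu ^+ k * sK x = x -> x = 0) \/ mu = 1.

(** Compare coefficients at a monomial [M] just below the top degree: the translations enter with
    factors [kap i], the coefficients at [M] of the partial derivatives of the top part. In the
    first alternative all top monomials have weight [W], so a single index contributes; when
    [mu = 1] several may, and the largest is normalised. *)
Lemma affine_coboundary_ex : exists j q (beta : nat -> K),
  [/\ forall i, sK (beta i) = beta i,
      mu = 1 \/ forall i, (i < j)%N -> beta i = 0 &
      mu ^+ j.+1 * sK q = q + (jb j + \sum_(i < j) beta i * jb i)].
Proof.
have [_ PW W0 [mW mWP mWW]] := EP.
have P0 : P != 0 by apply: contraTneq mWP => ->; rewrite msupp0.
pose D := (msize P).-1.
have PD : lowered deg 0 P D.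
  by move=> m /msize_mdeg_lt /=; rewrite addn0 /D; lia.
have [mD mDP mDD] : exists2 m, m \in msupp P & mdeg m = D.
  by exists (mlead P); rewrite ?mlead_supp// /D -mlead_deg.
have D0 : (0 < D)%N.
  have /= := PD _ mWP; rewrite addn0; apply: leq_trans; rewrite lt0n mdeg_eq0.
  by apply: contraTneq W0 => m0; rewrite -mWW m0 mnmwgt0.
set Q := mtop deg D P.
have Qdeg m : m \in msupp Q -> mdeg m = D by move/mtop_ge.
have QD : lowered deg 0 Q D by move=> m /mtop_ge ->; rewrite addn0.
have QP m : m \in msupp Q -> Q@_m = P@_m.
  by move=> mQ; rewrite mcoeff_mtop /= Qdeg// eqxx.
have top m : m \in msupp Q -> Q@_m = mu ^+ (W - mnmwgt m) * sK Q@_m.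
  by move=> mQ; rewrite QP// -(eigen_top mu0 EP jphi_lowered_conn PD (Qdeg _ mQ)).
have fix1 m : sK Q@_m = Q@_m /\ (mu = 1 \/ (m \in msupp Q -> mnmwgt m = W)).
  case: alt => [inj|mu1]; last first.
    split; last by left.
    have [mQ|mQ] := boolP (m \in msupp Q); last by rewrite memN_msupp_eq0// rmorph0.
    by rewrite [RHS]top// mu1 expr1n mul1r.
  have wW : m \in msupp Q -> mnmwgt m = W.
    move=> mQ; have mP : m \in msupp P by move: (mQ); rewrite !mcoeff_msupp QP.
    have /= := PW _ mP; rewrite addn0 leq_eqVlt => /predU1P[//|lt].
    by have := mQ; rewrite mcoeff_msupp (inj _ _ _ (esym (top _ mQ))) ?eqxx// subn_gt0.
  split; last by right.
  have [mQ|mQ] := boolP (m \in msupp Q); last by rewrite memN_msupp_eq0// rmorph0.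
  by rewrite [RHS]top// wW// subnn mul1r.
have [i0] : exists i, Q^`M(i) != 0.
  apply: (@nonconst_mderiv _ _ _ deg D mD) => //.
  by rewrite mcoeff_msupp mcoeff_mtop /= mDD eqxx -mcoeff_msupp.
rewrite -msupp_eq0 -size_eq0; case E: (msupp _) => [//|M s] _.
pose kap (i : 'I_N) := (Q^`M(i))@_M.
have ki0 : kap i0 != 0 by rewrite /kap -mcoeff_msupp E mem_head.
have kapQ i : kap i != 0 -> (M + U_(i))%MM \in msupp Q.
  by rewrite /kap mcoeff_deriv mcoeff_msupp; apply: contraNneq => ->; rewrite mul0rn.
have skap i : sK (kap i) = kap i.
  by rewrite /kap mcoeff_deriv rmorphMn /= (fix1 _).1.
have MD : ((mdeg M).+1 = D)%N.
  by rewrite -(Qdeg _ (kapQ _ ki0)) mdegD mdeg1 addn1.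
case: (@arg_maxnP _ i0 (fun i => kap i != 0) (fun i : 'I_N => val i) ki0) => j kj jmax.
have MQ : Q@_M = 0 by rewrite mcoeff_mtop /= ltn_eqF// -MD.
have PM : P@_M = mu ^+ (W - mnmwgt M) * sK P@_M + \sum_(i < N) jb i * kap i.
  rewrite {1}(eigen_step mu0 EP jphi_lowered_conn PD (M := M)) ?(jphi_coef_conn QD)//=.
    by rewrite -MD.
  by move=> m /PD /=; lia.
(* Unless [mu = 1], the monomial [M + U_(j)] has weight [W]. *)
have muj : mu ^+ (W - mnmwgt M) = mu ^+ j.+1.
  case: (fix1 (M + U_(j))%MM) => _ [->|/(_ (kapQ _ kj))]; first by rewrite !expr1n.
  by rewrite mnmwgtD mnmwgt1 => <-; rewrite addKn.
exists (val j), (- P@_M / kap j), (fun i => if insub i is Some i' then kap i' / kap j else 0).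
split.
- move=> i; case: insub => [i'|]; last exact: rmorph0.
  by rewrite rmorphM fmorphV !skap.
- have [mu1|mu1] := eqVneq mu 1; [by left | right=> i ij].
  have kW i' : kap i' != 0 -> (mnmwgt M + i'.+1 = W)%N.
    move=> ki; case: (fix1 (M + U_(i'))%MM) => _ [/eqP|/(_ (kapQ _ ki))].
      by rewrite (negbTE mu1).
    by rewrite mnmwgtD mnmwgt1.
  case: insubP => // i' _ iE; have [->|ki] := eqVneq (kap i') 0; first by rewrite mul0r.
  by have := kW _ ki; have := kW _ kj; rewrite -iE in ij; move: ij => /=; lia.
rewrite rmorphM fmorphV rmorphN /= skap !mulrA mulrN -muj.
have -> : mu ^+ (W - mnmwgt M) * sK P@_M = P@_M - \sum_(i < N) jb i * kap i.
  by rewrite {2}PM addrK.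
rewrite opprB mulrBl mulNr addrC; congr (_ + _).
rewrite (bigID (fun i : 'I_N => (i <= j)%N))/= [X in _ + X]big1 ?addr0; last first.
  move=> i; rewrite -ltnNge => ji; have [->|/jmax] := eqVneq (kap i) 0; first by rewrite mulr0.
  by move=> /=; rewrite [(_ <= _)%N]leqNgt ji.
rewrite (bigD1 j)//= mulrDl mulfK//; congr (_ + _); rewrite mulr_suml.
rewrite (big_ord_widen N (fun i => (if insub i is Some i' then kap i' / kap j else 0) * jb i))//; last exact: ltnW.
apply: eq_big => [i|i _]; first by rewrite ltn_neqAle andbC -(inj_eq val_inj).
by rewrite valK [RHS]mulrC mulrA.
Qed.
End Translation.

Lemma minimal_ex T (E : T -> Prop) (m : T -> nat) x0 : E x0 ->
  exists2 x, E x & forall y, E y -> (m x <= m y)%N.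
Proof.
move=> Ex0; have ex : exists n, `[< exists2 x, E x & m x = n >].
  by exists (m x0); apply/asboolP; exists x0.
case: (ex_minnP ex) => n /asboolP[x Ex <-] nmin; exists x => // y Ey.
by apply: nmin; apply/asboolP; exists y.
Qed.

Section TopWeight.
Variables (K : fieldType) (N : nat).
Implicit Types P : {mpoly K[N]}.

Definition topwgt P := (\max_(m <- msupp P) mnmwgt m)%N.

Lemma topwgt_lowered P : lowered (@mnmwgt N) 0 P (topwgt P).
Proof. by move=> m mP; rewrite addn0 /topwgt; apply: (leq_bigmax_seq (F := @mnmwgt N)). Qed.

Lemma topwgt_le P W : lowered (@mnmwgt N) 0 P W -> (topwgt P <= W)%N.
Proof. by move=> PW; apply/bigmax_leqP_seq => m /PW; rewrite addn0. Qed.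

Lemma topwgt_mem P : P != 0 -> exists2 m, m \in msupp P & mnmwgt m = topwgt P.
Proof.
rewrite -msupp_eq0 -size_eq0; case E: (msupp P) => [//|m0 s] _; rewrite -E.
have [m mP wm] := @minimal_ex _ (fun m => m \in msupp P) (fun m => topwgt P - mnmwgt m)%N m0
  (ltac:(by rewrite E mem_head)).
exists m => //; apply/eqP; rewrite eqn_leq; have /= := topwgt_lowered mP; rewrite addn0 => -> /=.
by apply: topwgt_le => m' m'P; have := wm _ m'P; have /= := topwgt_lowered m'P;
  have /= := topwgt_lowered mP; lia.
Qed.
End TopWeight.

(** * Minimal relations *)

Section Relation.
Variables (K L : fieldType) (iota : {rmorphism K -> L}).
Variables (sK : {rmorphism K -> K}) (sL : {rmorphism L -> L}).
Variables (dK : K -> K) (dL : L -> L) (mu : K).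
Hypotheses (iota_s : forall x, sL (iota x) = iota (sK x))
  (iota_d : forall x, dL (iota x) = iota (dK x))
  (dLD : {morph dL : x y / x + y}) (dLM : forall x y, dL (x * y) = dL x * y + x * dL y)
  (d_s : forall x, dL (sL x) = iota mu * sL (dL x)) (mu0 : mu != 0)
  (K2 : 2%:R != 0 :> K).
Variables (f : L) (a w c : K).
Hypotheses (f0 : f != 0) (a0 : a != 0) (sf : sL f = iota a * f).
Variable N : nat.
Local Notation R := {mpoly K[N]}.
Local Notation jS := (@jS K sK dK mu a w c N).
Local Notation jev := (@jev K L iota dL f w c N).
Local Notation jphi := (@jphi K sK dK mu a w c N).
Local Notation wgt := (@mnmwgt N).

Lemma jSZ x P : jS (x *: P) = sK x *: jS P.
Proof. by rewrite /jS mmapZ /= mul_mpolyC. Qed.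

Lemma jS_top P W : lowered wgt 0 P W ->
  lowered wgt 0 (jS P) W /\ forall M, mnmwgt M = W -> (jS P)@_M = mu ^- W * sK P@_M.
Proof.
move=> PW; have low m : lowered wgt 1 (jphi 'X_[m] - 'X_[m]) (wgt m).
  by apply: jphi_lowered => //; [exact: jdK0 iota_d dLD | exact: jdK1 iota_d dLM].
split=> [|M MW].
  rewrite jS_sum; rewrite big_seq; apply: drop_sum => m mP; apply: dropZ => m' m'P.
  suff h : lowered wgt 0 (jphi 'X_[m]) (wgt m).
    by apply: leq_trans (h _ m'P) _; rewrite -[wgt m]addn0 PW.
  rewrite -[jphi _](subrK 'X_[m]); apply: dropD; last exact: dropX.
  by apply: (@dropW _ _ _ 1).
rewrite jS_sum raddf_sum /=.
rewrite (eq_big_seq (fun m => sK P@_m * mu ^- mnmwgt m * (m == M)%:R)) => [|m mP]; last first.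
  rewrite mcoeffZ -[jphi _](subrK 'X_[m]) mcoeffD mcoeffX (drop_coef (@low m)) ?add0r//.
  by have /= := PW _ mP; rewrite MW; lia.
have [MP|MP] := boolP (M \in msupp P).
  rewrite (bigD1_seq M)//= ?msupp_uniq// eqxx mulr1 MW mulrC big1 ?addr0// => m mM.
  by rewrite (negbTE mM) mulr0.
rewrite (memN_msupp_eq0 MP) rmorph0 mulr0 big1_seq// => m /andP[_ mP].
by case: eqP mP => [->|]; rewrite ?(negbTE MP)// mulr0.
Qed.

Local Notation jev_poly := (map_poly (mmap iota (fun i : 'I_N => ujet iota dL f w c i))).

Definition relation (p : {poly R}) :=
  p != 0 /\ (jev_poly p).[f] = 0.

(** The relation obtained by applying [sigma] to [p(f) = 0] and writing [a f] for [sigma f]. *)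
Definition twist (p : {poly R}) : {poly R} := \poly_(i < size p) (a ^+ i *: jS p`_i).

Lemma horner_twist p :
  (jev_poly p).[f] = 0 ->
  (jev_poly (twist p)).[f] = 0.
Proof.
move=> p0; rewrite (@horner_coef_wide _ (size p)); last first.
  by apply: leq_trans (size_poly _ _) (size_poly _ _).
transitivity (sL (jev_poly p).[f]).
  rewrite (@horner_coef_wide _ (size p)) ?size_poly// rmorph_sum.
  apply: eq_bigr => i _; rewrite !coef_map coef_poly ltn_ord /= mmapZ rmorphM !rmorphXn /= sf.
  rewrite -/(jev (jS p`_i)) (jev_S iota_s iota_d dLD dLM d_s mu0 w c f0 a0 sf).
  by rewrite exprMn mulrCA mulrA.
by rewrite p0 rmorph0.
Qed.

(** Minimise in turn the degree in [f], the top weight of the leading coefficient, and the number of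
    its monomials of that weight. With [lam] cancelling one of these, [p - lam twist p] still
    vanishes at [f]; if nonzero, it would have the same degree and top weight but fewer top
    monomials. *)
Lemma minimal_relation p0 : relation p0 -> exists2 p, relation p &
  exists lam, p = lam%:MP *: twist p.
Proof.
move=> R0.
pose lw (p : {poly R}) := topwgt (lead_coef p).
have [p1 R1 min1] := minimal_ex (fun p : {poly R} => size p) R0.
have [p2 [R2 s2] min2] := @minimal_ex _ (fun p => relation p /\ size p = size p1) lw p1
  (conj R1 erefl).
pose cnt (p : {poly R}) := size (msupp (mtop wgt (lw p) (lead_coef p))).
have [p [Rp sp lp] min3] := @minimal_ex _
  (fun p => [/\ relation p, size p = size p1 & lw p = lw p2]) cnt p2 (And3 R2 s2 erefl).
exists p => //; have [p_neq0 pf] := Rp.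
set P := lead_coef p; have P0 : P != 0 by rewrite lead_coef_eq0.
have [M MP MW] := topwgt_mem P0.
have [JW Jtop] := jS_top (@topwgt_lowered _ _ P).
set d := (size p).-1.
pose lam := P@_M / (a ^+ d * (mu ^- topwgt P * sK P@_M)).
have PM0 : P@_M != 0 by rewrite -mcoeff_msupp.
have den0 : a ^+ d * (mu ^- topwgt P * sK P@_M) != 0.
  by rewrite !mulf_neq0 ?invr_eq0 ?expf_neq0 ?fmorph_eq0.
exists lam; apply/eqP; rewrite -subr_eq0; set y := p - _.
apply: contraT => y0.
have yf : (jev_poly y).[f] = 0.
  by rewrite rmorphB /= map_polyZ hornerD hornerN hornerZ pf horner_twist// mulr0 subrr.
have sy : size y = size p1.
  apply/eqP; rewrite eqn_leq; apply/andP; split; last by apply: min1; split.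
  rewrite -sp; apply: leq_trans (size_polyD _ _) _; rewrite geq_max leqnn size_polyN /=.
  by apply: leq_trans (size_scale_leq _ _) (size_poly _ _).
have s0 : (d < size p)%N by rewrite /d prednK// lt0n size_poly_eq0.
have yE : lead_coef y = P - (lam * a ^+ d) *: jS P.
  rewrite lead_coefE sy -sp coefB coefZ coef_poly s0 mul_mpolyC scalerA.
  by rewrite /P lead_coefE.
have yW : lowered wgt 0 (lead_coef y) (topwgt P).
  by rewrite yE; apply: dropB; [exact: topwgt_lowered | exact: dropZ].
have lwy : lw y = lw p.
  apply/eqP; rewrite eqn_leq topwgt_le//= lp; apply: min2; split=> //; by split.
have : (cnt p <= cnt y)%N by apply: min3; rewrite lwy.
rewrite leqNgt => /negP[]; rewrite /cnt lwy.
(* In top weight [jS] acts monomial by monomial, so no new monomial appears. *)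
have sub : {subset M :: msupp (mtop wgt (lw p) (lead_coef y)) <= msupp (mtop wgt (lw p) P)}.
  move=> m; rewrite inE => /predU1P[->|].
    by rewrite mcoeff_msupp mcoeff_mtop /= MW eqxx.
  rewrite !mcoeff_msupp !mcoeff_mtop /=; have [mW|_] := eqVneq (mnmwgt m) (lw p); last by rewrite eqxx.
  rewrite yE mcoeffB mcoeffZ Jtop//.
  by apply: contraNneq => ->; rewrite rmorph0 !mulr0 subrr.
have un : uniq (M :: msupp (mtop wgt (lw p) (lead_coef y))).
  rewrite /= msupp_uniq andbT mcoeff_msupp mcoeff_mtop /= MW eqxx negbK yE mcoeffB mcoeffZ Jtop//.
  by rewrite -mulrA /lam divfK// subrr.
exact: (uniq_leq_size un sub).
Qed.

(** The identity [p = lam twist p] holds coefficient by coefficient. A coefficient of positive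
    weight becomes an eigenvector once scaled to have a top coefficient 1. If there is none, the
    coefficients lie in [K], and the quotient of two of them solves [sigma x = a^n x]. *)
Lemma eigen_ex p : relation p ->
  (exists n x, [/\ (0 < n)%N, x != 0 & sK x = a ^+ n * x]) \/
  (exists P W, eigen sK dK mu a w c (P : R) W).
Proof.
move=> /minimal_relation[{}p [p0 pf] [lam pE]].
have pi i : p`_i = (lam * a ^+ i) *: jS p`_i.
  have [ip|pi] := ltnP i (size p).
    by rewrite {1}pE coefZ coef_poly ip mul_mpolyC scalerA.
  by rewrite nth_default// /jS rmorph0 scaler0.
have [[i pi0]|const] := pselect (exists i, (0 < topwgt p`_i)%N).
  right; have Pn0 : p`_i != 0.
    by apply: contraTneq pi0 => ->; rewrite /topwgt msupp0 big_nil.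
  have [M MP MW] := topwgt_mem Pn0; set P := p`_i in pi0 Pn0 MP MW *.
  have PM0 : P@_M != 0 by rewrite -mcoeff_msupp.
  have [_ Jtop] := jS_top (@topwgt_lowered _ _ P).
  exists ((P@_M)^-1 *: P), (topwgt P); split=> //.
  - have /(congr1 (fun Q => Q@_M)) := pi i; rewrite mcoeffZ Jtop//.
    move=> PM; have lam0 : lam * a ^+ i != 0.
      by apply: contraNneq PM0 => l0; rewrite -/P PM l0 mul0r.
    have -> : jS ((P@_M)^-1 *: P) = (sK P@_M)^-1 *: ((lam * a ^+ i)^-1 *: P).
      have PE : P = (lam * a ^+ i) *: jS P := pi i.
      rewrite jSZ fmorphV; congr (_ *: _).
      by rewrite [in RHS]PE scalerA mulVf// scale1r.
    rewrite !scalerA {2}[P@_M]PM -/P; congr (_ *: _).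
    have muW : mu ^+ topwgt P != 0 by exact: expf_neq0.
    by rewrite [in RHS]invfM [(mu ^- _ * _)^-1]invfM invrK mulrCA mulKf// mulrC.
  - by apply: dropZ; exact: topwgt_lowered.
  - by exists M => //; rewrite mcoeff_msupp mcoeffZ mulf_neq0 ?invr_eq0.
left; have pC i : p`_i = ((p`_i)@_0%MM)%:MP.
  apply/mpolyP => m; rewrite mcoeffC; have [<-|m0] := eqVneq 0%MM m; first by rewrite mulr1.
  rewrite mulr0; apply/memN_msupp_eq0/negP => /topwgt_lowered /=; rewrite addn0.
  case: (posnP (topwgt p`_i)) => [->|pos]; last by case: const; exists i.
  rewrite leqn0 /mnmwgt sum_nat_eq0 => /forallP z; case/eqP: m0; apply/mnmP => k.
  by have := z k; rewrite /= muln_eq0 orbF mnm0E => /eqP.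
have pev : \sum_(i < size p) iota (p`_i)@_0%MM * f ^+ i = 0.
  rewrite -[RHS]pf (@horner_coef_wide _ (size p)) ?size_poly//; apply: eq_bigr => i _.
  by rewrite coef_map /= {2}pC mmapC.
pose x i := (p`_i)@_0%MM.
have xE i : x i = lam * a ^+ i * sK (x i).
  rewrite /x; have /(congr1 (fun Q : R => Q@_0%MM)) := pi i.
  by rewrite {2}pC /jS mmapC mcoeffZ mcoeffC eqxx mulr1.
set d := (size p).-1.
have d0 : (d < size p)%N by rewrite /d prednK// lt0n size_poly_eq0.
have xd : x d != 0.
  have : lead_coef p != 0 by rewrite lead_coef_eq0.
  by rewrite lead_coefE [p`_d]pC mpolyC_eq0.
(* A single term cannot vanish at the nonzero [f]. *)
have [i id xi] : exists2 i : nat, (i < d)%N & x i != 0.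
  apply: contrapT => nx; move/eqP: pev; apply/negP.
  rewrite (bigD1 (Ordinal d0))//= big1 => [|i ni].
    by rewrite addr0 mulf_neq0 ?expf_neq0// fmorph_eq0.
  have id : (i < d)%N.
    rewrite ltn_neqAle -ltnS /d prednK ?lt0n ?size_poly_eq0// ltn_ord andbT.
    by rewrite -[_ == _](inj_eq val_inj) in ni.
  have [->|xi] := eqVneq ((p`_i)@_0%MM) 0; first by rewrite rmorph0 mul0r.
  by case: nx; exists i.
exists (d - i)%N, (x i / x d); split; first by rewrite subn_gt0.
  by rewrite mulf_neq0 ?invr_eq0.
have lam0 : lam != 0 by apply: contraNneq xd => l0; rewrite xE l0 !mul0r.
rewrite fmorph_div [in X in _ = _ * X](xE i) [in X in _ = _ * X](xE d).
have sxd : sK (x d) != 0 by rewrite fmorph_eq0.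
rewrite (_ : a ^+ d = a ^+ (d - i) * a ^+ i); last by rewrite -exprD subnK // ltnW.
have ai k : a ^+ k != 0 by exact: expf_neq0.
by field; rewrite sxd lam0 !ai.
Qed.
End Relation.

(** * From ordinary derivatives to jets *)

Section Conversion.
Variables (K L : fieldType) (iota : {rmorphism K -> L}).
Variables (dK : K -> K) (dL : L -> L).
Hypotheses (iota_d : forall x, dL (iota x) = iota (dK x))
  (dLD : {morph dL : x y / x + y}) (dLM : forall x y, dL (x * y) = dL x * y + x * dL y).
Variables (f : L) (w c : K).
Hypotheses (f0 : f != 0).
Variables (der : L -> L) (e : K) (e0 : e != 0).
Hypothesis derE : forall x, der x = iota e * dL x.
Variable N : nat.
Local Notation R := {mpoly K[N]}.
Local Notation u := (ujet iota dL f w c).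
Local Notation jev := (@jev K L iota dL f w c N).

(** The subalgebra generated by the jets of index below [k]. It records the triangular form of the
    derivatives: [f^(k+1) / f] is [u_k] times a nonzero element of [K], plus a polynomial in earlier
    jets. *)
Inductive jsub (k : nat) : R -> Prop :=
| JsubC x : jsub k x%:MP
| JsubX i : (i < k)%N -> (i < N)%N -> jsub k (jet N K i)
| JsubD p q : jsub k p -> jsub k q -> jsub k (p + q)
| JsubM p q : jsub k p -> jsub k q -> jsub k (p * q).

Lemma jsubW k l p : (k <= l)%N -> jsub k p -> jsub l p.
Proof.
move=> kl; elim=> [x|i ik iN|p1 q1 _ h1 _ h2|p1 q1 _ h1 _ h2].
- exact: JsubC.
- by apply: JsubX => //; apply: leq_trans ik kl.
- exact: JsubD.
- exact: JsubM.
Qed.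

Lemma jev_jet i : (i < N)%N -> jev (jet N K i) = u i.
Proof. by move=> iN; rewrite -[ i ]/(val (Ordinal iN)) jetE /jev mmapX mmap1U. Qed.
Lemma jevC x : jev x%:MP = iota x. Proof. by rewrite /jev mmapC. Qed.
Lemma jevD p q : jev (p + q) = jev p + jev q. Proof. exact: rmorphD. Qed.
Lemma jevM p q : jev (p * q) = jev p * jev q. Proof. exact: rmorphM. Qed.

Lemma dL_jet i : dL (u i) = u i.+1 - iota (i.+1%:R * c) * u i.
Proof. by rewrite /= addrK. Qed.

Lemma jsub_deriv k p : (k < N)%N -> jsub k p ->
  exists2 q, jsub k.+1 q & dL (jev p) = jev q.
Proof.
move=> kN; elim=> [x|i ik iN|p1 q1 s1 [p' s1' e1] s2 [q' s2' e2]|p1 q1 s1 [p' s1' e1] s2 [q' s2' e2]].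
- by exists (dK x)%:MP; [exact: JsubC | rewrite !jevC iota_d].
- have i1N : (i.+1 < N)%N by apply: leq_ltn_trans ik kN.
  exists (jet N K i.+1 + (- (i.+1%:R * c))%:MP * jet N K i).
    by apply: JsubD; [exact: JsubX | apply: JsubM; [exact: JsubC | apply: JsubX => //; exact: ltnW]].
  by rewrite jevD jevM !jev_jet// dL_jet jevC rmorphN mulNr.
- by exists (p' + q'); [exact: JsubD | rewrite !jevD dLD e1 e2].
- have W := jsubW (leqnSn k).
  exists (p' * q1 + p1 * q'); first by apply: JsubD; apply: JsubM => //; exact: W.
  by rewrite jevD !jevM dLM e1 e2.
Qed.

Lemma der_iter k : (k < N)%N -> exists alpha q, [/\ alpha != 0, jsub k q &
  iter k.+1 der f = f * (iota alpha * u k + jev q)].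
Proof.
have df : dL f = f * (u 0%N + iota w) by rewrite /= subrK mulrCA mulfV// mulr1.
elim: k => [|k IHk] kN.
  exists e, (e * w)%:MP; split=> //; first exact: JsubC.
  by rewrite [iter _ _ _]/= derE df jevC rmorphM; ring.
have [alpha [q [al0 sq E]]] := IHk (ltnW kN).
have [q' sq' E'] := jsub_deriv (ltnW kN) sq.
have n0 : (0 < N)%N by apply: leq_ltn_trans kN.
exists (e * alpha), (e%:MP * ((jet N K 0 + w%:MP) * (alpha%:MP * jet N K k + q) +
  (dK alpha - alpha * (k.+1%:R * c))%:MP * jet N K k + q')).
split; first exact: mulf_neq0.
  have W := jsubW (leqnSn k).
  have X0 : jsub k.+1 (jet N K 0) by apply: JsubX.
  have Xk : jsub k.+1 (jet N K k) by apply: JsubX => //; exact: ltnW.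
  by do ?[exact: JsubC | exact: W | apply: JsubD | apply: JsubM].
rewrite iterS E derE dLM df dLD E' dLM iota_d dL_jet.
rewrite jevM !jevD !jevM !jevD jevM !jevC !jev_jet// ?(ltnW kN)//.
by rewrite !(rmorphM, rmorphB) /=; ring.
Qed.

Lemma jsub_ext (S : comNzRingType) (eps : {rmorphism K -> S}) (y y' : nat -> S) k p :
  jsub k p -> (forall i, (i < k)%N -> y i = y' i) ->
  mmap eps (fun i : 'I_N => y i) p = mmap eps (fun i : 'I_N => y' i) p.
Proof.
move=> sp yy; elim: sp => [x|i ik iN|p1 q1 _ h1 _ h2|p1 q1 _ h1 _ h2].
- by rewrite !mmapC.
- by rewrite -[ i ]/(val (Ordinal iN)) jetE !mmapX !mmap1U /= yy.
- by rewrite !rmorphD /= h1 h2.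
- by rewrite !rmorphM /= h1 h2.
Qed.

(* Substitutes f for the first variable and f (alpha_k u_k + q_k) for the others. *)
Definition jsubst (al : 'I_N -> K) (q : 'I_N -> R) (i : 'I_N.+1) : {poly R} :=
  if unlift ord0 i is Some k then 'X * (((al k)%:MP * 'X_k + q k)%:P) else 'X.

(** The triangular system is solved for the jets one at a time, so the substitution attains any
    values with nonzero first coordinate. *)
Lemma jsubst_generic (S : fieldType) (eps : {rmorphism K -> S}) (X : 'I_N.+1 -> S) al q :
  (forall k, al k != 0) -> (forall k : 'I_N, jsub k (q k)) -> X ord0 != 0 ->
  exists psi : {rmorphism {poly R} -> S},
    forall P, psi (mmap (polyC \o @mpolyC N K) (jsubst al q) P) = mmap eps X P.
Proof.
move=> al0 sq X0.
have [y Hy] : exists y : nat -> S, forall k : 'I_N,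
    eps (al k) * y k + mmap eps (fun i : 'I_N => y i) (q k) = X (lift ord0 k) / X ord0.
  suff H l : (l <= N)%N -> exists y : nat -> S, forall k : 'I_N, (k < l)%N ->
      eps (al k) * y k + mmap eps (fun i : 'I_N => y i) (q k) = X (lift ord0 k) / X ord0.
    by have [y Hy] := H N (leqnn N); exists y => k; apply: Hy.
  elim: l => [|l IHl] lN; first by exists (fun=> 0).
  have [y Hy] := IHl (ltnW lN); pose kl := Ordinal lN.
  pose y' i := if i == l then
    (X (lift ord0 kl) / X ord0 - mmap eps (fun i : 'I_N => y i) (q kl)) / eps (al kl) else y i.
  have yy i : (i < l)%N -> y i = y' i by move=> il; rewrite /y' ltn_eqF.
  exists y' => k; rewrite ltnS leq_eqVlt => /predU1P[kE|kl'].
    have -> : k = kl by apply: val_inj.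
    rewrite -(jsub_ext eps (sq kl) yy) /y' /= eqxx.
    by rewrite mulrC divfK ?subrK// fmorph_eq0.
  rewrite -(jsub_ext eps (sq k) (y := y)) => [|i ik].
    by rewrite -yy// Hy.
  by apply: yy; apply: ltn_trans ik kl'.
pose ev := mmap eps (fun i : 'I_N => y i).
pose psi : {rmorphism {poly R} -> S} := horner_eval (X ord0) \o map_poly ev.
exists psi; apply: (@mmap_ext _ _ _ (psi \o mmap (polyC \o @mpolyC N K) (jsubst al q))
  (mmap eps X)) => [x|i].
  by rewrite /psi /= !mmapC /= /horner_eval map_polyC hornerC /= /ev mmapC.
rewrite /psi /= !mmapX !mmap1U /horner_eval /jsubst; case: unliftP => [k|] -> /=.
  rewrite rmorphM /= map_polyX map_polyC /= hornerM hornerX hornerC.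
  by rewrite /ev rmorphD rmorphM /= mmapC mmapX mmap1U Hy mulrC divfK.
by rewrite map_polyX hornerX.
Qed.

Lemma relation_ex (P : {mpoly K[N.+1]}) : P != 0 ->
  mmap iota (fun i : 'I_N.+1 => iter i der f) P = 0 ->
  exists p : {poly R}, relation iota dL f w c p.
Proof.
move=> P0 Pf.
have [al Hal] := choice (fun k : 'I_N => der_iter (ltn_ord k)).
have [q Hq] := choice Hal.
pose p : {poly R} := mmap (polyC \o @mpolyC N K) (jsubst al q) P.
exists p; split; last first.
  rewrite -[RHS]Pf /p; pose ev := mmap iota (fun i : 'I_N => u i).
  pose psi1 : {rmorphism {mpoly K[N.+1]} -> L} :=
    horner_eval f \o (map_poly ev \o mmap (polyC \o @mpolyC N K) (jsubst al q)).
  apply: (@mmap_ext _ _ _ psi1 (mmap iota (fun i : 'I_N.+1 => iter i der f))).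
    move=> x; rewrite /psi1 /= !mmapC /= /horner_eval map_polyC hornerC /= /ev mmapC//.
  move=> i; rewrite /psi1 /= !mmapX !mmap1U /horner_eval /jsubst; case: unliftP => [k|] -> /=.
    rewrite rmorphM /= map_polyX map_polyC /= hornerM hornerX hornerC.
    have [_ _ E] := Hq k; rewrite [RHS]E -/(jev _) jevD jevM jevC; congr (f * (_ * _ + _)).
    by rewrite /jev mmapX mmap1U.
  by rewrite map_polyX hornerX.
pose eps : {rmorphism K -> {fraction {mpoly K[N.+1]}}} :=
  @tofrac {mpoly K[N.+1]} \o @mpolyC N.+1 K.
have X0 : @tofrac {mpoly K[N.+1]} 'X_(@ord0 N) != 0.
  by rewrite tofrac_eq0 -msupp_eq0 msuppX -size_eq0.
have al0 k : al k != 0 by case: (Hq k).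
have sq (k : 'I_N) : jsub k (q k) by case: (Hq k).
(* Independent variables as values: no nonzero polynomial vanishes there, so the substitution is
   injective. *)
have [psi psiE] := @jsubst_generic _ eps (fun i => tofrac 'X_i) al q al0 sq X0.
apply: contraNneq P0 => p0; rewrite -tofrac_eq0.
have -> : tofrac P = mmap eps (fun i => tofrac 'X_i) P.
  apply: (@mmap_ext _ _ _ (@tofrac {mpoly K[N.+1]}) (mmap eps (fun i => tofrac 'X_i))) => [x|i].
    by rewrite /= mmapC.
  by rewrite /= mmapX mmap1U.
by rewrite -psiE -/p p0 rmorph0.
Qed.
End Conversion.

(** * Proof of the theorem *)

Section Equation.
Variable C : numClosedFieldType.
Local Notation K := {fraction {poly C}}.
Local Notation L := (laurent C).
Local Notation DK := (@frac_deriv C).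

Lemma linfD_D : {morph @linfD C : x y / x + y}.
Proof. by move=> x y; rewrite /linfD lderivD mulrDr. Qed.

Lemma linfD_M (x y : L) : linfD (x * y) = linfD x * y + x * linfD y.
Proof. by rewrite /linfD lderivM; ring. Qed.

Lemma lderiv_linfD (x : L) : lderiv x = Tinf C (- kX C ^+ 2) * linfD x.
Proof.
rewrite rmorphN rmorphXn /= TinfX /linfD mulrA mulrNN -exprMn mulVf ?expr1n ?mul1r//.
exact: lT_neq0.
Qed.

Variables (F : K) (m : nat) (v0 : C).
Hypothesis FZ : zero_at0 (Tinf C F)^-1 m v0.
Local Notation G := (Tinf C F)^-1.
Local Notation mu := (DK F).
Local Notation sg := (sig FZ).

Lemma linfD_comp (x : L) : linfD (lcomp x G) = Tinf C mu * lcomp (linfD x) G.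
Proof.
have [_ v00 Gl] := FZ; have FT : Tinf C F != 0.
  by rewrite -invr_eq0; exact: lead_neq0 Gl v00.
have -> : lcomp (linfD x) G = - G ^+ 2 * lcomp (lderiv x) G.
  rewrite /linfD (lcompM FZ); congr (_ * _).
  by rewrite [LHS](rmorphN (lcomp_rmorph FZ)) rmorphXn /= (lcompT FZ).
rewrite Tinf_deriv /linfD (lcomp_deriv FZ) lderivV; field.
exact: FT.
Qed.

Lemma frac_natr_neq0 k : k.+1%:R != 0 :> K.
Proof. by rewrite -(rmorph_nat (@kC C)) fmorph_eq0 pnatr_eq0. Qed.

Definition eigen_constant := forall (h : L) kap, h != 0 -> lcomp h G = lC kap * h ->
  exists c, h = lC c.

(** Subtracting its leading coefficient from [h] gives another eigenvector, whose order would have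
    to be 0 although that coefficient has been cancelled. *)
Lemma eigen_constantI : (forall (h : L) kap a c, lead h a c -> c != 0 ->
  lcomp h G = lC kap * h -> a = 0 /\ kap = 1) -> eigen_constant.
Proof.
move=> ord h kap h0 hG; have [a [c [c0 l]]] := lead_ex h0.
have [a0 k1] := ord _ _ _ _ l c0 hG; rewrite {}a0 in l; rewrite {}k1 rmorph1 mul1r in hG.
exists c; apply/eqP; rewrite -subr_eq0; apply/negPn/negP => d0.
have [b [e [e0 l']]] := lead_ex d0.
have [|b0 _] := ord _ 1 _ _ l' e0; first by rewrite (lcompB FZ) (lcompC FZ) hG rmorph1 mul1r.
by have := lead_uniq l'; rewrite b0 => /(_ _ (leadB l (lead_lC c))); rewrite subrr; move/eqP: e0.
Qed.

Lemma eigen_constant_superattracting : (1 < m)%N -> eigen_constant.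
Proof.
move=> m2; have [_ v00 _] := FZ.
apply: eigen_constantI => h kap a c l c0 hG; have k0 : kap != 0.
  apply: contraNneq c0 => k0; have h0 : lcomp h G = 0 by rewrite hG k0 rmorph0 mul0r.
  have := fmorph_eq0 (lcomp_rmorph FZ) h; rewrite /= h0 eqxx => /esym/eqP h0'.
  by case: l => _ <-; rewrite h0'.
have l2 := leadM (lead_lC kap) l; rewrite -hG in l2.
have [E1 E2] := lead_order (lead_comp FZ l) l2 (mulf_neq0 c0 (expfz_neq0 _ v00)) (mulf_neq0 k0 c0).
have a0 : a = 0 by move: E1; rewrite add0r; nia.
split=> //; move: E2; rewrite a0 expr0z mulr1 => /esym/eqP.
by rewrite -subr_eq0 -{2}[c]mul1r -mulrBl mulf_eq0 (negbTE c0) orbF subr_eq0 => /eqP.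
Qed.

Lemma eigen_constant_parabolic p r : (0 < p)%N -> r != 0 -> lead (G - lT C) (p%:Z + 1) r ->
  eigen_constant.
Proof.
move=> p0 r0 Gp; apply: eigen_constantI => h kap a c l c0 hG.
have l2 := tangent_comp p0 Gp l; rewrite hG -{2}[h]mul1r -(rmorph1 (@lC C)) -mulrBl -rmorphB in l2.
have k1 : kap - 1 = 0.
  apply/eqP/negPn/negP => k1; have [E _] := lead_order (leadM (lead_lC (kap - 1)) l) (leadM (lead_lC (kap - 1)) l) (mulf_neq0 k1 c0) (mulf_neq0 k1 c0).
  have := lead_van_le (leadM (lead_lC (kap - 1)) l) (mulf_neq0 k1 c0) l2.1; lia.
split; last by apply/eqP; rewrite -subr_eq0 k1.
move: l2; rewrite k1 rmorph0 mul0r => /lead_uniq/(_ (lead0 _ _))/eqP.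
by rewrite !mulf_eq0 (negbTE r0) (negbTE c0) !orbF intr_eq0 => /eqP.
Qed.

(** At infinity the orders give [m (a - k) + k = a], so [a = k], and then the leading coefficients
    give [m^k = 1]. *)
Lemma pull_superattracting k (x : K) : (1 < m)%N -> (0 < k)%N -> mu ^+ k * sg x = x -> x = 0.
Proof.
move=> m2 k0 E; apply/eqP/negPn/negP => x0; have [_ v00 _] := FZ.
have x1 : Tinf C x != 0 by rewrite fmorph_eq0.
have [a [c [c0 l]]] := lead_ex x1.
have := pull_inf FZ k l; rewrite E => l2.
have m0 : m%:R != 0 :> C by rewrite pnatr_eq0; lia.
have [E1 E2] := lead_order l2 l (mulf_neq0 (mulf_neq0 (expf_neq0 _ m0) c0) (expfz_neq0 _ v00)) c0.
have ak : a = k by nia.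
move: E2; rewrite ak subrr expr0z mulr1 => /eqP; rewrite -subr_eq0 -{2}[c]mul1r -mulrBl.
rewrite mulf_eq0 (negbTE c0) orbF subr_eq0 -natrX pnatr_eq1 => /eqP mk.
by have := ltn_expl k m2; lia.
Qed.

Section Solution.
Hypothesis EC : eigen_constant.
Variables (f : L) (a : K).
Hypotheses (f0 : f != 0) (a0 : a != 0) (fa : lcomp f G = Tinf C a * f).

Lemma sig_const (x : K) : sg x = x -> exists c, x = kC c.
Proof.
have [->|x0] := eqVneq x 0; first by exists 0; rewrite rmorph0.
move=> xs; have x1 : Tinf C x != 0 by rewrite fmorph_eq0.
have [|c] := EC (kap := 1) x1; first by rewrite rmorph1 mul1r -(sig_inf FZ) xs.
by rewrite -TinfC => /fmorph_inj ->; exists c.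
Qed.

Definition power_rational := exists2 N : nat, (0 < N)%N & exists b, f ^+ N = Tinf C b.

(** Composition multiplies [f^N / x] by the constant [kap]. *)
Lemma power_rationalI N (x : K) kap : (0 < N)%N -> x != 0 -> sg x * kC kap = a ^+ N * x ->
  power_rational.
Proof.
move=> N0 x0 sx; have x1 : Tinf C x != 0 by rewrite fmorph_eq0.
have k0 : kap != 0.
  apply: contraTneq (mulf_neq0 (expf_neq0 N a0) x0) => k0.
  by rewrite -sx k0 rmorph0 mulr0 eqxx.
have [||c E] := EC (h := f ^+ N / Tinf C x) (kap := kap).
- by rewrite mulf_neq0 ?invr_eq0 ?expf_neq0.
- have fN : lcomp (f ^+ N) G = Tinf C a ^+ N * f ^+ N.
    by rewrite [LHS](rmorphXn (lcomp_rmorph FZ)) /= fa exprMn.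
  have aE : Tinf C a ^+ N = Tinf C (sg x) * lC kap / Tinf C x.
    by rewrite -TinfC -rmorphM sx rmorphM rmorphXn mulfK.
  have s1 : Tinf C (sg x) != 0 by rewrite !fmorph_eq0.
  by rewrite (lcompM FZ) (lcompV FZ) fN -(sig_inf FZ) aE; field; rewrite s1 x1.
exists N => //; exists (kC c * x); rewrite rmorphM TinfC -E divfK//.
Qed.

Lemma root_coboundary_power : root_coboundary FZ a -> power_rational.
Proof.
move=> [N N0 [kap [b [b0 E]]]]; apply: (@power_rationalI N b kap) => //.
by rewrite E mulrC mulrA divfK.
Qed.

Variables (n : nat) (P : {mpoly K[n.+1]}).
Hypotheses (P0 : P != 0) (Pf : mmap (Tinf C) (fun i : 'I_n.+1 => iter i (@lderiv C) f) P = 0).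

Lemma eigen_jets w c : power_rational \/
  exists (P : {mpoly K[n]}) W, eigen sg DK mu a w c P W.
Proof.
have e0 : - kX C ^+ 2 != 0.
  by rewrite oppr_eq0; apply: expf_neq0; rewrite tofrac_eq0 polyX_eq0.
have lD x : linfD (Tinf C x) = Tinf C (DK x) by rewrite Tinf_deriv.
have [p Rp] := relation_ex lD linfD_D linfD_M w c f0 e0 lderiv_linfD P0 Pf.
have iS x : lcomp_rmorph FZ (Tinf C x) = Tinf C (sg x) by rewrite /= (sig_inf FZ).
have := @eigen_ex _ _ (Tinf C) sg (lcomp_rmorph FZ) DK (@linfD C) mu iS lD linfD_D linfD_M
  linfD_comp (mu_neq0 FZ) (frac_natr_neq0 1) f a w c f0 a0 fa n p Rp.
case=> [[N [x [N0 x0 sx]]]|[Q [W EQ]]]; [left | by right; exists Q, W].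
by apply: (@power_rationalI N x 1) => //; rewrite rmorph1 mulr1.
Qed.
End Solution.
End Equation.

(** * Parabolic, superattracting and translation cases *)

Section Cases.
Variable C : numClosedFieldType.
Local Notation K := {fraction {poly C}}.
Local Notation L := (laurent C).
Local Notation DK := (@frac_deriv C).

Variables (F : K) (m : nat) (v0 : C).
Hypothesis FZ : zero_at0 (Tinf C F)^-1 m v0.
Local Notation G := (Tinf C F)^-1.
Local Notation mu := (DK F).
Local Notation sg := (sig FZ).
Hypothesis EC : eigen_constant F.
Variables (f : L) (a : K).
Hypotheses (f0 : f != 0) (a0 : a != 0) (fa : lcomp f G = Tinf C a * f).
Variables (n : nat) (P : {mpoly K[n.+1]}).
Hypotheses (P0 : P != 0) (Pf : mmap (Tinf C) (fun i : 'I_n.+1 => iter i (@lderiv C) f) P = 0).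
Local Notation pr := (power_rational f).

Let mu0 : mu != 0 := mu_neq0 FZ.

Lemma jb_dlog_iter c j : jtheta sg DK mu c = 0 -> jb sg DK mu a 0 c j = dlog_iter c (DK a / a) j.
Proof.
move=> th; elim: j => [|j IHj]; first by rewrite /= rmorph0 mulr0 subrr subr0.
by rewrite [LHS]/= IHj th add0r.
Qed.

Section DegreeTwo.
Variables (A Q : {poly C}).
Hypotheses (Q0 : Q != 0) (AQ : coprimep A Q) (FE : F = tofrac A / tofrac Q) (d2 : (2 < size A)%N).

(** The eigenvector for [w = 0] either settles the matter or supplies the [w] for which the second
    eigenvector is formed. *)
Lemma connection_ex : (forall x, mu * sg x = x -> x = 0) ->
  pr \/ exists g, mu * sg g = g + rho F.
Proof.
move=> inj1.
have [?|[P1 [W1 E1]]] := eigen_jets FZ EC f0 a0 fa P0 Pf 0 0; first by left.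
have [conn|[g gE]|[lam [w [lam0 slam jb0]]]] := eigen_trichotomy mu0 (@frac_natr_neq0 C) (@frac_derivD C)
  (@frac_derivM C) (frac_deriv0 C) (frac_deriv1 C) E1; first by right.
  left; apply: (@root_coboundary_power _ _ _ _ FZ EC _ _ f0 a0 fa).
  exact: (@log_coboundary _ _ _ _ FZ _ _ Q0 AQ FE d2 a g a0 gE).
have [l lE] := sig_const EC slam.
have dlam : DK lam = 0 by rewrite lE frac_derivC.
have [?|[P2 [W2 E2]]] := eigen_jets FZ EC f0 a0 fa P0 Pf w 0; first by left.
have [conn|[q qE]] := connection_or_projective mu0 (@frac_natr_neq0 C) (@frac_derivD C) (@frac_derivM C)
  (frac_deriv0 C) (frac_deriv1 C) dlam E2 slam lam0 jb0 inj1; right; first exact: conn.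
exact: (projective_connection Q0 AQ FE d2 qE).
Qed.

(** Without invariant connections there are no invariant 1-forms either, by [fixed_connection]; this
    is the injectivity that [connection_ex] asks for. *)
Lemma power_parabolic p r : (0 < p)%N -> r != 0 -> lead (G - lT C) (p%:Z + 1) r -> pr.
Proof.
move=> p0 r0 Gp.
have noconn g : mu * sg g = g + rho F -> False.
  by move=> gE; exact: (conn_parabolic Q0 AQ FE d2 gE p0 r0 Gp).
have inj1 x : mu * sg x = x -> x = 0.
  move=> xE; apply/eqP/negPn/negP => x0; apply: (noconn (- DK x / x)).
  exact: (fixed_connection mu0 (@frac_derivM C) (sig_deriv FZ) x0 xE).
by have [|[g /noconn]] := connection_ex inj1.
Qed.

Lemma power_superattracting : (1 < m)%N -> pr.
Proof.
move=> m2.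
have inj k x : (0 < k)%N -> mu ^+ k * sg x = x -> x = 0 by exact: pull_superattracting.
have [x /(inj 1%N x isT)//|//|[c cE]] := connection_ex.
have Q1 := conn_superattracting Q0 AQ FE d2 cE m2.
have th : jtheta sg DK mu c = 0 := jtheta_connection cE.
have [//|[P1 [W1 E1]]] := eigen_jets FZ EC f0 a0 fa P0 Pf 0 c.
have [j [q [beta [sb alt qE]]]] := affine_coboundary_ex mu0 (@frac_natr_neq0 C) (frac_deriv0 C)
  (frac_deriv1 C) th E1 (or_introl inj).
have b0 i : (i < j)%N -> beta i = 0.
  case: alt => [mu1|]; last by apply.
  have := inj 1%N 1 isT; rewrite expr1 mu1 rmorph1 mulr1 => /(_ erefl)/eqP.
  by rewrite oner_eq0.
apply: (@root_coboundary_power _ _ _ _ FZ EC _ _ f0 a0 fa).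
pose nu x := 1 - Tloc x c (-1).
have [ord ordP] := loc_order a0.
have nuo y x e v : lies_over F y x e v -> nu y = e%:R * nu x.
  by move=> o; rewrite /nu -[LHS]opprB (conn_over Q0 AQ FE d2 cE o) -mulrN opprB.
have nopole y e v : ~ pole_at F y e v.
  move=> /(root_pole FZ FE); move/eqP: Q1 => /size_poly1P[k k0 ->].
  by rewrite hornerC; apply/eqP.
(* Points of angle 0 form a finite backward-closed set, so each is totally ramified; a polynomial
   has at most one such finite point, which is therefore fixed. *)
have nu0 y x e v : lies_over F y x e v -> nu x = 0 -> [/\ y = x, e = (size A).-1 & (1 < (size A).-1)%N].
  have [s sP] := conn_support c.
  pose B x := nu x = 0.
  have Bs z : B z -> z \in s.
    by move=> Bz; apply/negPn/negP => /sP; rewrite /B /nu in Bz *; move=> z0;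
       move: Bz; rewrite z0 subr0 => /eqP; rewrite oner_eq0.
  have Bc : backward_closed F B by move=> y' x' e' v' /nuo; rewrite /B => -> ->; rewrite mulr0.
  have tot z : B z -> exists x v, lies_over F z x (size A).-1 v.
    by move=> /(backward_closed_total FZ Q0 AQ FE Bs Bc)[x' [v' [_ o]]]; exists x', v'.
  move=> o Bx; have By : B y by exact: Bc o Bx.
  have [x1 [v1 o1]] := tot _ By; have [x2 [v2 o2]] := tot _ Bx.
  split; last by lia.
    exact: (totally_ramified_uniq FZ Q0 AQ FE d2 Q1 o1 o2).
  by have [] := over_uniq o o1.
apply: (@affine_coboundary _ _ _ _ FZ c nu a ord _ ordP (size A).-1 _ nopole _ nuo nu0 j q 0).
- by move=> x; rewrite /nu opprB addrC subrK; exact: (conn_loc Q0 AQ FE d2 cE).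
- exact: (no_backward_deg FZ Q0 AQ FE d2).
- by move=> s E; exact: (rational_weights FZ Q0 AQ FE d2).
- rewrite qE jb_dlog_iter// big1 ?addr0// => i _.
  by rewrite b0 ?mul0r.
- by move=> x; rewrite rmorph0.
Qed.
End DegreeTwo.

(** Here [mu = 1], so the zero connection is invariant and every angle is 1. *)
Lemma power_translation k : k != 0 -> F = kX C + kC k -> pr.
Proof.
move=> k0 FE.
have mu1 : mu = 1.
  apply: (fmorph_inj (Tinf C)); rewrite Tinf_deriv FE rmorphD TinfX TinfC rmorph1 linfD_D /linfD.
  by rewrite lderiv_lC mulr0 addr0 lderivV lderiv_lT; field; exact: lT_neq0.
have rho0 : jrho DK mu = 0 by rewrite /jrho mu1 frac_deriv1 mul0r.
have th : jtheta sg DK mu 0 = 0 by rewrite jtheta0 rho0 oppr0.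
have [//|[P1 [W1 E1]]] := eigen_jets FZ EC f0 a0 fa P0 Pf 0 0.
have [j [q [beta [sb _ qE]]]] := affine_coboundary_ex mu0 (@frac_natr_neq0 C) (frac_deriv0 C)
  (frac_deriv1 C) th E1 (or_intror mu1).
apply: (@root_coboundary_power _ _ _ _ FZ EC _ _ f0 a0 fa).
have [ord ordP] := loc_order a0.
have o1 y : lies_over F (y - k) y 1 1 := over_translation y FE.
have oE y x e v : lies_over F y x e v -> x = y + k /\ e = 1%N.
  by move=> o; have := o1 (y + k); rewrite addrK => /(over_uniq o).
have nopole y e v : ~ pole_at F y e v.
  by move=> p; have := o1 (y + k); rewrite addrK => h; exact: (over_pole FZ h p).
have cnu x : lead (Tloc x (0 : K)) (-1) (1 - 1) by rewrite rmorph0 subrr; exact: lead0.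
apply: (@affine_coboundary _ _ _ _ FZ 0 (fun=> 1) a ord cnu ordP 1%N _ nopole _ _ _ j q
  (\sum_(i < j) beta i * jb sg DK mu a 0 0 i)).
- exact: no_backward_translation k0 FE.
(* Along [x, x - k, x - 2k, ...] the function [E] changes by integers and finally leaves its finite
   support. *)
- move=> s E Es Ee x.
  have Ez (i : nat) : exists z : int, E x = E (x - i%:R * k) + z%:~R.
    elim: i => [|i [z IHz]]; first by exists 0; rewrite mul0r subr0 addr0.
    have [z' E'] := Ee _ _ _ _ (o1 (x - i%:R * k)).
    exists (z' + z); rewrite IHz -[X in X + _ = _]mul1r E' -natr1 mulrDl mul1r opprD !addrA.
    by rewrite rmorphD /= addrA.
  have [i xi] := translate_notin x s k0.
  have [z Exz] := Ez i; exists 1%N => //; exists z.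
  by rewrite mulr1 Exz (Es _ xi) add0r.
- by move=> y x e v /oE[_ ->]; rewrite mulr1.
- by move=> y x e v _ /eqP; rewrite oner_eq0.
- by rewrite qE jb_dlog_iter.
(* The [beta i] are constants and the [i]-th jet constant has poles of order at most
   [i + 1 <= j]. *)
- move=> x; rewrite rmorph_sum; apply: van_sum => i _.
  have [c ->] := sig_const EC (sb i).
  rewrite rmorphM TlocC jb_dlog_iter//.
  have [v _] := leadM (lead_lC c) (lead_dlog_iter cnu ordP x i).
  by apply: vanish_belowW v; have := ltn_ord i; lia.
Qed.
End Cases.

(** * Reduction to infinity and to an iterate *)

Section Final.
Variable C : numClosedFieldType.
Local Notation K := {fraction {poly C}}.
Local Notation L := (laurent C).

Lemma power_rational_ex (F : K) m v0 (FZ : zero_at0 (Tinf C F)^-1 m v0) (f : L) (a : K) n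
    (P : {mpoly K[n.+1]}) :
  (1 < m)%N \/ (exists p r, [/\ (0 < p)%N, r != 0 & lead ((Tinf C F)^-1 - lT C) (p%:Z + 1) r]) ->
  f != 0 -> a != 0 -> lcomp f (Tinf C F)^-1 = Tinf C a * f ->
  P != 0 -> mmap (Tinf C) (fun i : 'I_n.+1 => iter i (@lderiv C) f) P = 0 ->
  power_rational f.
Proof.
move=> FT f0 a0 fa P0 Pf; have [A [Q [Q0 AQ FE]]] := frac_coprime F.
have EC : eigen_constant F.
  case: FT => [m2|[p [r [p0 r0 Gp]]]]; first exact: (eigen_constant_superattracting FZ m2).
  exact: (eigen_constant_parabolic FZ p0 r0 Gp).
have [d2|d1] := ltnP 2 (size A).
  case: FT => [m2|[p [r [p0 r0 Gp]]]].
    exact: (power_superattracting FZ EC f0 a0 fa P0 Pf Q0 AQ FE d2 m2).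
  exact: (power_parabolic FZ EC f0 a0 fa P0 Pf Q0 AQ FE d2 p0 r0 Gp).
(* Degree one: [F] is affine with [m = 1], tangency to the identity makes it a translation, and
   [r != 0] makes it nontrivial. *)
have [m0 v00 _] := FZ.
have lF := lead_inf_F FZ; have vi : v0^-1 != 0 by rewrite invr_eq0.
have A0 : A != 0.
  by apply/eqP => A0; move: lF; rewrite FE A0 rmorph0 mul0r rmorph0 => /lead_uniq/(_ (lead0 _ _))/eqP;
    apply/negP.
have lcA : lead_coef A != 0 by rewrite lead_coef_eq0.
have lcQ : lead_coef Q != 0 by rewrite lead_coef_eq0.
have lAQ := lead_div (lead_inf_poly A) (lead_inf_poly Q) lcQ.
rewrite -fmorph_div -FE in lAQ.
have [E1 E2] := lead_order lF lAQ vi (mulf_neq0 lcA (invr_neq0 lcQ)).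
have sQ : (0 < size Q)%N by rewrite lt0n size_poly_eq0.
have [sA2 sQ1 m1] : [/\ size A = 2, size Q = 1%N & m = 1%N].
  by move: d1 m0 sQ E1; move: (size A) (size Q) => sA sq; clear; split; lia.
case: FT => [|[p [r [p0 r0 Gp]]]]; first by rewrite m1.
have v1 : v0 = 1.
  have [_ _ Gl] := FZ; rewrite m1 in Gl.
  exact: (lead_uniq Gl (tangent_lead p0 Gp)).
have [q q0 QE] : exists2 q, q != 0 & Q = q%:P by apply/size_poly1P/eqP.
have Aq : A`_1 / q = 1.
  by move: E2; rewrite v1 invr1 !lead_coefE sA2 sQ1 QE coefC eqxx => ->.
have AE : A = A`_1 *: 'X + (A`_0)%:P.
  apply/polyP => -[|[|i]]; rewrite coefD coefZ coefX coefC /= ?mulr0 ?mulr1 ?add0r ?addr0//.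
  by rewrite nth_default// sA2.
have FE' : F = kX C + kC (A`_0 / q).
  have tA : tofrac A = kC A`_1 * kX C + kC A`_0 by rewrite {1}AE tofracD -mul_polyC tofracM.
  have k1 (x y : C) : kC x / kC y = kC (x / y) by rewrite fmorph_div.
  by rewrite FE tA QE -[tofrac q%:P]/(kC q) mulrDl mulrAC !k1 Aq rmorph1 mul1r.
have k0 : A`_0 / q != 0.
  apply: contraNneq r0 => k0; move: Gp; rewrite FE' k0 rmorph0 addr0 TinfX invrK subrr.
  by move=> /lead_uniq/(_ (lead0 _ _)) ->.
exact: (power_translation FZ EC f0 a0 fa P0 Pf k0 FE').
Qed.

Lemma inv_nconst x : (kX C)^-1 != kC x.
Proof.
apply/eqP => /(congr1 (Tinf C)); rewrite fmorphV /= TinfX invrK TinfC => /(congr1 (fun h : L => h 1)).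
by rewrite (lead_lT C).2 lCE => /eqP; rewrite oner_eq0.
Qed.

Definition inversion : {rmorphism K -> K} := sval (frac_eval (kap := @kC C) inv_nconst).

Lemma inversionX : inversion (kX C) = (kX C)^-1.
Proof. exact: (svalP (frac_eval (kap := @kC C) inv_nconst)).1. Qed.
Lemma inversionC c : inversion (kC c) = kC c.
Proof. exact: (svalP (frac_eval (kap := @kC C) inv_nconst)).2. Qed.

Lemma Tinf_inversion q : Tinf C (inversion q) = expand q.
Proof.
apply: (@frac_ext _ _ (Tinf C \o inversion) (@expand C)) => [|c] /=.
  by rewrite inversionX fmorphV /= TinfX invrK expand_poly.
by rewrite inversionC TinfC expand_poly.
Qed.

Lemma expand_inversion q : expand (inversion q) = Tinf C q.
Proof.
rewrite -Tinf_inversion; congr (Tinf C _).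
apply: (@frac_ext _ _ (inversion \o inversion) idfun) => [|c] /=.
  by rewrite inversionX fmorphV /= inversionX invrK.
by rewrite !inversionC.
Qed.

Section Iterates.
Variables (H : L) (w : C).
Hypothesis HZ : zero_at0 H 1 w.

Lemma literate_zero j : zero_at0 (literate j H) 1 (w ^+ j).
Proof.
elim: j => [|j IHj]; first by split; rewrite ?oner_neq0//; exact: lead_lT.
by have := zero_at0_comp IHj HZ; rewrite expr1z -exprSr.
Qed.

Lemma lcomp_literate (iter_sig : {rmorphism K -> K}) (f : L) (a : K) j :
  (forall q, Tinf C (iter_sig q) = lcomp (Tinf C q) H) -> lcomp f H = Tinf C a * f ->
  exists b, lcomp f (literate j H) = Tinf C b * f.
Proof.
move=> sH fa; elim: j => [|j [b IHj]]; first by exists 1; rewrite rmorph1 mul1r lcomp_lT.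
exists (iter_sig b * a).
by rewrite -[literate j.+1 H]/(lcomp _ H) -(lcompA _ (literate_zero j) HZ) IHj (lcompM HZ) fa
  rmorphM sH mulrA.
Qed.

Lemma literate_Tinf (iter_sig : {rmorphism K -> K}) j :
  (forall q, Tinf C (iter_sig q) = lcomp (Tinf C q) H) ->
  exists F, Tinf C F = (literate j H)^-1.
Proof.
move=> sH; elim: j => [|j [F IHj]]; first by exists (kX C); exact: TinfX.
by exists (iter_sig F); rewrite sH IHj (lcompV HZ).
Qed.
End Iterates.

Lemma diff_algebraic_power (R : K) (R0 : R != 0) (RV : has_value0 (expand R) 0)
    (dR : exists r : C, has_value0 (lderiv (expand R)) r /\
       (r = 0 \/ exists2 k : nat, (0 < k)%N & k.-unity_root r))
    (R_iter : forall n : nat, (0 < n)%N -> literate n (expand R) <> lpoly 'X)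
    (f : L) (a : K) (f0 : f != 0) (fa : lcomp f (expand R) = expand a * f) n
    (P : {mpoly K[n.+1]}) :
  P != 0 -> mmap (@expand C) (fun i : 'I_n.+1 => iter i (@lderiv C) f) P = 0 ->
  exists2 N : nat, (0 < N)%N & exists b : K, f ^+ N = expand b.
Proof.
move=> P0 Pf; set H := expand R in RV dR R_iter fa.
suff [N N0 [b fN]] : power_rational f.
  by exists N => //; exists (inversion b); rewrite expand_inversion.
have H0 : H != 0 by rewrite fmorph_eq0.
have [e [w [w0 He]]] := lead_ex H0.
have e0 : 0 < e.
  rewrite ltNge; apply/negP => e0; move/eqP: w0; apply.
  by case: RV => v v0; case: (ltgtP e 0) e0 He => // [el _ [_ <-]|-> _ [_ <-]//]; apply: v.
case: e e0 He => // e; rewrite ltz_nat => e0 He.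
have HZ : zero_at0 H e w by split.
(* [F(z) = 1 / R(1/z)], the map [R] in the coordinate [z]. *)
pose F := (inversion R)^-1.
have FE : (Tinf C F)^-1 = H by rewrite fmorphV invrK Tinf_inversion.
have FZ : zero_at0 (Tinf C F)^-1 e w by rewrite FE.
have fa' : lcomp f H = Tinf C (inversion a) * f by rewrite Tinf_inversion.
have a0 : inversion a != 0.
  apply/eqP => a0; move: fa'; rewrite a0 rmorph0 mul0r => /eqP.
  by rewrite (fmorph_eq0 (lcomp_rmorph HZ)) (negbTE f0).
have P0' : map_mpoly inversion P != 0.
  apply: contraNneq P0 => /mpolyP E; apply/eqP/mpolyP => m; have := E m.
  by rewrite mcoeff_map_mpoly !mcoeff0 => /eqP; rewrite fmorph_eq0 => /eqP.
have Pf' : mmap (Tinf C) (fun i : 'I_n.+1 => iter i (@lderiv C) f) (map_mpoly inversion P) = 0.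
  rewrite -[RHS]Pf; apply: (@mmap_ext _ _ _ (mmap (Tinf C) _ \o map_mpoly inversion) (mmap (@expand C) _)).
    by move=> c; rewrite /= map_mpolyC !mmapC /= Tinf_inversion.
  by move=> i; rewrite /= map_mpolyX !mmapX !mmap1U.
have [e2|e1] := ltnP 1 e.
  by apply: (power_rational_ex FZ _ f0 a0 _ P0' Pf'); [left | rewrite FE].
have {e1} e1 : e = 1%N by lia.
subst e; have [r [rV [r0|[k k0 wk]]]] := dR.
  have := lead_deriv He; rewrite subrr => /lead_uniq/(_ rV)/eqP.
  by rewrite r0 mulr1z (negbTE w0).
have rw : r = w by have := lead_deriv He; rewrite subrr => /lead_uniq/(_ rV); rewrite mulr1z.
have wk1 : w ^+ k = 1 by apply/eqP; rewrite -rw -unity_rootE.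
have sH q : Tinf C (sig FZ q) = lcomp (Tinf C q) H by rewrite sig_inf FE.
(* The [k]-th iterate has multiplier [w^k = 1]; the equation for [f] persists, with the cocycle
   product of [a] as factor. *)
have [b fb] := lcomp_literate HZ k sH fa'.
have [Fk FkE] := literate_Tinf HZ k sH.
have GE : (Tinf C Fk)^-1 = literate k H by rewrite FkE invrK.
have LZ := literate_zero HZ k; rewrite wk1 -GE in LZ.
have b0 : b != 0.
  apply/eqP => b0; move: fb; rewrite b0 rmorph0 mul0r -GE => /eqP.
  by rewrite (fmorph_eq0 (lcomp_rmorph LZ)) (negbTE f0).
apply: (power_rational_ex LZ _ f0 b0 _ P0' Pf'); last by rewrite GE.
(* The iterate differs from the identity, so it has a first nonlinear term, which gives [p] and
   [r]. *)
right; have d0 : (Tinf C Fk)^-1 - lT C != 0.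
  by rewrite GE subr_eq0; apply/eqP; exact: R_iter.
have [e [r' [r'0 le]]] := lead_ex d0.
have e1 : 1 < e.
  have [_ _ l1] := LZ; have l2 := leadB l1 (lead_lT C); rewrite subrr in l2.
  have := lead_van_le le r'0 (lead0_van l2); clear; lia.
exists (absz (e - 1)), r'; split=> //; first by lia.
by rewrite (_ : _ + 1 = e)//; lia.
Qed.
End Final.

Theorem theoremC (K : realType) (R : {fraction {poly K[i]}})
    (R_neq0 : R != 0)
    (R0 : has_value0 (expand R) 0)
    (dR0 : exists r : K[i], has_value0 (lderiv (expand R)) r /\
       (r = 0 \/ exists2 k : nat, (0 < k)%N & k.-unity_root r))
    (R_iter : forall n : nat, (0 < n)%N -> literate n (expand R) <> lpoly 'X)
    (f : laurent K[i]) (a : {fraction {poly K[i]}})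
    (f_eq : lcomp f (expand R) = expand a * f) :
  (algebraicOver (@expand K[i]) f /\
     exists2 N : nat, (0 < N)%N &
       exists b : {fraction {poly K[i]}}, f ^+ N = expand b) \/
  diff_transcendental f.
Proof.
have [[n [P [P0 Pf]]]|] := pselect (exists (n : nat) (P : {mpoly {fraction {poly K[i]}}[n.+1]}),
  P != 0 /\ mmap (@expand K[i]) (fun i : 'I_n.+1 => iter i (@lderiv K[i]) f) P = 0); last by right.
left; have [N N0 [b fN]] : exists2 N : nat, (0 < N)%N &
    exists b : {fraction {poly K[i]}}, f ^+ N = expand b.
  have [->|f0] := eqVneq f 0; first by exists 1%N => //; exists 0; rewrite rmorph0.
  exact: (diff_algebraic_power R_neq0 R0 dR0 R_iter f0 f_eq P0 Pf).
split; last by exists N => //; exists b.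
exists ('X^N - b%:P); first by rewrite -size_poly_gt0 size_XnsubC.
by rewrite /root rmorphB /= map_polyXn map_polyC /= hornerD hornerN hornerXn hornerC fN subrr.
Qed.
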